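(* Let $G$ be a (theta, prism)-free graph, let $a\in V(G)$ and let $T$ be a smooth tree. Suppose that there exists a tame, substantial and rich $(T,a)$-strip-structure in $G$. Then there is a substantial and rich $(T,a)$-strip-structure $\zeta$ in $G$ for which $V(G)\setminus(\zeta^+(T)\cup\mathcal{J}_\zeta)$ is anticomplete to $\zeta^+(T)$.
   Context: Graphs are finite and simple; induced subgraphs identified with vertex sets; ''path'' means induced path; length = number of edges. Theta: two non-adjacent vertices joined by three internally disjoint paths of length $\geq 2$ with pairwise anticomplete interiors. Prism: two disjoint triangles $\{a_1,a_2,a_3\},\{b_1,b_2,b_3\}$ and disjoint paths $P_i$ from $a_i$ to $b_i$, with $a_ia_j,b_ib_j$ the only edges between $P_i,P_j$ ($i\ne j$). Pyramid: apex $a$, base triangle $\{b_1,b_2,b_3\}$, paths $P_i$ from $a$ to $b_i$ of length $\geq1$, otherwise disjoint, $b_ib_j$ the only edge between $P_i\setminus\{a\}$ and $P_j\setminus\{a\}$, at most one $P_i$ of length one. A vertex $p\notin\Sigma$ is a jewel for a pyramid $\Sigma$ at $b_i$ if $p$ is anticomplete to $P_i$ and $N_{P_j}(p)=N_{P_j}[b_j]$ for $j\ne i$. $a$ is trapped in an induced subgraph $H$ if all vertices at distance $\le 2$ from $a$ lie in $H$ and every neighbor of $a$ has degree two in $H$. Strip-structures: a tree $T$ is smooth if it has $\ge 3$ vertices and every vertex is a leaf or has degree $>2$ (a branch vertex). For $\eta: V(T)\cup E(T)\cup(E(T)\times V(T))\to 2^{V(G)\setminus\{a\}}$ and $S\subseteq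 V(T)$ let $\eta(S)=\bigcup_{v\in S}\eta(v)\cup\bigcup_{e\in E(T[S])}\eta(e)$, $\eta(T)=\eta(V(T))$, $\eta^+(S)=\eta(S)\cup\{a\}$; $B_\eta(v)=\bigcup_{e\ni v}\eta(e,v)$; for $e=uv$, $\eta^\circ(e)=\eta(e)\setminus(\eta(e,u)\cup\eta(e,v))$. $\eta$ is a $(T,a)$-strip-structure if: (S1) $\eta(o)$, $o\in V(T)\cup E(T)$, are pairwise disjoint; (S2) $\eta(l)=\emptyset$ for leaves $l$; (S3) $\eta(e,v)\subseteq\eta(e)$, nonempty iff $e$ is incident with $v$; (S4) for distinct $e,f$ and every $v$, $\eta(e,v)$ is complete to $\eta(f,v)$ and there are no other edges between $\eta(e),\eta(f)$; (S5) for $e=uv$, every $x\in\eta(e)$ has a path in $G[\eta(e)]$ to $\eta(e,u)$ with interior in $\eta^\circ(e)$, and likewise to $\eta(e,v)$; (S6) $\eta(v)$ is anticomplete to $\eta(e)\setminus\eta(e,v)$; (S7) every component of $G[\eta(v)]$ has a neighbor in $B_\eta(v)$; (S8) for each leaf $l$ with incident edge $e$, $a$ is complete to $\eta(e,l)$, and $a$ has no other neighbors in $\eta(T)$. For $e=uv$, an $\eta(e)$-rung is a path $P$ in $G[\eta(e)]$ such that either $|P|=1$ and $P\subseteq\eta(e,u)\cap\eta(e,v)$, or $P$ has an end in $\eta(e,u)\setminus\eta(e,v)$, an end in $\eta(e,v)\setminus\eta(e,u)$ and interior in $\eta^\circ(e)$; it is long if it has at least two vertices. $\eta$ is tame if $\eta(v)=\emptyset$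 for all $v$ and every vertex of each $\eta(e)$ lies in some $\eta(e)$-rung; substantial if for every $e$ there is a long $\eta(e)$-rung; rich if $a$ is trapped in $\eta^+(T)$ and for every leaf $l$ with incident edge $e$, $|\eta(e,l)|=1$. A seagull is $(v,e_1,e_2)$ with $e_1\ne e_2$ incident with $v$; a claw is $(v,e_1,e_2,e_3)$ with distinct $e_i$ incident with $v$. An $\eta$-pyramid at claw $(v,e_1,e_2,e_3)$ is a pyramid $\Sigma$ with apex $a$, base $b_1b_2b_3$, paths $P_1,P_2,P_3$ such that for each $i$: $b_i\in\eta(e_i,v)$, and there is a leaf $l_i$ of $T$ in the component of $T-e_i$ not containing $v$ such that, with $\Lambda_i$ the path of $T$ from $v$ to $l_i$, $P_i=\Gamma_i\cup\{a\}$ where $\Gamma_i$ is a path in $\bigcup_{e\in E(\Lambda_i)}\eta(e)$ with $\Gamma_i\cap\eta(e_i)$ a long $\eta(e_i)$-rung and $\Gamma_i\cap\eta(e)$ an $\eta(e)$-rung for every other $e\in E(\Lambda_i)$. A vertex $p\in V(G)\setminus\eta^+(T)$ is a jewel for $\eta$ at seagull $(v,e_1,e_2)$ if for some edge $e_3\notin\{e_1,e_2\}$ incident with $v$ there is an $\eta$-pyramid at $(v,e_1,e_2,e_3)$ with $b_i\in\eta(e_i,v)$ such that $p$ is a jewel for it at $b_3$. $\mathcal{J}_\eta$ is the set of all jewels for $\eta$ (at seagulls at branch vertices). *)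

(* Defs.v *)
From mathcomp Require Import all_boot.

Set Implicit Arguments.
Unset Strict Implicit.
Unset Printing Implicit Defensive.

Record sgraph := SGraph {
  svertex :> finType;
  sedge : rel svertex;
  sedge_sym : symmetric sedge;
  sedge_irrefl : irreflexive sedge
}.

Section Graphs.
Variable G : sgraph.
Implicit Types (x y : G) (A B H : {set G}) (p : seq G).

Definition nbhd x : {set G} := [set y | sedge x y].
Definition cnbhd x : {set G} := x |: nbhd x.

Definition complete A B := {in A & B, forall x y, sedge x y}.
Definition anticomplete A B := {in A & B, forall x y, ~~ sedge x y}.

(* Induced paths, as nonempty vertex sequences; the length is (size p).-1. *)
Definition ipath p :=
  [&& p != [::], uniq p &
      [forall i : 'I_(size p), forall j : 'I_(size p),
         sedge (tnth (in_tuple p) i) (tnth (in_tuple p) j)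
           == ((i.+1 == j) || (j.+1 == i))]].

(* As p is nonempty, the default values of head and last are irrelevant. *)
Definition ipath_between x y p := [&& ipath p, head x p == x & last x p == y].

Definition is_path_set A : Prop := exists2 p, ipath p & A = [set x in p].

Definition interior x y p : {set G} := [set z in p] :\: [set x; y].

Definition is_theta (x y : G) (P : 'I_3 -> seq G) : Prop :=
  [/\ x != y, ~~ sedge x y,
      forall i, ipath_between x y (P i) /\ 3 <= size (P i) &
      forall i j, i != j ->
        [disjoint interior x y (P i) & interior x y (P j)] /\
        anticomplete (interior x y (P i)) (interior x y (P j))].

Definition theta_free : Prop := forall x y P, ~ is_theta x y P.

Definition is_prism (a b : 'I_3 -> G) (P : 'I_3 -> seq G) : Prop :=
  [/\ forall i j, i != j -> sedge (a i) (a j) /\ sedge (b i) (b j),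
      forall i j, a i != b j,
      forall i, ipath_between (a i) (b i) (P i) &
      forall i j, i != j -> {in P i & P j, forall x y, x != y /\
        sedge x y = ((x == a i) && (y == a j)) || ((x == b i) && (y == b j))}].

Definition prism_free : Prop := forall a b P, ~ is_prism a b P.

Definition is_pyramid (a : G) (b : 'I_3 -> G) (P : 'I_3 -> seq G) : Prop :=
  [/\ forall i j, i != j -> sedge (b i) (b j),
      forall i, ipath_between a (b i) (P i) /\ 2 <= size (P i),
      forall i j, i != j ->
        {in [set x in P i] :\ a & [set y in P j] :\ a, forall x y,
           x != y /\ sedge x y = (x == b i) && (y == b j)} &
      forall i j, size (P i) = 2 -> size (P j) = 2 -> i = j].

Definition jewel_for (a : G) (b : 'I_3 -> G) (P : 'I_3 -> seq G)
    (i : 'I_3) (p : G) : Prop :=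
  [/\ is_pyramid a b P,
      forall j, p \notin P j,
      anticomplete [set p] [set x in P i] &
      forall j, j != i ->
        nbhd p :&: [set x in P j] = cnbhd (b j) :&: [set x in P j]].

Definition dist_le (n : nat) x y : Prop :=
  exists p, [/\ path (@sedge G) x p, last x p = y & size p <= n].

Definition trapped (a : G) H : Prop :=
  (forall x, dist_le 2 a x -> x \in H) /\
  (forall x, sedge a x -> #|nbhd x :&: H| = 2).

Definition components A : {set {set G}} :=
  equivalence_partition
    (connect [rel x y | [&& x \in A, y \in A & sedge x y]]) A.

Definition edge_set : {set {set G}} :=
  [set [set xy.1; xy.2] | xy : G * G & sedge xy.1 xy.2].

Definition del_edge (e : {e : {set G} | e \in edge_set}) : rel G :=
  [rel x y | sedge x y && ([set x; y] != val e)].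

Definition leaf x := #|nbhd x| == 1.
Definition branch x := 2 < #|nbhd x|.

Definition is_tree : Prop :=
  [/\ 0 < #|G|,
      forall x y, connect (@sedge G) x y &
      forall c, ucycle (@sedge G) c -> size c < 3].

Definition smooth_tree : Prop :=
  [/\ is_tree, 3 <= #|G| & forall x, leaf x || branch x].

End Graphs.

Notation edge G := {e : {set G} | e \in edge_set G}.

Section StripStructures.
Variables G T : sgraph.

(* A map from V(T), E(T) and E(T) x V(T) to sets of vertices of G. *)
Record strip_map := StripMap {
  sv : T -> {set G};
  se : edge T -> {set G};
  sev : edge T -> T -> {set G}
}.

Variables (a : G) (eta : strip_map).
Implicit Types (u v l : T) (e f : edge T).

Definition eta_sub (S : {set T}) : {set G} :=
  (\bigcup_(v in S) sv eta v) :|: \bigcup_(e : edge T | val e \subset S) se eta e.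

Definition eta_all : {set G} := eta_sub [set: T].
Definition eta_plus : {set G} := a |: eta_all.

Definition eta_B v : {set G} := \bigcup_(e : edge T | v \in val e) sev eta e v.

Definition eta_int e : {set G} := se eta e :\: \bigcup_(v in val e) sev eta e v.

Definition avoids_apex : Prop :=
  [/\ forall v, a \notin sv eta v,
      forall e, a \notin se eta e &
      forall e v, a \notin sev eta e v].

Definition strip1 : Prop :=
  [/\ forall u v, u != v -> [disjoint sv eta u & sv eta v],
      forall e f, e != f -> [disjoint se eta e & se eta f] &
      forall v e, [disjoint sv eta v & se eta e]].

Definition strip2 : Prop := forall l, leaf l -> sv eta l = set0.

Definition strip3 : Prop := forall e v,
  sev eta e v \subset se eta e /\ (sev eta e v != set0) = (v \in val e).

Definition strip4 : Prop := forall e f, e != f ->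
  (forall v, complete (sev eta e v) (sev eta f v)) /\
  {in se eta e & se eta f, forall x y, sedge x y ->
     exists v, x \in sev eta e v /\ y \in sev eta f v}.

Definition strip5 : Prop := forall e v, v \in val e ->
  forall x, x \in se eta e ->
  exists y p, [/\ y \in sev eta e v, ipath_between x y p,
                  [set z in p] \subset se eta e &
                  interior x y p \subset eta_int e].

Definition strip6 : Prop :=
  forall v e, anticomplete (sv eta v) (se eta e :\: sev eta e v).

Definition strip7 : Prop := forall v D, D \in components (sv eta v) ->
  exists x y, [/\ x \in D, y \in eta_B v & sedge x y].

Definition strip8 : Prop :=
  (forall l e, leaf l -> l \in val e -> complete [set a] (sev eta e l)) /\
  (forall x, x \in eta_all -> sedge a x ->
     exists l e, [/\ leaf l, l \in val e & x \in sev eta e l]).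

Definition strip_structure : Prop :=
  [/\ avoids_apex, strip1, strip2, strip3 & strip4] /\
  [/\ strip5, strip6, strip7 & strip8].

Definition rung e (A : {set G}) : Prop :=
  exists u v, val e = [set u; v] /\
  exists2 p, ipath p & A = [set x in p] /\ A \subset se eta e /\
    ((#|A| = 1 /\ A \subset sev eta e u :&: sev eta e v) \/
     (exists x y, [/\ ipath_between x y p,
                      x \in sev eta e u :\: sev eta e v,
                      y \in sev eta e v :\: sev eta e u &
                      interior x y p \subset eta_int e])).

Definition long_rung e (A : {set G}) : Prop := rung e A /\ 2 <= #|A|.

Definition tame : Prop :=
  (forall v, sv eta v = set0) /\
  (forall e x, x \in se eta e -> exists2 A, rung e A & x \in A).

Definition substantial : Prop := forall e, exists A, long_rung e A.

Definition rich : Prop :=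
  trapped a eta_plus /\
  (forall l e, leaf l -> l \in val e -> #|sev eta e l| = 1).

Definition seagull v e1 e2 : Prop :=
  [/\ e1 != e2, v \in val e1 & v \in val e2].

Definition claw v (c : 'I_3 -> edge T) : Prop :=
  injective c /\ forall i, v \in val (c i).

(* L is an induced path of the tree T, so its edges are exactly the edges of T
   contained in its vertex set. *)
Definition eta_pyramid v (c : 'I_3 -> edge T)
    (b : 'I_3 -> G) (P : 'I_3 -> seq G) : Prop :=
  [/\ claw v c, is_pyramid a b P &
      forall i, b i \in sev eta (c i) v /\
      exists (l : T) (L : seq T) (Gam : {set G}),
        [/\ leaf l /\ ~~ connect (del_edge (c i)) v l,
            ipath_between v l L,
            [set x in P i] = a |: Gam /\ is_path_set Gam,
            Gam \subset \bigcup_(e : edge T | val e \subset [set w in L]) se eta e &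
            long_rung (c i) (Gam :&: se eta (c i)) /\
            forall e, val e \subset [set w in L] -> e != c i ->
              rung e (Gam :&: se eta e)]].

Definition jewel_at v e1 e2 (p : G) : Prop :=
  [/\ p \notin eta_plus, seagull v e1 e2 &
      exists e3 (b : 'I_3 -> G) (P : 'I_3 -> seq G),
        [/\ v \in val e3, e3 \notin [:: e1; e2],
            eta_pyramid v (tnth [tuple e1; e2; e3]) b P &
            jewel_for a b P ord_max p]].

(* The set J_eta, as a predicate. *)
Definition is_jewel (p : G) : Prop :=
  exists v e1 e2, branch v /\ jewel_at v e1 e2 p.

End StripStructures.

(* Main.v *)
(* Call two vertices of eta(T) local if they lie in a common eta(e) or a common
   B_eta(v).  Choose a tame, substantial, rich strip-structure eta with eta(T)
   of maximum size, and let W be the set of vertices outside eta^+(T) that are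
   not jewels.  If a connected part of W sees a nonlocal pair, a shortest path F
   doing so is induced and only its ends see nonlocal pairs.  At any branch
   vertex w, rungs through prescribed vertices can be concatenated to a pyramid
   with apex a, and analysing F against it yields a theta, a prism, a jewel, or
   the following: on all directions at w but one, F sees exactly the base
   vertex.  Rerouting through long rungs shows that the jewels found this way
   are jewels for eta, hence excluded.  Ranging over all rungs, F together with
   possibly a piece of an old rung is a new rung of some edge e, contradicting
   the maximality of eta.  So every component of W has local attachments and can
   be absorbed into some eta(v) or eta(e); what is left of W has no neighbours. *)
Require Import Defs.
From mathcomp Require Import all_boot boolp.

Set Implicit Arguments.
Unset Strict Implicit.
Unset Printing Implicit Defensive.

(** * Induced paths, thetas and prisms *)

(** Richness enters through distance two: a vertex outside [eta_plus] sees neither [a] nor a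
    neighbour of [a]. So attachments are never adjacent to [a], and [a] can be an end of every theta
    below. The condition on leaves makes each rung at a leaf long, so no arm is a single vertex. By
    (S4) consecutive rungs fit together whichever are chosen. This freedom turns a statement about
    one pyramid into one about all of a direction at [w]: the vertex under consideration is put on
    the arm. It also separates jewels for a pyramid from jewels for [eta]: the latter need long
    first rungs on all three arms, and substantiality provides the rungs for rerouting. Maximality
    has to be spent before anything is absorbed. Adding a rung preserves tameness, on which the
    choice of rungs depends, whereas absorbed vertices need not lie on rungs. Absorption only
    enlarges the sets, so eta-pyramids survive it, and old jewels that stay outside remain
    jewels. *)

Section InducedPaths.
Variable G : sgraph.
Implicit Types (x y z : G) (p q : seq G).

Lemma sedgeC x y : sedge x y = sedge y x.
Proof. exact: sedge_sym. Qed.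

Lemma sedge_neq x y : sedge x y -> x != y.
Proof. by apply: contraTneq => ->; rewrite sedge_irrefl. Qed.

Lemma ipathP p : reflect
  [/\ p != [::], uniq p & forall x0 i j, i < size p -> j < size p ->
     sedge (nth x0 p i) (nth x0 p j) = ((i.+1 == j) || (j.+1 == i))] (ipath p).
Proof.
apply: (iffP and3P) => [[p0 Up /forallP H]|[p0 Up H]]; split=> //.
  move=> x0 i j li lj.
  have /forallP/(_ (Ordinal lj))/eqP := H (Ordinal li).
  by rewrite !(tnth_nth x0).
apply/forallP=> i; apply/forallP=> j; apply/eqP.
case: p p0 {Up} H i j => // x0 p _ H i j.
by rewrite !(tnth_nth x0) H ?ltn_ord.
Qed.

Lemma ipath_uniq p : ipath p -> uniq p.
Proof. by case/and3P. Qed.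

Lemma ipath_index p x y : ipath p -> x \in p -> y \in p ->
  sedge x y = ((index x p).+1 == index y p) || ((index y p).+1 == index x p).
Proof.
case/ipathP=> _ _ H px py.
by rewrite -[in LHS](nth_index x px) -[in LHS](nth_index x py) H ?index_mem.
Qed.

Lemma ipath1 x : ipath [:: x].
Proof. by apply/ipathP; split=> // x0 [|i] [|j] //=; rewrite sedge_irrefl. Qed.

Lemma ipath_rev p : ipath (rev p) = ipath p.
Proof.
suff H q : ipath q -> ipath (rev q).
  by apply/idP/idP=> /H; rewrite ?revK.
case/ipathP=> q0 Uq Hq; apply/ipathP; split.
- by rewrite -size_eq0 size_rev size_eq0.
- by rewrite rev_uniq.
move=> x0 i j; rewrite size_rev => li lj; rewrite !nth_rev // Hq; last 2 first.
- by rewrite subnSK // leq_subr.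
- by rewrite subnSK // leq_subr.
rewrite !subnSK // !eqn_sub2lE // 1?ltnW // orbC.
by rewrite (eq_sym j.+1) (eq_sym i.+1).
Qed.

Lemma ipath_catr p q : q != [::] -> ipath (p ++ q) -> ipath q.
Proof.
move=> q0 /ipathP[_]; rewrite cat_uniq => /and3P[_ _ Uq] H.
apply/ipathP; split=> // x0 i j li lj.
have := H x0 (size p + i) (size p + j).
rewrite size_cat !ltn_add2l !nth_cat !(ltnNge (_ + _) (size p)) !leq_addr /=.
rewrite !addKn => /(_ li lj) ->.
by rewrite -[(_ + i).+1]addnS -[(_ + j).+1]addnS !eqn_add2l.
Qed.

Lemma ipath_catl p q : p != [::] -> ipath (p ++ q) -> ipath p.
Proof.
move=> p0; rewrite -ipath_rev rev_cat => /ipath_catr; rewrite ipath_rev.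
by apply; rewrite -size_eq0 size_rev size_eq0.
Qed.

Lemma ipath_apart p x q u v :
  ipath (p ++ x :: q) -> u \in p -> v \in q -> u != v /\ ~~ sedge u v.
Proof.
move=> ip pu qv.
have U := ipath_uniq ip; move: (U); rewrite cat_uniq => /and3P[_ /hasPn nUp Uq].
have nv : v \notin p by apply: nUp; rewrite inE qv orbT.
split; first by apply: contraNneq nv => <-.
rewrite (ipath_index ip) ?mem_cat ?pu ?inE ?qv ?orbT //.
rewrite !index_cat pu (negbTE nv) /=.
have -> : (x == v) = false.
  by apply: contraTF Uq => /eqP->; rewrite /= qv.
rewrite -index_mem in pu; have lt := ltn_addr (index v q) pu.
by rewrite addnS eqSS (ltn_eqF lt) gtn_eqF // !ltnS ltnW // ltnW.
Qed.

(** Recursive form of the index-based [ipath], which makes induction on the sequence possible. *)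
Lemma ipath_cons2 x y q : ipath [:: x, y & q] =
  [&& x \notin y :: q, sedge x y, ~~ has (sedge x) q & ipath (y :: q)].
Proof.
apply/idP/idP=> [ip|/and4P[nx xy /hasPn nq /ipathP[_ U H]]].
  apply/and4P; split; first by case/andP: (ipath_uniq ip).
  - have Ux := ipath_uniq ip; rewrite (ipath_index ip) ?inE ?eqxx ?orbT //= eqxx.
    by case: (x =P y) Ux => [->|//]; rewrite /= inE eqxx.
  - apply/hasPn=> z zq.
    by have [] := @ipath_apart [:: x] y q x z ip (mem_head _ _) zq.
  by apply: (@ipath_catr [:: x]) ip.
apply/ipathP; split=> //; first by rewrite cons_uniq nx.
move=> x0 [|i] [|j] /= li lj; rewrite ?sedge_irrefl ?orbF //.
- case: j lj => [|j] lj /=; first by rewrite xy.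
  by apply/negbTE/nq/mem_nth.
- case: i li => [|i] li /=; first by rewrite sedgeC xy.
  by rewrite sedgeC; apply/negbTE/nq/mem_nth.
by rewrite [LHS](H x0 i j).
Qed.

Lemma ipath_cat x p y q :
  ipath (x :: p) -> ipath (y :: q) ->
  {in x :: p & y :: q, forall u v,
     u != v /\ sedge u v = (u == last x p) && (v == y)} ->
  ipath ((x :: p) ++ y :: q).
Proof.
elim: p x => [|z p IH] x ip iq H.
  rewrite ipath_cons2 iq andbT; apply/and3P; split.
  - by apply/negP=> /(H x x (mem_head _ _))[]; rewrite eqxx.
  - by have [_ ->] := H x y (mem_head _ _) (mem_head _ _); rewrite /= !eqxx.
  apply/hasPn=> v vq.
  have [|_ ->] := H x v (mem_head _ _); first by rewrite inE vq orbT.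
  by have := ipath_uniq iq; case: (v =P y) => [<-|]; rewrite ?andbF //= vq.
move: (ip); rewrite ipath_cons2 => /and4P[nx xz nq ip'].
have nv v : v \in y :: q -> (x != v) /\ ~~ sedge x v.
  move=> vq; have [-> ->] := H x v (mem_head _ _) vq; split=> //.
  rewrite negb_and; apply/orP; left; apply: contraNneq nx => /= ->.
  exact: mem_last.
rewrite !cat_cons ipath_cons2; apply/and4P; split=> //.
- by rewrite -cat_cons mem_cat negb_or nx; apply/negP=> /nv[]; rewrite eqxx.
- by rewrite has_cat negb_or nq; apply/hasPn=> v /nv[].
by apply: IH => // u v up; apply: H; rewrite inE up orbT.
Qed.

Lemma ipath_path x p : ipath (x :: p) -> path (@sedge G) x p.
Proof.
by elim: p x => //= y p IH x; rewrite ipath_cons2 => /and4P[_ -> _ /IH].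
Qed.

Lemma split_last (P : pred G) p : has P p ->
  exists q1 z q2, [/\ p = q1 ++ z :: q2, P z & ~~ has P q2].
Proof.
elim: p => //= x p IH.
case hp: (has P p); last first.
  by rewrite orbF => Px; exists [::], x, p; rewrite hp.
by move=> _; have [q1 [z [q2 [-> Pz nq]]]] := IH hp; exists (x :: q1), z, q2.
Qed.

Lemma split_first (P : pred G) p : has P p ->
  exists q1 z q2, [/\ p = q1 ++ z :: q2, P z & ~~ has P q1].
Proof.
rewrite -has_rev => /split_last[q1 [z [q2 [E Pz n]]]].
exists (rev q2), z, (rev q1); split=> //; last by rewrite has_rev.
by rewrite -[p]revK E rev_cat rev_cons cat_rcons.
Qed.

(** By induction the tail is already induced. If it contains [x], it is cut there; otherwise [x] is
    joined to its last neighbour on it, which removes all chords at [x]. *)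
Lemma walk_ipath x p : path (@sedge G) x p ->
  exists q, [/\ ipath (x :: q), last x q = last x p & {subset q <= p}].
Proof.
elim: p x => [|y p IH] x /=; first by exists [::]; split=> //; apply: ipath1.
case/andP=> xy /IH[q [iq lq sq]].
have sq' : {subset y :: q <= y :: p}.
  by move=> z; rewrite !inE => /orP[->//|/sq ->]; rewrite orbT.
have [xq|nxq] := boolP (x \in y :: q).
  have {}lq : last x (y :: q) = last y p by [].
  case/splitPr: xq iq lq sq' => q1 q2 iq lq sq'; exists q2; split.
  - exact: ipath_catr iq.
  - by rewrite -lq last_cat.
  by move=> z zq; apply: sq'; rewrite mem_cat inE zq !orbT.
have [|q1 [z [q2 [E xz nz]]]] := @split_last (sedge x) (y :: q).
  by rewrite /= xy.
exists (z :: q2); split.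
- rewrite ipath_cons2 xz nz (@ipath_catr q1) -?E // !andbT.
  by apply: contra nxq => h; rewrite E mem_cat h orbT.
- by rewrite -lq -[last y q]/(last x (y :: q)) E last_cat.
by move=> w wq; apply: sq'; rewrite E mem_cat wq orbT.
Qed.

Definition apart p q :=
  forall u v, u \in p -> v \in q -> u != v /\ ~~ sedge u v.

Lemma apartC p q : apart p q -> apart q p.
Proof. by move=> H u v uq vp; rewrite eq_sym sedgeC; apply: H. Qed.

Lemma walk_between x y p : x != y -> ~~ sedge x y ->
  path (@sedge G) x (rcons p y) ->
  exists q, [/\ ipath_between x y q, 3 <= size q &
                {subset interior x y q <= p}].
Proof.
move=> nxy nExy /walk_ipath[q [iq]]; rewrite last_rcons => lq sq.
exists (x :: q); split; first by rewrite /ipath_between iq /= lq !eqxx.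
- case: q lq iq {sq} => [|z [|t q]] //=; first by move=> E; rewrite E eqxx in nxy.
  by move=> ->; rewrite ipath_cons2 (negbTE nExy) andbF.
move=> z; rewrite !inE negb_or => /andP[/andP[nzx nzy]] /orP[|/sq].
  by rewrite (negbTE nzx).
by rewrite mem_rcons inE (negbTE nzy).
Qed.

(** Shortcutting a walk to an induced path only shrinks its interior, so apartness of the three
    given interiors is all that has to be checked. The paths have length at least two because the
    ends are distinct and nonadjacent. *)
Lemma theta_walks x y p1 p2 p3 : theta_free G -> x != y -> ~~ sedge x y ->
  path (@sedge G) x (rcons p1 y) -> path (@sedge G) x (rcons p2 y) ->
  path (@sedge G) x (rcons p3 y) ->
  apart p1 p2 -> apart p1 p3 -> apart p2 p3 -> False.
Proof.
move=> tf nxy nExy.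
move=> /(walk_between nxy nExy)[q1 [b1 s1 sub1]].
move=> /(walk_between nxy nExy)[q2 [b2 s2 sub2]].
move=> /(walk_between nxy nExy)[q3 [b3 s3 sub3]] A12 A13 A23.
apply: (tf x y (fun i => nth [::] [:: q1; q2; q3] i)); split=> //.
  by case=> -[|[|[|//]]].
suff H p p' q q' : {subset interior x y q <= p} ->
    {subset interior x y q' <= p'} -> apart p p' ->
    [disjoint interior x y q & interior x y q'] /\
    anticomplete (interior x y q) (interior x y q').
  by move=> [[|[|[|//]]] ?] [[|[|[|//]]] ?] //= _;
    (eapply H; [eassumption | eassumption | try eassumption]); apply: apartC.
move=> sp sp' A; split.
  rewrite disjoint_subset; apply/subsetP=> z zq; rewrite inE.
  by apply/negP=> zq'; have [] := A _ _ (sp _ zq) (sp' _ zq'); rewrite eqxx.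
by move=> u v uq vq; have [] := A _ _ (sp _ uq) (sp' _ vq).
Qed.

(** The prism condition between two of its paths, with an implication in place of the equality for
    edges, so that it passes to subsequences with the same ends. *)
Definition rungs_linked a p a' p' :=
  forall u v, u \in a :: p -> v \in a' :: p' -> u != v /\
    (sedge u v -> (u = a /\ v = a') \/ (u = last a p /\ v = last a' p')).

Lemma rungs_linkedC a p a' p' : rungs_linked a p a' p' -> rungs_linked a' p' a p.
Proof.
move=> H u v up vp; rewrite eq_sym sedgeC.
by have [-> h] := H v u vp up; split=> // /h[] []; auto.
Qed.

(** As for thetas, the walks may be shortcut: this keeps their ends, which carry the two
    triangles. *)
Lemma prism_walks a1 p1 a2 p2 a3 p3 : prism_free G ->
  path (@sedge G) a1 p1 -> path (@sedge G) a2 p2 -> path (@sedge G) a3 p3 ->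
  sedge a1 a2 -> sedge a1 a3 -> sedge a2 a3 ->
  sedge (last a1 p1) (last a2 p2) -> sedge (last a1 p1) (last a3 p3) ->
  sedge (last a2 p2) (last a3 p3) ->
  a1 != last a1 p1 -> a2 != last a2 p2 -> a3 != last a3 p3 ->
  rungs_linked a1 p1 a2 p2 -> rungs_linked a1 p1 a3 p3 ->
  rungs_linked a2 p2 a3 p3 -> False.
Proof.
move=> pf w1 w2 w3 a12 a13 a23 b12 b13 b23 n1 n2 n3 L12 L13 L23.
have [q1 [i1 l1 s1]] := walk_ipath w1.
have [q2 [i2 l2 s2]] := walk_ipath w2.
have [q3 [i3 l3 s3]] := walk_ipath w3.
pose a i := nth a1 [:: a1; a2; a3] (i : 'I_3).
pose b i := nth a1 [:: last a1 p1; last a2 p2; last a3 p3] (i : 'I_3).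
pose P i := nth [::] [:: a1 :: q1; a2 :: q2; a3 :: q3] (i : 'I_3).
have nab c p c' p' : rungs_linked c p c' p' -> c != last c' p' /\ c' != last c p.
  move=> L; have [-> _] := L c (last c' p') (mem_head _ _) (mem_last _ _).
  by have [+ _] := L (last c p) c' (mem_last _ _) (mem_head _ _); rewrite eq_sym.
have [n12 n21] := nab _ _ _ _ L12; have [n13 n31] := nab _ _ _ _ L13.
have [n23 n32] := nab _ _ _ _ L23.
apply: (pf a b P); split.
- by move=> [[|[|[|//]]] ?] [[|[|[|//]]] ?] //= _; rewrite /a /b /= 1?[sedge a2 _]sedgeC //; split=> //; rewrite sedgeC.
- by move=> [[|[|[|//]]] ?] [[|[|[|//]]] ?].
- by move=> [[|[|[|//]]] ?]; rewrite /ipath_between /a /b /P /= ?i1 ?i2 ?i3 ?l1 ?l2 ?l3 !eqxx.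
suff H c p q c' p' q' : {subset q <= p} -> {subset q' <= p'} ->
    rungs_linked c p c' p' -> sedge c c' -> sedge (last c p) (last c' p') ->
    {in c :: q & c' :: q', forall x y, x != y /\
      sedge x y = ((x == c) && (y == c')) || ((x == last c p) && (y == last c' p'))}.
  by move=> [[|[|[|//]]] ?] [[|[|[|//]]] ?] //= _;
    (eapply H; [eassumption | eassumption | | | ]); rewrite // 1?sedgeC //; apply: rungs_linkedC.
move=> sp sp' L cc ll x y xq yq.
have sc r r' (d : G) : {subset r <= r'} -> {subset d :: r <= d :: r'}.
  by move=> s z; rewrite !inE => /orP[->//|/s ->]; rewrite orbT.
have [nxy h] := L x y (sc _ _ _ sp _ xq) (sc _ _ _ sp' _ yq); split=> //.
apply/idP/orP=> [/h|]; first by case=> -[-> ->]; rewrite !eqxx; auto.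
by case=> /andP[/eqP-> /eqP->].
Qed.

Lemma head_neq_last x p : ipath (x :: p) -> p != [::] -> x != last x p.
Proof.
move=> /ipath_uniq /andP[+ _]; case: p => //= y p nx _.
by apply: contraNneq nx => ->; apply: mem_last.
Qed.

End InducedPaths.

(** * Walks and their interiors *)

Section Walks.
Variable G : sgraph.
Implicit Types (x y z c : G) (p q C D : seq G).

(** Only the interior is listed, since the interiors are what a theta requires to be apart. *)
Definition walk x p y := path (@sedge G) x (rcons p y).

Lemma walk_sym x p y : walk x p y -> walk y (rev p) x.
Proof.
rewrite /walk; have := rev_path (@sedge G) x (rcons p y).
rewrite last_rcons belast_rcons rev_cons => ->.
by rewrite (eq_path (e' := @sedge G)) // => u v; rewrite sedgeC.
Qed.

Lemma walk_cat x p y q z : walk x p y -> walk y q z -> walk x (p ++ y :: q) z.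
Proof.
rewrite /walk rcons_cat cat_path rcons_path /= => /andP[-> ->] //.
Qed.

Lemma walk_cons x p y c : sedge x c -> walk c p y -> walk x (c :: p) y.
Proof. by rewrite /walk /= => ->. Qed.

Lemma path_prefix_back b q C z D : path (@sedge G) b q -> b :: q = C ++ z :: D ->
  exists p, [/\ path (@sedge G) z p, last z p = b & z :: p =i rcons C z].
Proof.
case: C => [|c C] /= pbq [<-]; first by move=> _; exists [::].
move=> E; exists (rcons (rev C) b); split; last 2 first.
- by rewrite last_rcons.
- move=> u; rewrite !(inE, mem_rcons, mem_rev).
  by case: (u == z); case: (u == b); rewrite ?orbT.
apply: walk_sym; rewrite /walk; move: pbq.
by rewrite E -cat_rcons cat_path => /andP[].
Qed.

Lemma walk_prefix c b q C z D : path (@sedge G) b q -> sedge c b ->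
  b :: q = C ++ z :: D -> walk c C z.
Proof.
move=> pbq cb E; have: path (@sedge G) c (b :: q) by rewrite /= cb.
by rewrite E -cat_rcons cat_path => /andP[].
Qed.

Lemma apart_catl p q (r : seq G) : apart p r -> apart q r -> apart (p ++ q) r.
Proof. by move=> H K u v; rewrite mem_cat => /orP[/H|/K] h /h. Qed.

Lemma apart_catr p q (r : seq G) : apart r p -> apart r q -> apart r (p ++ q).
Proof. by move=> H K; apply/apartC/apart_catl; apply: apartC. Qed.

Lemma apart_sub p q p' q' : apart p q ->
  {subset p' <= p} -> {subset q' <= q} -> apart p' q'.
Proof. by move=> H sp sq u v /sp up /sq vq; apply: H. Qed.

Lemma uniq_cat_disj p q x y : uniq (p ++ q) -> x \in p -> y \in q -> x != y.
Proof.
rewrite cat_uniq => /and3P[_ /hasPn H _] xp /H.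
by apply: contraNneq => <-.
Qed.

Lemma last_suffix b q C z D : b :: q = C ++ z :: D -> last b q = last z D.
Proof. by move=> E; rewrite -[last b q]/(last b (b :: q)) E last_cat. Qed.

Lemma head_prefix b q C z D : b :: q = C ++ z :: D -> b \in rcons C z.
Proof. by case: C => [|c C] [-> _]; rewrite mem_head. Qed.

Lemma sub_walk y q p3 z p4 : path (@sedge G) y q -> y :: q = p3 ++ z :: p4 ->
  exists t, [/\ path (@sedge G) y t, last y t = z, size t = size p3 &
                {subset t <= q}].
Proof.
case: p3 => [_ [-> _]|c p3 + [<- Eq]]; first by exists [::].
rewrite Eq -cat_rcons cat_path => /andP[pt _]; exists (rcons p3 z).
split=> //; first by rewrite last_rcons.
  by rewrite size_rcons.
by move=> t tp; rewrite mem_cat tp.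
Qed.

End Walks.

(** * Paths attached to a pyramid *)

Section Pyramid.
Variables (G : sgraph) (a : G).
Implicit Types (b f x y z u v : G) (q s C D : seq G).

(* The arm [b :: q] is a path of the pyramid without its apex [a], listed from
   the base vertex [b] to the neighbour of [a]; arms of length at least two
   suffice, since strip-structures here produce no shorter ones. *)
Definition arm b q := [/\ ipath (b :: q), q != [::], a \notin b :: q &
  {in b :: q, forall z, sedge a z = (z == last b q)}].

(** The pyramid condition between two paths with the apex left out. *)
Definition cross b q b' q' := {in b :: q & b' :: q', forall x y,
  x != y /\ sedge x y = (x == b) && (y == b')}.

Lemma crossC b q b' q' : cross b q b' q' -> cross b' q' b q.
Proof.
by move=> H x y xq yq; have [n E] := H y x yq xq; rewrite eq_sym sedgeC andbC.
Qed.

Lemma cross_apart b q b' q' (p p' : seq G) : cross b q b' q' ->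
  {subset p <= b :: q} -> {subset p' <= b' :: q'} ->
  (b \notin p) || (b' \notin p') -> apart p p'.
Proof.
move=> H sp sp' nb u v up vp; have [-> ->] := H u v (sp _ up) (sp' _ vp).
split=> //; apply/negP=> /andP[/eqP E /eqP E']; subst u v.
by rewrite up vp in nb.
Qed.

Definition att f s z := has (sedge z) (f :: s).

Definition connector f s := ipath (f :: s) /\ {in f :: s, forall u, u != a /\ ~~ sedge a u}.

(** The last vertex of an arm is a neighbour of the trapped apex, so nothing outside sees it. The
    second clause thereby makes every attachment on the arm nonadjacent to [a]. *)
Definition off f s b q := ~~ has [in b :: q] (f :: s) /\ ~~ att f s (last b q).

(* What remains of the choice of [f :: s] as a shortest path with nonlocal
   attachments: only its two ends can see a nonlocal pair. *)
Definition min_conn f s b q b' q' := forall u v x y,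
  u \in f :: s -> v \in f :: s -> x \in b :: q -> y \in b' :: q' ->
  sedge u x -> sedge v y -> ~~ ((x == b) && (y == b')) ->
  (u = f /\ v = last f s) \/ (u = last f s /\ v = f).

Lemma min_connC f s b q b' q' :
  min_conn f s b q b' q' -> min_conn f s b' q' b q.
Proof.
move=> H u v x y uf vf xq yq ux vy; rewrite andbC => n.
by case: (H v u y x vf uf yq xq vy ux n) => -[-> ->]; auto.
Qed.

Lemma off_neq f s b q u v : off f s b q -> u \in b :: q -> v \in f :: s -> u != v.
Proof. by case=> /hasPn o _ uq /o; apply: contraNneq => <-. Qed.

Lemma off_apart f s b q (p p' : seq G) : off f s b q ->
  {subset p <= f :: s} -> {subset p' <= b :: q} ->
  {in p', forall z, ~~ att f s z} -> apart p p'.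
Proof.
move=> [/hasPn o _] sp sp' na u v up vp; split.
  by apply: contraNneq (o _ (sp _ up)) => ->; apply: sp'.
rewrite sedgeC; apply: contra (na _ vp) => uv.
by apply/hasP; exists u; rewrite ?sp.
Qed.

Lemma ipath_mid_edge C z x Z : ipath (C ++ [:: z, x & Z]) -> sedge z x.
Proof. by move/ipath_catr => /(_ isT); rewrite ipath_cons2 => /and4P[]. Qed.

Lemma ipath_edge_split C z x Z u v : ipath (C ++ [:: z, x & Z]) ->
  u \in rcons C z -> v \in x :: Z ->
  u != v /\ (sedge u v -> u = z /\ v = x).
Proof.
move=> ip; rewrite mem_rcons !inE => /orP[/eqP->|uC] vZ; last first.
  by have [-> /negbTE->] := ipath_apart ip uC vZ.
case/orP: vZ => [/eqP->|vZ].
  have := ipath_uniq ip; rewrite cat_uniq => /and3P[_ _ /andP[+ _]].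
  by rewrite inE negb_or => /andP[].
rewrite -cat_rcons in ip.
have zC : z \in rcons C z by rewrite mem_rcons mem_head.
by have [-> /negbTE->] := ipath_apart ip zC vZ.
Qed.

Lemma arm_suffix b q C z D : arm b q -> b :: q = C ++ z :: D -> walk z D a.
Proof.
move=> [ip q0 _ aq] E; rewrite /walk rcons_path sedgeC.
have ip' : ipath (z :: D) by apply: (@ipath_catr _ C); rewrite -?E.
rewrite ipath_path //= aq; first by rewrite (last_suffix E).
by rewrite -(last_suffix E); apply: mem_last.
Qed.

Lemma connector_rev f s f' s' : f' :: s' = rev (f :: s) -> connector f s ->
  connector f' s' /\ last f' s' = f /\ last f s = f' /\ (f' :: s' =i f :: s).
Proof.
move=> E [ip na]; split.
  split; rewrite E ?ipath_rev // => u; rewrite mem_rev; exact: na.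
have E' : f :: s = rev (f' :: s') by rewrite E revK.
split; first by rewrite -[last f' s']/(last f (f' :: s')) E rev_cons last_rcons.
split; first by rewrite -[last f s]/(last f (f :: s)) E' rev_cons last_rcons.
by move=> z; rewrite E mem_rev.
Qed.

Section Half.
Variables (f : G) (s : seq G) (b1 : G) (q1 : seq G) (b2 : G) (q2 : seq G)
  (b3 : G) (q3 : seq G).
Hypotheses (tf : theta_free G) (A1 : arm b1 q1) (A2 : arm b2 q2) (A3 : arm b3 q3).
Hypotheses (X12 : cross b1 q1 b2 q2) (X13 : cross b1 q1 b3 q3)
  (X23 : cross b2 q2 b3 q3).
Hypotheses (K : connector f s) (O1 : off f s b1 q1) (O2 : off f s b2 q2)
  (O3 : off f s b3 q3).
Hypothesis N3 : {in b3 :: q3, forall z, ~~ att f s z}.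
Hypothesis end1 :
  {in b1 :: q1, forall z u, u \in f :: s -> sedge u z -> u = f}.
Hypothesis end2 :
  {in b2 :: q2, forall z u, u \in f :: s -> sedge u z -> u = last f s}.

(* Unless the attachments on the first arm are two consecutive vertices, there
   is a theta whose ends are [a] and either [f] or the only attachment. *)
Lemma half : has (att f s) q1 -> has (att f s) q2 ->
  exists C z x Z, [/\ b1 :: q1 = C ++ [:: z, x & Z], sedge f z, sedge f x,
    {in C, forall u, ~~ att f s u} & {in Z, forall u, ~~ att f s u}].
Proof.
move=> /split_last[B1 [x1 [Z1 [E1 ax1 /hasPn nZ1]]]].
move=> /split_last[B2 [x2 [Z2 [E2 ax2 _]]]].
have F1 : b1 :: q1 = (b1 :: B1) ++ x1 :: Z1 by rewrite E1.
have F2 : b2 :: q2 = (b2 :: B2) ++ x2 :: Z2 by rewrite E2.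
have s1 : {subset x1 :: Z1 <= b1 :: q1} by move=> z h; rewrite F1 mem_cat h orbT.
have s2 : {subset x2 :: Z2 <= b2 :: q2} by move=> z h; rewrite F2 mem_cat h orbT.
have [[ip1 _ _ a1] [ip2 _ _ a2]] := (A1, A2).
have nb1 : b1 \notin x1 :: Z1.
  apply: contraL (ipath_uniq ip1); rewrite F1 => h; apply/negP=> U.
  by have := uniq_cat_disj U (mem_head _ _) h; rewrite eqxx.
have nb2 : b2 \notin x2 :: Z2.
  apply: contraL (ipath_uniq ip2); rewrite F2 => h; apply/negP=> U.
  by have := uniq_cat_disj U (mem_head _ _) h; rewrite eqxx.
have fx1 : sedge f x1.
  case/hasP: ax1 => u uF x1u; have E : u = f.
    by apply: end1 (s1 _ (mem_head _ _)) _ uF _; rewrite sedgeC.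
  by rewrite -E sedgeC.
have fx2 : sedge (last f s) x2.
  case/hasP: ax2 => u uF x2u; have E : u = last f s.
    by apply: end2 (s2 _ (mem_head _ _)) _ uF _; rewrite sedgeC.
  by rewrite -E sedgeC.
have w1 : walk x1 Z1 a by apply: arm_suffix F1.
have w2 : walk x2 Z2 a by apply: arm_suffix F2.
have w3 : walk b3 q3 a by apply: (@arm_suffix b3 q3 [::]).
have wF : walk f (s ++ x2 :: Z2) a.
  by rewrite /walk rcons_cat cat_path ipath_path ?(proj1 K) //= fx2.
have b31 : sedge b3 b1.
  by have [_] := X13 (mem_head _ _) (mem_head _ _); rewrite sedgeC !eqxx.
have p1 := ipath_path ip1.
have apZ2 : apart (x1 :: Z1) (x2 :: Z2) by apply: (cross_apart X12); rewrite ?nb1.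
have apQ3 : apart (x1 :: Z1) (b3 :: q3) by apply: (cross_apart X13); rewrite ?nb1.
have apZ3 : apart (x2 :: Z2) (b3 :: q3) by apply: (cross_apart X23); rewrite ?nb2.
have apF3 : apart (f :: s) (b3 :: q3) by apply: (off_apart O3).
(* [x1] is the last attachment on the first arm. If it is not the only one, [z] below is the first,
   and the two are consecutive when [D] is empty. *)
have [|nB] := boolP (has (att f s) (b1 :: B1)).
  move=> /split_first[C [z [D [EC az /hasPn nC]]]].
  have zB : z \in b1 :: B1 by rewrite EC mem_cat mem_head orbT.
  have zQ : z \in b1 :: q1 by rewrite F1 mem_cat zB.
  have fz : sedge f z.
    case/hasP: az => u uF zu; have E : u = f.
      by apply: end1 zQ _ uF _; rewrite sedgeC.
    by rewrite -E sedgeC.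
  case: D EC => [EC|d D EC].
    by exists C, z, x1, Z1; split=> //; rewrite F1 EC -catA.
  have G1 : b1 :: q1 = rcons C z ++ d :: D ++ x1 :: Z1.
    by rewrite F1 EC -!catA cat_rcons.
  have wz : walk z (rev C) b3.
    by apply/walk_sym/(walk_prefix p1 b31 (D := d :: D ++ x1 :: Z1)); rewrite G1 cat_rcons.
  have [fa nfa] := proj2 K f (mem_head _ _).
  have sC : {subset z :: rev C <= rcons C z}.
    by move=> u; rewrite mem_rcons !inE mem_rev.
  have sCq : {subset rcons C z <= b1 :: q1}.
    by move=> u h; rewrite G1 mem_cat h.
  (* From [f] to [a]: through the last attachment; along the connecting path and the second arm;
     through the first attachment back to [b1], then [b3] and the third arm. [D] being nonempty
     keeps the first and the third apart. *)
  case: (@theta_walks G f a (x1 :: Z1) (s ++ x2 :: Z2) (z :: rev C ++ b3 :: q3));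
    rewrite 1?[sedge f a]sedgeC //.
  - exact: walk_cons w1.
  - by apply: walk_cons fz _; apply: walk_cat wz w3.
  - apply: apart_catr => // u v uZ vs.
    split.
      by apply: (off_neq O1); rewrite ?s1 // inE vs orbT.
    apply/negP=> uv; have E : v = f.
      by apply: end1 (s1 _ uZ) _ _ _; rewrite 1?sedgeC // inE vs orbT.
    by have /andP[] := ipath_uniq (proj1 K); rewrite -{1}E vs.
  - rewrite -cat_cons; apply: apart_catr => // u v uZ /sC vC.
    rewrite eq_sym sedgeC.
    apply: (@ipath_apart _ (rcons C z) d (D ++ x1 :: Z1)); rewrite -?G1 //.
    by rewrite mem_cat uZ orbT.
  - rewrite -cat_cons; apply: apart_catl; apply: apart_catr; last 2 first.
    + apply: apartC; apply: (cross_apart X12) => //; last by rewrite nb2 orbT.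
      by move=> u /sC/sCq.
    + exact: apZ3.
    + move=> u v us /sC vC; split.
        by rewrite eq_sym; apply: (off_neq O1); rewrite ?sCq // inE us orbT.
      apply/negP=> uv; have E : u = f.
        by apply: end1 (sCq _ vC) _ _ _; rewrite // inE us orbT.
      by have /andP[] := ipath_uniq (proj1 K); rewrite -{1}E us.
    by apply: apart_sub apF3 _ _ => // u us; rewrite inE us orbT.
have x1q := s1 _ (mem_head x1 Z1).
have x1a : ~~ sedge x1 a.
  rewrite sedgeC a1 //; apply: contraNneq (proj2 O1) => <-; exact: ax1.
have nx1a : x1 != a.
  by case: A1 => _ _ + _; apply: contraNneq => <-.
(* From the only attachment [x1] to [a]: onward along the arm; along the connecting path and the
   second arm; back to [b1], then [b3] and the third arm. *)
case: (@theta_walks G x1 a Z1 (f :: s ++ x2 :: Z2) (rev (b1 :: B1) ++ b3 :: q3)) => //.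
- by apply: walk_cons wF; rewrite sedgeC.
- by apply: walk_cat w3; apply/walk_sym/(walk_prefix p1 b31 F1).
- rewrite -cat_cons; apply: apart_catr.
    apply: apartC; apply: (off_apart O1) => // u uZ.
      by apply: s1; rewrite inE uZ orbT.
  by apply: apart_sub apZ2 _ _ => // u uZ; rewrite inE uZ orbT.
- apply: apart_catr; last by apply: apart_sub apQ3 _ _ => // u uZ; rewrite inE uZ orbT.
  move=> u v uZ; rewrite mem_rev eq_sym sedgeC => vB.
  by apply: (@ipath_apart _ (b1 :: B1) x1 Z1); rewrite -?F1.
rewrite -cat_cons; apply: apart_catl; apply: apart_catr.
- apply: (off_apart O1) => // u; rewrite mem_rev => uB; first by rewrite F1 mem_cat uB.
  by move/hasPn: nB; apply.
- exact: apF3.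
- apply: apartC; apply: (cross_apart X12) => //; last by rewrite nb2 orbT.
  by move=> u; rewrite mem_rev => uB; rewrite F1 mem_cat uB.
exact: apZ3.
Qed.

(* The ends of the theta are [b2] and [a]. *)
Lemma base_theta :
  {in q1, forall z u, u \in f :: s -> sedge u z -> u = f} ->
  has (att f s) q1 -> sedge (last f s) b2 ->
  {in q2, forall z, ~~ att f s z} -> False.
Proof.
move=> e1 /split_last[B1 [x1 [Z1 [E1 ax1 /hasPn nZ1]]]] gb2 n2.
have F1 : b1 :: q1 = (b1 :: B1) ++ x1 :: Z1 by rewrite E1.
have s1 : {subset x1 :: Z1 <= b1 :: q1} by move=> z h; rewrite F1 mem_cat h orbT.
have [[ip1 _ _ a1] [ip2 q20 na2 a2]] := (A1, A2).
have nb1 : b1 \notin x1 :: Z1.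
  apply: contraL (ipath_uniq ip1); rewrite F1 => h; apply/negP=> U.
  by have := uniq_cat_disj U (mem_head _ _) h; rewrite eqxx.
have fx1 : sedge f x1.
  case/hasP: ax1 => u uF x1u; have E : u = f.
    apply: (e1 x1 _ u uF); last by rewrite sedgeC.
    by rewrite E1 mem_cat mem_head orbT.
  by rewrite -E sedgeC.
have w1 : walk x1 Z1 a by apply: arm_suffix F1.
have w2 : walk b2 q2 a by apply: (@arm_suffix b2 q2 [::]).
have w3 : walk b3 q3 a by apply: (@arm_suffix b3 q3 [::]).
have b23 : sedge b2 b3.
  by have [_] := X23 (mem_head _ _) (mem_head _ _); rewrite !eqxx.
have wF : walk b2 (rev (f :: s)) x1.
  apply: walk_sym; rewrite /walk rcons_path /= sedgeC fx1.
  by rewrite ipath_path ?(proj1 K).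
have sq2 : {subset q2 <= b2 :: q2} by move=> u h; rewrite inE h orbT.
have nb2 : b2 \notin q2 by case/andP: (ipath_uniq ip2).
(* From [b2] to [a]: along its own arm; over [b3]; along the reversed connecting path and the end of
   the first arm. *)
case: (@theta_walks G b2 a q2 (b3 :: q3) (rev (f :: s) ++ x1 :: Z1)) => //.
- by apply: contraNneq na2 => <-; apply: mem_head.
- rewrite sedgeC a2 ?mem_head //; apply: contraNneq nb2 => ->.
  by case: (q2) q20 => //= x q _; apply: mem_last.
- exact: walk_cons w3.
- exact: walk_cat wF w1.
- by apply: (cross_apart X23); rewrite ?nb2.
- apply: apart_catr.
    by apply/apartC/(off_apart O2) => // u; rewrite mem_rev.
  by apply/apartC/(cross_apart X12); rewrite ?nb1.
apply: apart_catr.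
  by apply/apartC/(off_apart O3) => // u; rewrite mem_rev.
by apply/apartC/(cross_apart X13); rewrite ?nb1.
Qed.

(** * Prisms from two consecutive attachments on each of two arms *)

Hypothesis pf : prism_free G.
Variables (C1 : seq G) (z1 x1 : G) (Z1 C2 : seq G) (z2 x2 : G) (Z2 : seq G).
Hypotheses (E1 : b1 :: q1 = C1 ++ [:: z1, x1 & Z1]) (fz1 : sedge f z1)
  (fx1 : sedge f x1) (nC1 : {in C1, forall u, ~~ att f s u})
  (nZ1 : {in Z1, forall u, ~~ att f s u}).
Hypotheses (E2 : b2 :: q2 = C2 ++ [:: z2, x2 & Z2])
  (gz2 : sedge (last f s) z2) (gx2 : sedge (last f s) x2)
  (nC2 : {in C2, forall u, ~~ att f s u})
  (nZ2 : {in Z2, forall u, ~~ att f s u}).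

Let sX1 : {subset x1 :: Z1 <= b1 :: q1}.
Proof. by move=> z h; rewrite E1 -cat_rcons mem_cat h orbT. Qed.
Let sX2 : {subset x2 :: Z2 <= b2 :: q2}.
Proof. by move=> z h; rewrite E2 -cat_rcons mem_cat h orbT. Qed.
Let sC1 : {subset rcons C1 z1 <= b1 :: q1}.
Proof. by move=> z h; rewrite E1 -cat_rcons mem_cat h. Qed.
Let sC2 : {subset rcons C2 z2 <= b2 :: q2}.
Proof. by move=> z h; rewrite E2 -cat_rcons mem_cat h. Qed.

Let na1 u : u \in rcons C1 z1 -> a != u /\ ~~ sedge a u.
Proof.
move=> uC; case: A1 => ip _ na aq; split.
  by apply: contraNneq na => ->; apply: sC1.
rewrite aq ?sC1 //; have := ipath_uniq ip; rewrite E1 -cat_rcons => U.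
apply: (uniq_cat_disj U uC).
by rewrite (@last_suffix _ b1 q1 (rcons C1 z1) x1 Z1) ?cat_rcons // mem_last.
Qed.
Let na2 u : u \in rcons C2 z2 -> a != u /\ ~~ sedge a u.
Proof.
move=> uC; case: A2 => ip _ na aq; split.
  by apply: contraNneq na => ->; apply: sC2.
rewrite aq ?sC2 //; have := ipath_uniq ip; rewrite E2 -cat_rcons => U.
apply: (uniq_cat_disj U uC).
by rewrite (@last_suffix _ b2 q2 (rcons C2 z2) x2 Z2) ?cat_rcons // mem_last.
Qed.

Let nb1 : b1 \notin x1 :: Z1.
Proof.
case: A1 => /ipath_uniq U _ _ _; apply/negP=> h; move: U (head_prefix E1).
by rewrite E1 -cat_rcons => U /(uniq_cat_disj U)/(_ h); rewrite eqxx.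
Qed.
Let nb2 : b2 \notin x2 :: Z2.
Proof.
case: A2 => /ipath_uniq U _ _ _; apply/negP=> h; move: U (head_prefix E2).
by rewrite E2 -cat_rcons => U /(uniq_cat_disj U)/(_ h); rewrite eqxx.
Qed.

Let attI u v : u \in f :: s -> sedge u v -> att f s v.
Proof. by move=> uF uv; apply/hasP; exists u; rewrite // sedgeC. Qed.

Let linkF1 u v : u \in f :: s -> v \in b1 :: q1 ->
  u != v /\ (sedge u v -> u = f /\ (v = z1 \/ v = x1)).
Proof.
move=> uF vq; rewrite eq_sym (off_neq O1) //; split=> // uv.
split; first exact: end1 uF uv.
move: vq; rewrite E1 mem_cat !inE => /or4P[/nC1|/eqP|/eqP|/nZ1]; auto;
  by rewrite (attI uF uv).
Qed.

Let linkF2 u v : u \in f :: s -> v \in b2 :: q2 ->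
  u != v /\ (sedge u v -> u = last f s /\ (v = z2 \/ v = x2)).
Proof.
move=> uF vq; rewrite eq_sym (off_neq O2) //; split=> // uv.
split; first exact: end2 uF uv.
move: vq; rewrite E2 mem_cat !inE => /or4P[/nC2|/eqP|/eqP|/nZ2]; auto;
  by rewrite (attI uF uv).
Qed.

Let linkF3 u v : u \in f :: s -> v \in b3 :: q3 -> u != v /\ ~~ sedge u v.
Proof.
move=> uF vq; rewrite eq_sym (off_neq O3) //; split=> //.
by apply: contra (N3 vq); apply: attI.
Qed.

Let linkFa u : u \in f :: s -> u != a /\ ~~ sedge u a.
Proof. by move=> /(proj2 K)[]; rewrite [sedge u a]sedgeC. Qed.

Let head12 u v : u \in b1 :: q1 -> v \in b2 :: q2 ->
  u != v /\ (sedge u v -> u = b1 /\ v = b2).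
Proof.
by move=> uq vq; have [-> ->] := X12 uq vq; split=> // /andP[/eqP-> /eqP->].
Qed.

Let head13 u v : u \in b1 :: q1 -> v \in b3 :: q3 ->
  u != v /\ (sedge u v -> u = b1 /\ v = b3).
Proof.
by move=> uq vq; have [-> ->] := X13 uq vq; split=> // /andP[/eqP-> /eqP->].
Qed.

Let head23 u v : u \in b2 :: q2 -> v \in b3 :: q3 ->
  u != v /\ (sedge u v -> u = b2 /\ v = b3).
Proof.
by move=> uq vq; have [-> ->] := X23 uq vq; split=> // /andP[/eqP-> /eqP->].
Qed.

Let p1 := ipath_path (let: And4 ip _ _ _ := A1 in ip).
Let p2 := ipath_path (let: And4 ip _ _ _ := A2 in ip).
Let b12 : sedge b1 b2.
Proof. by have [_] := X12 (mem_head _ _) (mem_head _ _); rewrite !eqxx. Qed.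
Let b13 : sedge b1 b3.
Proof. by have [_] := X13 (mem_head _ _) (mem_head _ _); rewrite !eqxx. Qed.
Let b23 : sedge b2 b3.
Proof. by have [_] := X23 (mem_head _ _) (mem_head _ _); rewrite !eqxx. Qed.
Let w1 : walk x1 Z1 a.
Proof. by apply: (arm_suffix A1 (C := rcons C1 z1)); rewrite cat_rcons. Qed.
Let w2 : walk x2 Z2 a.
Proof. by apply: (arm_suffix A2 (C := rcons C2 z2)); rewrite cat_rcons. Qed.
Let w3 : walk b3 q3 a.
Proof. exact: (@arm_suffix b3 q3 [::]). Qed.
Let zx1 : sedge z1 x1.
Proof. by case: A1 => ip _ _ _; apply: (@ipath_mid_edge C1 _ _ Z1); rewrite -E1. Qed.
Let zx2 : sedge z2 x2.
Proof. by case: A2 => ip _ _ _; apply: (@ipath_mid_edge C2 _ _ Z2); rewrite -E2. Qed.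
Let split1 u v : u \in rcons C1 z1 -> v \in x1 :: Z1 ->
  u != v /\ (sedge u v -> u = z1 /\ v = x1).
Proof. by case: A1 => ip _ _ _; apply: ipath_edge_split; rewrite -E1. Qed.
Let split2 u v : u \in rcons C2 z2 -> v \in x2 :: Z2 ->
  u != v /\ (sedge u v -> u = z2 /\ v = x2).
Proof. by case: A2 => ip _ _ _; apply: ipath_edge_split; rewrite -E2. Qed.

Let linkX1 u v : u \in f :: s -> v \in x1 :: Z1 ->
  u != v /\ (sedge u v -> u = f /\ v = x1).
Proof.
move=> uF vX; have [nuv h] := linkF1 uF (sX1 vX); split=> // /h[-> []] // E.
have zC : z1 \in rcons C1 z1 by rewrite mem_rcons mem_head.
by have [] := split1 zC vX; rewrite E eqxx.
Qed.
Let linkX2 u v : u \in f :: s -> v \in x2 :: Z2 ->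
  u != v /\ (sedge u v -> u = last f s /\ v = x2).
Proof.
move=> uF vX; have [nuv h] := linkF2 uF (sX2 vX); split=> // /h[-> []] // E.
have zC : z2 \in rcons C2 z2 by rewrite mem_rcons mem_head.
by have [] := split2 zC vX; rewrite E eqxx.
Qed.
Let linkC1 u v : u \in f :: s -> v \in rcons C1 z1 ->
  u != v /\ (sedge u v -> u = f /\ v = z1).
Proof.
move=> uF vX; have [nuv h] := linkF1 uF (sC1 vX); split=> // /h[-> []] // E.
by have [] := split1 vX (mem_head _ _); rewrite E eqxx.
Qed.
Let linkC2 u v : u \in f :: s -> v \in rcons C2 z2 ->
  u != v /\ (sedge u v -> u = last f s /\ v = z2).
Proof.
move=> uF vX; have [nuv h] := linkF2 uF (sC2 vX); split=> // /h[-> []] // E.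
by have [] := split2 vX (mem_head _ _); rewrite E eqxx.
Qed.
Let apX1 v : v \in b2 :: q2 -> apart (x1 :: Z1) [:: v].
Proof.
by move=> vq; apply: (cross_apart X12) => //; rewrite ?nb1 // => u; rewrite inE => /eqP->.
Qed.
Let apX2 v : v \in b1 :: q1 -> apart (x2 :: Z2) [:: v].
Proof.
by move=> vq; apply: (cross_apart (crossC X12)) => //; rewrite ?nb2 // => u; rewrite inE => /eqP->.
Qed.

(* The two triangles are formed by an end of the connecting path and the two
   attachments on an arm; the third path of the prism runs through [b1 b2]. *)
Lemma prism_long : s != [::] -> False.
Proof.
move=> s0.
have [r1 [wr1 lr1 mr1]] := path_prefix_back p1 E1.
have wr2 : path (@sedge G) b1 (rcons C2 z2) by apply: (walk_prefix p2 b12 E2).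
have fg : f != last f s.
  by case: (K) => ip _; apply: head_neq_last.
have m2 v : v \in x1 :: rcons (Z1 ++ a :: rev Z2) x2 ->
    v \in x1 :: Z1 \/ v = a \/ v \in x2 :: Z2.
  rewrite !(inE, mem_rcons, mem_cat, mem_rev).
  by case/or4P=> [->|->|->|/orP[/eqP|->]]; rewrite ?orbT; auto.
have m3 v : v \in z1 :: (r1 ++ rcons C2 z2) ->
    v \in rcons C1 z1 \/ v \in rcons C2 z2.
  by rewrite -cat_cons mem_cat mr1 => /orP[]; auto.
(* The paths are the connecting path, the way from [x1] over [a] to [x2], and the way from [z1] back
   over the edge [b1 b2] to [z2]. *)
case: (@prism_walks G f s x1 (rcons (Z1 ++ a :: rev Z2) x2) z1 (r1 ++ rcons C2 z2)).
all: rewrite ?last_rcons ?last_cat ?last_rcons //.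
- exact: ipath_path (proj1 K).
- exact: walk_cat w1 (walk_sym w2).
- by rewrite cat_path wr1 lr1.
- by rewrite sedgeC.
- by rewrite sedgeC.
- have [] // := @apX1 x2 _ x1 x2 (mem_head _ _) (mem_head _ _).
  exact: sX2 (mem_head _ _).
- have z1C : z1 \in rcons C1 z1 by rewrite mem_rcons mem_head.
  have z2C : z2 \in rcons C2 z2 by rewrite mem_rcons mem_head.
  by have [] := head12 (sC1 z1C) (sC2 z2C).
- move=> u v uF /m2[vX|[->|vX]]; rewrite last_rcons.
  + by have [-> h] := linkX1 uF vX; split=> // /h; auto.
  + by have [-> /negbTE->] := linkFa uF.
  + by have [-> h] := linkX2 uF vX; split=> // /h; auto.
- move=> u v uF /m3[vC|vC]; rewrite last_cat last_rcons.
  + by have [-> h] := linkC1 uF vC; split=> // /h; auto.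
  + by have [-> h] := linkC2 uF vC; split=> // /h; auto.
move=> u v uX vC; rewrite eq_sym sedgeC last_cat !last_rcons.
move/m2: uX => [uX|[->|uX]]; move/m3: vC => [vC|vC].
- by have [-> h] := split1 vC uX; split=> // /h[-> ->]; auto.
- have [] := apX1 (sC2 vC) uX (mem_head _ _).
  by rewrite eq_sym sedgeC => -> /negbTE->.
- by have [] := na1 vC; rewrite eq_sym sedgeC => -> /negbTE->.
- by have [] := na2 vC; rewrite eq_sym sedgeC => -> /negbTE->.
- have [] := apX2 (sC1 vC) uX (mem_head _ _).
  by rewrite eq_sym sedgeC => -> /negbTE->.
- by have [-> h] := split2 vC uX; split=> // /h[-> ->]; auto.
Qed.

(* Here the second triangle is the base of the pyramid. *)
Lemma prism_short : s = [::] -> C1 != [::] -> False.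
Proof.
move=> s0 C10.
have [r1 [wr1 lr1 mr1]] := path_prefix_back p1 E1.
have [r2 [wr2 lr2 mr2]] := path_prefix_back p2 E2.
have lf : last f s = f by rewrite s0.
have z1C : z1 \in rcons C1 z1 by rewrite mem_rcons mem_head.
(* As [C1] is nonempty, [b1] differs from [z1], and the two triangles are disjoint. *)
have b1C : b1 \in C1 by case: C1 C10 E1 => //= c C _ [-> _]; apply: mem_head.
have b3q : b3 \in b3 :: q3 by apply: mem_head.
have fF : f \in f :: s by apply: mem_head.
have m2 v : v \in x1 :: rcons (Z1 ++ a :: rev q3) b3 ->
    v \in x1 :: Z1 \/ v = a \/ v \in b3 :: q3.
  rewrite !(inE, mem_rcons, mem_cat, mem_rev).
  by case/or4P=> [->|->|->|/orP[/eqP|->]]; rewrite ?orbT; auto.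
have m3 v : v \in f :: z2 :: r2 -> v = f \/ v \in rcons C2 z2.
  by rewrite inE mr2 => /orP[/eqP|]; auto.
(* The paths run from [z1] back to [b1], from [x1] over [a] to [b3], and from [f] over [z2] back to
   [b2]. *)
case: (@prism_walks G z1 r1 x1 (rcons (Z1 ++ a :: rev q3) b3) f (z2 :: r2)).
all: rewrite ?last_rcons /= ?lr1 ?lr2 //.
- exact: walk_cat w1 (walk_sym w3).
- by rewrite wr2 -lf gz2.
- by rewrite sedgeC.
- by rewrite sedgeC.
- by rewrite sedgeC.
- case: A1 => /ipath_uniq; rewrite E1 => U _ _ _; rewrite eq_sym.
  exact: uniq_cat_disj U b1C (mem_head _ _).
- by have [] := head13 (sX1 (mem_head _ _)) b3q.
- by rewrite eq_sym; apply: (off_neq O2); rewrite ?mem_head.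
- move=> u v; rewrite mr1 lr1 last_rcons => uC /m2[vX|[->|vq]].
  + by have [-> h] := split1 uC vX; split=> // /h; auto.
  + by have [] := na1 uC; rewrite eq_sym sedgeC => -> /negbTE->.
  + by have [-> h] := head13 (sC1 uC) vq; split=> // /h; auto.
- move=> u v; rewrite mr1 /= lr1 lr2 => uC /m3[->|vC].
  + have [] := linkC1 fF uC; rewrite eq_sym sedgeC => -> h.
    by split=> // /h[_ ->]; auto.
  + by have [-> h] := head12 (sC1 uC) (sC2 vC); split=> // /h; auto.
move=> u v; rewrite last_rcons /= lr2 => uX vC.
move/m2: uX => [uX|[->|uq]]; move/m3: vC => [->|vC].
- have [] := linkX1 fF uX; rewrite eq_sym sedgeC => -> h.
  by split=> // /h[_ ->]; auto.
- by have [-> /negbTE->] := apX1 (sC2 vC) uX (mem_head _ _).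
- by have [] := linkFa fF; rewrite eq_sym sedgeC => -> /negbTE->.
- by have [-> /negbTE->] := na2 vC.
- by have [] := linkF3 fF uq; rewrite eq_sym sedgeC => -> /negbTE->.
- have [] := head23 (sC2 vC) uq; rewrite eq_sym sedgeC => -> h.
  by split=> // /h[-> ->]; auto.
Qed.

End Half.

(** * Possible attachments of a connecting path to a pyramid *)

Record pyr b1 q1 b2 q2 b3 q3 : Prop := Pyr {
  pyr_arm1 : arm b1 q1; pyr_arm2 : arm b2 q2; pyr_arm3 : arm b3 q3;
  pyr_cross12 : cross b1 q1 b2 q2;
  pyr_cross13 : cross b1 q1 b3 q3;
  pyr_cross23 : cross b2 q2 b3 q3 }.

Record att_pyr f s b1 q1 b2 q2 b3 q3 : Prop := AttPyr {
  ap_conn : connector f s;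
  ap_off1 : off f s b1 q1; ap_off2 : off f s b2 q2; ap_off3 : off f s b3 q3;
  ap_min12 : min_conn f s b1 q1 b2 q2;
  ap_min13 : min_conn f s b1 q1 b3 q3;
  ap_min23 : min_conn f s b2 q2 b3 q3 }.

Lemma pyr_swap23 b1 q1 b2 q2 b3 q3 :
  pyr b1 q1 b2 q2 b3 q3 -> pyr b1 q1 b3 q3 b2 q2.
Proof. by case=> *; split=> //; apply: crossC. Qed.

Lemma att_pyr_swap23 f s b1 q1 b2 q2 b3 q3 :
  att_pyr f s b1 q1 b2 q2 b3 q3 -> att_pyr f s b1 q1 b3 q3 b2 q2.
Proof. by case=> *; split=> //; apply: min_connC. Qed.

Lemma att_eq f s f' s' : f' :: s' =i f :: s -> att f' s' =1 att f s.
Proof. by move=> E z; rewrite /att (eq_has_r E). Qed.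

Lemma att_pyr_rev f s f' s' b1 q1 b2 q2 b3 q3 : f' :: s' = rev (f :: s) ->
  att_pyr f s b1 q1 b2 q2 b3 q3 -> att_pyr f' s' b1 q1 b2 q2 b3 q3.
Proof.
move=> E [K O1 O2 O3 M12 M13 M23].
have [K' [lf' [lf mF]]] := connector_rev E K.
have off_rev b q : off f s b q -> off f' s' b q.
  by case=> o n; rewrite /off (eq_has_r mF) (att_eq mF).
have min_rev b q b' q' : min_conn f s b q b' q' -> min_conn f' s' b q b' q'.
  move=> M u v x y; rewrite !mF lf' -lf => uF vF xq yq ux vy n.
  by case: (M u v x y uF vF xq yq ux vy n) => -[-> ->]; auto.
by split; auto.
Qed.

(** If the connecting path is one vertex, its last attachments on the three arms give a theta with
    ends [f] and [a]. Otherwise each two of the three attachments form a nonlocal pair, so their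
    neighbours on the connecting path are opposite ends of it; three vertices cannot be pairwise
    opposite. *)
Lemma no_three_feet f s b1 q1 b2 q2 b3 q3 : theta_free G ->
  pyr b1 q1 b2 q2 b3 q3 -> att_pyr f s b1 q1 b2 q2 b3 q3 ->
  has (att f s) q1 -> has (att f s) q2 -> has (att f s) (b3 :: q3) -> False.
Proof.
move=> tf [A1 A2 A3 X12 X13 X23] [K O1 O2 O3 M12 M13 M23].
move=> /split_last[B1 [x1 [Z1 [E1 ax1 _]]]].
move=> /split_last[B2 [x2 [Z2 [E2 ax2 _]]]].
move=> /split_last[B3 [x3 [Z3 [F3 ax3 _]]]].
have F1 : b1 :: q1 = (b1 :: B1) ++ x1 :: Z1 by rewrite E1.
have F2 : b2 :: q2 = (b2 :: B2) ++ x2 :: Z2 by rewrite E2.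
have sub b q C x Z : b :: q = C ++ x :: Z -> {subset x :: Z <= b :: q}.
  by move=> -> z h; rewrite mem_cat h orbT.
have nb b q B x Z : arm b q -> b :: q = (b :: B) ++ x :: Z -> b \notin x :: Z.
  case=> /ipath_uniq U _ _ _ E; apply/negP; move: U; rewrite E => U.
  by move/(uniq_cat_disj U (mem_head _ _)); rewrite eqxx.
have [s1 s2 s3] := And3 (sub _ _ _ _ _ F1) (sub _ _ _ _ _ F2) (sub _ _ _ _ _ F3).
have [n1 n2] := (nb _ _ _ _ _ A1 F1, nb _ _ _ _ _ A2 F2).
have m1 := s1 _ (mem_head x1 Z1); have m2 := s2 _ (mem_head x2 Z2).
have m3 := s3 _ (mem_head x3 Z3).
have nx1 : x1 != b1 by apply: contraNneq n1 => <-; apply: mem_head.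
have nx2 : x2 != b2 by apply: contraNneq n2 => <-; apply: mem_head.
have [u1 u1F] := hasP ax1; have [u2 u2F] := hasP ax2; have [u3 u3F] := hasP ax3.
rewrite sedgeC => e3; rewrite sedgeC => e2; rewrite sedgeC => e1.
have [s0|s0] := eqVneq s [::].
  move: u1F u2F u3F; rewrite s0 !inE => /eqP ? /eqP ? /eqP ?; subst u1 u2 u3.
  have [fa nfa] := proj2 K f (mem_head _ _).
  apply: (@theta_walks G f a (x1 :: Z1) (x2 :: Z2) (x3 :: Z3)) => //.
  - by rewrite sedgeC.
  - exact: walk_cons e1 (arm_suffix A1 F1).
  - exact: walk_cons e2 (arm_suffix A2 F2).
  - exact: walk_cons e3 (arm_suffix A3 F3).
  - by apply: (cross_apart X12); rewrite ?n1.
  - by apply: (cross_apart X13); rewrite ?n1.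
  - by apply: (cross_apart X23); rewrite ?n2.
have fg : f != last f s.
  by case: (K) => ip _; apply: head_neq_last.
move: (M12 u1 u2 x1 x2 u1F u2F m1 m2 e1 e2) (M13 u1 u3 x1 x3 u1F u3F m1 m3 e1 e3)
  (M23 u2 u3 x2 x3 u2F u3F m2 m3 e2 e3).
rewrite (negbTE nx1) (negbTE nx2) /= => /(_ isT) h12 /(_ isT) h13 /(_ isT) h23.
by move/eqP: fg; intuition congruence.
Qed.

(** A jewel at [b3] expressed by arms: on an arm, the closed neighbourhood of the base vertex
    consists of its first two vertices. *)
Definition jewel_pattern f s b1 q1 b2 q2 b3 q3 :=
  [/\ s = [::],
     exists x1 Z1, q1 = x1 :: Z1 /\
       {in b1 :: q1, forall z, att f s z = (z \in [:: b1; x1])},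
     exists x2 Z2, q2 = x2 :: Z2 /\
       {in b2 :: q2, forall z, att f s z = (z \in [:: b2; x2])} &
     {in b3 :: q3, forall z, ~~ att f s z}].

(** [base_theta] excludes a second arm seen only at its base. Otherwise [half], used from both ends
    of the connecting path, gives two consecutive attachments on each arm; the prisms then force a
    single connecting vertex ([prism_long]) and attachments starting at the bases ([prism_short],
    once for each arm). *)
Lemma two_feet_oriented f s b1 q1 b2 q2 b3 q3 : theta_free G -> prism_free G ->
  pyr b1 q1 b2 q2 b3 q3 -> att_pyr f s b1 q1 b2 q2 b3 q3 ->
  has (sedge f) q1 -> has (att f s) (b2 :: q2) ->
  {in b3 :: q3, forall z, ~~ att f s z} ->
  jewel_pattern f s b1 q1 b2 q2 b3 q3.
Proof.
move=> tf pf [A1 A2 A3 X12 X13 X23] AP /hasP[x xq fx] a2 N3.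
have [K O1 O2 O3 M12 _ _] := AP.
have fF : f \in f :: s := mem_head _ _.
have gF : last f s \in f :: s := mem_last _ _.
have xQ : x \in b1 :: q1 by rewrite inE xq orbT.
have hx : has (att f s) q1.
  by apply/hasP; exists x => //; apply/hasP; exists f; rewrite // sedgeC.
have nb (b : G) q y : arm b q -> y \in q -> y != b.
  by case=> /ipath_uniq /andP[+ _] _ _ _ yq; apply: contraNneq => <-.
have end2 : {in b2 :: q2, forall z u, u \in f :: s -> sedge u z -> u = last f s}.
  move=> y yQ u uF uy.
  by case: (M12 f u x y fF uF xQ yQ fx uy) => [|[_ ->]|[? ->]] //; rewrite (negbTE (nb _ _ _ A1 xq)).
have attE2 z : z \in b2 :: q2 -> att f s z -> sedge (last f s) z.
  move=> zQ /hasP[u uF]; rewrite sedgeC => uz.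
  by rewrite -(end2 _ zQ _ uF uz).
have [|/hasPn n2] := boolP (has (att f s) q2); last first.
  have gb2 : sedge (last f s) b2.
    move: a2; rewrite [has _ _]/= => /orP[|/hasP[z zq az]].
      by move/attE2; apply; apply: mem_head.
    by have := n2 _ zq; rewrite az.
  case: (base_theta tf A1 A2 A3 X12 X13 X23 K O2 O3 N3 _ hx gb2 n2).
  move=> z zq u uF uz; have zQ : z \in b1 :: q1 by rewrite inE zq orbT.
  case: (M12 u _ z b2 uF gF zQ (mem_head _ _) uz gb2) => [|[-> _]|[-> ?]] //.
  by rewrite (negbTE (nb _ _ _ A1 zq)).
move=> h2; have [y yq /(attE2 _ _) gy] := hasP h2.
have {}gy : sedge (last f s) y by apply: gy; rewrite inE yq orbT.
have yQ : y \in b2 :: q2 by rewrite inE yq orbT.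
have end1 : {in b1 :: q1, forall z u, u \in f :: s -> sedge u z -> u = f}.
  move=> z zQ u uF uz; case: (M12 u _ z y uF gF zQ yQ uz gy) => [|[-> _]|[-> ?]] //.
  by rewrite (negbTE (nb _ _ _ A2 yq)) andbF.
have [C1 [z1 [x1 [Z1 [E1 fz1 fx1 nC1 nZ1]]]]] :=
  half tf A1 A2 A3 X12 X13 X23 K O1 O3 N3 end1 end2 hx h2.
(* Reversing the connecting path exchanges the roles of the first two arms in [half]. *)
case Er: (rev (f :: s)) => [|f' s'].
  by move: (congr1 size Er); rewrite size_rev.
have Er' := esym Er.
have [K' [lf' [lf mF]]] := connector_rev Er' K.
have [_ O1' O2' O3' _ _ _] := att_pyr_rev Er' AP.
have aE := att_eq mF.
have [|||||C2 [z2 [x2 [Z2 [E2 gz2 gx2 nC2 nZ2]]]]] :=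
  half tf A2 A1 A3 (crossC X12) X23 X13 K' O2' O3'.
- by move=> z zq; rewrite aE N3.
- by move=> z zQ u; rewrite mF -lf; apply: end2.
- by move=> z zQ u; rewrite mF lf'; apply: end1.
- by rewrite (eq_has aE).
- by rewrite (eq_has aE).
rewrite -lf in gz2 gx2.
have {}nC2 : {in C2, forall u, ~~ att f s u} by move=> u /nC2; rewrite aE.
have {}nZ2 : {in Z2, forall u, ~~ att f s u} by move=> u /nZ2; rewrite aE.
have [s0|s0] := eqVneq s [::]; last first.
  by case: (prism_long A1 A2 X12 K O1 O2 end1 end2 pf E1 fz1 fx1 nC1 nZ1 E2 gz2 gx2 nC2 nZ2 s0).
have gf : last f s = f by rewrite s0.
have C10 : C1 = [::].
  apply/eqP/negPn/negP => C10.
  by case: (prism_short A1 A2 A3 X12 X13 X23 K O1 O2 O3 N3 end1 pf E1 fz1 fx1 nC1 nZ1 E2 gz2 s0 C10).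
have C20 : C2 = [::].
  apply/eqP/negPn/negP => C20; rewrite gf in end2 gz2 gx2.
  case: (prism_short A2 A1 A3 (crossC X12) X23 X13 K O2 O1 O3 N3 end2 pf
           E2 gz2 gx2 nC2 nZ2 E1 _ s0 C20).
  by rewrite gf.
rewrite C10 /= in E1; rewrite C20 /= in E2.
case: E1 fz1 => -> -> fz1; case: E2 gz2 => -> -> gz2.
have pat z x' Z : sedge f z -> sedge f x' -> {in Z, forall u, ~~ att f s u} ->
    {in [:: z, x' & Z], forall u, att f s u = (u \in [:: z; x'])}.
  move=> fz fx' nZ u; rewrite /att s0 /= orbF !inE => /or3P[/eqP->|/eqP->|uZ].
  - by rewrite eqxx sedgeC fz.
  - by rewrite eqxx orbT sedgeC fx'.
  have := nZ _ uZ; rewrite /att s0 /= orbF => nu; rewrite (negbTE nu).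
  by apply/esym/negbTE; apply: contra nu => /orP[] /eqP->; rewrite sedgeC.
split=> //; first by exists x1, Z1; split=> //; apply: pat.
by exists x2, Z2; split=> //; apply: pat; rewrite // -gf.
Qed.

(** If the third arm is seen as well, [no_three_feet], used with the last two arms in both orders,
    leaves only their base vertices. If it is not, the minimality of the connecting path makes one
    of its ends see the first arm off its base, and [two_feet_oriented] applies up to reversal. *)
Lemma foot_or_jewel f s b1 q1 b2 q2 b3 q3 : theta_free G -> prism_free G ->
  pyr b1 q1 b2 q2 b3 q3 -> att_pyr f s b1 q1 b2 q2 b3 q3 ->
  has (att f s) q1 -> has (att f s) (b2 :: q2) ->
  jewel_pattern f s b1 q1 b2 q2 b3 q3 \/
  ({in b2 :: q2, forall z, att f s z = (z == b2)} /\
   {in b3 :: q3, forall z, att f s z = (z == b3)}).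
Proof.
move=> tf pf PY AP h1 h2.
have [h3|/hasPn N3] := boolP (has (att f s) (b3 :: q3)).
  right; have pat b q : has (att f s) (b :: q) -> ~~ has (att f s) q ->
      {in b :: q, forall z, att f s z = (z == b)}.
    rewrite [has _ (_ :: _)]/= => + /hasPn nq z.
    case/orP=> [ab|/hasP[y /nq/negbTE->//]]; rewrite inE => /orP[/eqP->|zq].
      by rewrite eqxx.
    have [->//|_] := eqVneq z b; exact/negbTE/nq.
  split; apply: pat => //; apply/negP=> h.
    exact: (no_three_feet tf PY AP h1 h h3).
  exact: (no_three_feet tf (pyr_swap23 PY) (att_pyr_swap23 AP) h1 h h2).
left; have [x xq /hasP[u uF xu]] := hasP h1.
have [y yQ /hasP[v vF yv]] := hasP h2.
have xQ : x \in b1 :: q1 by rewrite inE xq orbT.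
have nx : x != b1.
  case: PY => -[/ipath_uniq /andP[+ _] _ _ _] _ _ _ _ _.
  by apply: contraNneq => <-.
case: (ap_min12 AP uF vF xQ yQ) => [|||[Eu _]|[Eu _]].
- by rewrite sedgeC.
- by rewrite sedgeC.
- by rewrite (negbTE nx).
- apply: two_feet_oriented => //; apply/hasP; exists x => //.
  by rewrite -Eu sedgeC.
case Er: (rev (f :: s)) => [|f' s'].
  by move: (congr1 size Er); rewrite size_rev.
have Er' := esym Er.
have [K' [lf' [lf mF]]] := connector_rev Er' (ap_conn AP).
have aE := att_eq mF.
have [|||] := two_feet_oriented tf pf PY (att_pyr_rev Er' AP).
- by apply/hasP; exists x => //; rewrite -lf -Eu sedgeC.
- by rewrite (eq_has aE).
- by move=> z zQ; rewrite aE N3.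
move=> s0 [x1 [Z1 [E1 p1]]] [x2 [Z2 [E2 p2]]] _; split=> //.
- by apply/nilP; rewrite /nilp -(size_rev s); move: (congr1 size Er); rewrite size_rev s0 /= => -[]; rewrite size_rev => ->.
- by exists x1, Z1; split=> // z /p1; rewrite aE.
by exists x2, Z2; split=> // z /p2; rewrite aE.
Qed.

(** * From arms back to pyramids and jewels *)

Definition pyr_base b1 b2 b3 (i : 'I_3) := nth b1 [:: b1; b2; b3] i.
(** Arms are listed from the base, whereas [is_pyramid] lists its paths from the apex; hence the
    reversal. *)
Definition pyr_path (Q1 Q2 Q3 : seq G) (i : 'I_3) :=
  a :: rev (nth [::] [:: Q1; Q2; Q3] i).

Lemma arm_path b q : arm b q ->
  ipath_between a b (a :: rev (b :: q)) /\ 2 < size (a :: rev (b :: q)).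
Proof.
case=> ip q0 na aq; split; last by rewrite /= size_rev; case: (q) q0.
rewrite /ipath_between /= rev_cons last_rcons !eqxx !andbT -rev_cons.
rewrite -rev_rcons ipath_rev -cats1; apply: (ipath_cat ip (ipath1 a)).
move=> x y xq; rewrite inE => /eqP->; rewrite sedgeC aq // eqxx andbT.
by split=> //; apply: contraNneq na => ax; rewrite -ax.
Qed.

Lemma pyr_pathE (Q : seq G) : a \notin Q -> [set x in a :: rev Q] :\ a =i Q.
Proof.
move=> na z; rewrite !inE mem_rev; have [->|//] := eqVneq z a.
by rewrite (negbTE na).
Qed.

Lemma pyr_pyramid b1 q1 b2 q2 b3 q3 : pyr b1 q1 b2 q2 b3 q3 ->
  is_pyramid a (pyr_base b1 b2 b3) (pyr_path (b1 :: q1) (b2 :: q2) (b3 :: q3)).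
Proof.
case=> A1 A2 A3 X12 X13 X23.
have [[p1 s1] [p2 s2] [p3 s3]] := And3 (arm_path A1) (arm_path A2) (arm_path A3).
have na b q : arm b q -> a \notin b :: q by case.
have ad b q b' q' : cross b q b' q' -> sedge b b' /\ sedge b' b.
  by move=> X; have [_] := X _ _ (mem_head _ _) (mem_head _ _); rewrite !eqxx sedgeC.
have sep b q b' q' : arm b q -> arm b' q' -> cross b q b' q' ->
    {in [set x in a :: rev (b :: q)] :\ a & [set x in a :: rev (b' :: q')] :\ a,
      forall x y, x != y /\ sedge x y = (x == b) && (y == b')}.
  by move=> A A' X x y; rewrite !pyr_pathE ?na //; apply: X.
split.
- by move=> [[|[|[|//]]] ?] [[|[|[|//]]] ?] //= _; rewrite /pyr_base /=;
    first [exact: (ad _ _ _ _ X12).1 | exact: (ad _ _ _ _ X12).2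
      | exact: (ad _ _ _ _ X13).1 | exact: (ad _ _ _ _ X13).2
      | exact: (ad _ _ _ _ X23).1 | exact: (ad _ _ _ _ X23).2].
- by move=> [[|[|[|//]]] ?]; split=> //; apply: ltnW.
- move=> [[|[|[|//]]] ?] [[|[|[|//]]] ?] //= _; apply: sep => //; exact: crossC.
(* An arm has at least two vertices, so no path of this pyramid has length one. *)
move=> [[|[|[|//]]] ?] j E; rewrite /pyr_path /= in E;
  by move: s1 s2 s3; rewrite /= E // ltnn.
Qed.

Lemma pyr_jewel f b1 q1 b2 q2 b3 q3 : pyr b1 q1 b2 q2 b3 q3 ->
  att_pyr f [::] b1 q1 b2 q2 b3 q3 ->
  jewel_pattern f [::] b1 q1 b2 q2 b3 q3 ->
  jewel_for a (pyr_base b1 b2 b3) (pyr_path (b1 :: q1) (b2 :: q2) (b3 :: q3))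
    ord_max f.
Proof.
move=> PY AP [_ J1 J2 N3]; have [fa] := (ap_conn AP).2 f (mem_head _ _).
rewrite sedgeC => nfa.
have nin b q : off f [::] b q -> f \notin a :: rev (b :: q).
  case=> /hasPn/(_ _ (mem_head _ _)) o _.
  by rewrite inE (negbTE fa) mem_rev.
have nb b q : arm b q -> (exists x Z, q = x :: Z /\
      {in b :: q, forall z, att f [::] z = (z \in [:: b; x])}) ->
    nbhd f :&: [set x in a :: rev (b :: q)] =
    cnbhd b :&: [set x in a :: rev (b :: q)].
  move=> [ip q0 naq aq] [x [Z [Eq J]]]; apply/setP=> z.
  rewrite /cnbhd /nbhd !in_setI in_setU1 !in_set in_cons mem_rev.
  have [->|nza] /= := eqVneq z a.
    have -> : sedge f a = false by apply: negbTE.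
    rewrite !andbT; apply/esym/negbTE; rewrite negb_or; apply/andP; split.
      by apply: contraNneq naq => ->; apply: mem_head.
    by rewrite sedgeC aq ?mem_head //; apply: head_neq_last.
  have [zq|] := boolP (z \in b :: q); last by rewrite !andbF.
  rewrite !andbT; have -> : sedge f z = att f [::] z by rewrite /att /= orbF sedgeC.
  rewrite J // !inE; have [//|nzb] /= := eqVneq z b.
  have {}zq : z \in q by rewrite inE (negbTE nzb) in zq.
  move: ip zq; rewrite Eq ipath_cons2 => /and4P[_ bx /hasPn nZ _].
  rewrite in_cons; have [->//|_ /= zZ] := eqVneq z x.
  exact/esym/negbTE/nZ.
split; first exact: pyr_pyramid.
- by case: AP => _ o1 o2 o3 _ _ _ [[|[|[|//]]] ?]; apply: nin.
- move=> x y; rewrite inE => /eqP->; rewrite inE /= inE mem_rev.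
  case/orP=> [/eqP->//|/N3]; by rewrite /att /= orbF sedgeC.
case: PY => A1 A2 _ _ _ _.
by move=> [[|[|[|//]]] ?] //= _; [apply: nb A1 J1 | apply: nb A2 J2].
Qed.

End Pyramid.

(** * Directions at a vertex of a tree *)

Section Trees.
Variable T : sgraph.
Implicit Types (t u v w : T) (e d h : edge T).

Lemma edge_at e w : w \in val e -> exists2 u, sedge w u & val e = [set w; u].
Proof.
have /imsetP[[x y]] := valP e; rewrite inE /= => xy ->.
rewrite !inE => /orP[/eqP->|/eqP->]; first by exists y.
by exists x; rewrite 1?sedgeC // setUC.
Qed.

Lemma edge_adj e w u : val e = [set w; u] -> sedge w u.
Proof.
have /imsetP[[x y]] := valP e; rewrite inE /= => xy ->.
have /eqP nxy := sedge_neq xy; move=> E.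
have wE : w \in [set x; y] by rewrite E !inE eqxx.
have uE : u \in [set x; y] by rewrite E !inE eqxx orbT.
have xE : x \in [set w; u] by rewrite -E !inE eqxx.
have yE : y \in [set w; u] by rewrite -E !inE eqxx orbT.
move: wE uE xE yE {E}; rewrite !inE.
move=> /orP[]/eqP-> /orP[]/eqP->; rewrite ?orbb //; last by move/eqP.
- by move=> _ /eqP /esym.
- by rewrite sedgeC.
Qed.

Lemma mk_edge x y : sedge x y -> exists e : edge T, val e = [set x; y].
Proof.
move=> xy; have eP : [set x; y] \in edge_set T.
  by apply/imsetP; exists (x, y); rewrite ?inE.
by exists (exist (fun E => E \in edge_set T) _ eP).
Qed.

Lemma edge_eq e d w u : val e = [set w; u] -> w \in val d -> u \in val d -> d = e.
Proof.
move=> E wd; have /sedge_neq n := edge_adj E; have [v _ D] := edge_at wd.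
rewrite D !inE eq_sym (negbTE n) /= => /eqP uv; apply: val_inj.
by rewrite E uv.
Qed.

Lemma mem_edgel e w u : val e = [set w; u] -> w \in val e.
Proof. by move->; rewrite !inE eqxx. Qed.

Lemma mem_edger e w u : val e = [set w; u] -> u \in val e.
Proof. by move->; rewrite !inE eqxx orbT. Qed.

Lemma mem_edge2 e w u t : val e = [set w; u] -> t \in val e -> t = w \/ t = u.
Proof. by move=> ->; rewrite !inE => /orP[] /eqP; auto. Qed.

Lemma edge_sym e w u : val e = [set w; u] -> val e = [set u; w].
Proof. by move->; rewrite setUC. Qed.

Lemma edge_sub e h : val h \subset val e -> h = e.
Proof.
have /imsetP[[x y]] := valP h; rewrite inE /= => xy H /subsetP s.
by apply/esym/(edge_eq H); apply: s; rewrite H !inE eqxx ?orbT.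
Qed.

Lemma leaf_edge l e d : leaf l -> l \in val e -> l \in val d -> e = d.
Proof.
move=> /cards1P[x Nx] /edge_at[u lu E] /edge_at[v lv D]; apply: val_inj.
rewrite E D; suff : (u \in nbhd l) && (v \in nbhd l).
  by rewrite Nx !inE => /andP[/eqP-> /eqP->].
by rewrite !inE lu lv.
Qed.

Lemma third_edge w e d : branch w -> w \in val e -> w \in val d ->
  exists h, [/\ w \in val h, h != e & h != d].
Proof.
move=> bw /edge_at[u wu E] /edge_at[v wv D].
have /subsetPn[x] : ~~ (nbhd w \subset [set u; v]).
  apply: contraL bw => /subset_leq_card le.
  by rewrite /branch -leqNgt (leq_trans le) // cards2; case: (_ != _).
rewrite !inE negb_or => wx /andP[nxu nxv].
have [h H] := mk_edge wx; exists h; split; first exact: mem_edgel H.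
  apply: contraNneq nxu => eh; have := mem_edger H; rewrite eh E !inE.
  by rewrite eq_sym (negbTE (sedge_neq wx)).
apply: contraNneq nxv => eh; have := mem_edger H; rewrite eh D !inE.
by rewrite eq_sym (negbTE (sedge_neq wx)).
Qed.

Lemma branch_edges w e d : (leaf w || branch w) -> w \in val e -> w \in val d ->
  e != d -> branch w.
Proof. by case/orP=> // lw we wd; rewrite (leaf_edge lw we wd) eqxx. Qed.

Hypothesis treeT : is_tree T.

Lemma del_edge_sym e : connect_sym (del_edge e).
Proof. by apply: sym_connect_sym => u v; rewrite /del_edge /= sedgeC setUC. Qed.

(** A duplicate-free path from [w] to [u] that avoids [e] would be closed by [e] to a cycle with at
    least three vertices. *)
Lemma bridge e w u : val e = [set w; u] -> ~~ connect (del_edge e) w u.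
Proof.
move=> E; have wu := edge_adj E; apply/negP=> /connectP[p0 pp lp].
move: lp; case/shortenP: pp => p pp Up _ lp.
have [_ _ /(_ (w :: p))] := treeT; rewrite /ucycle Up andbT /= rcons_path -lp.
rewrite [sedge u w]sedgeC wu andbT (sub_path _ pp); last by move=> x y /andP[].
move=> /(_ isT); case: p pp Up lp => [|x [|//]] /=.
  by move=> _ _ uw; rewrite uw sedge_irrefl in wu.
by move=> /andP[/andP[_]] + _ _ ux; rewrite -ux E eqxx.
Qed.

(* The component of [T - e] not containing [w], for [w] an end of [e]. *)
Definition far e w : {set T} := [set t | ~~ connect (del_edge e) w t].

(** Induction along a path from [w] to [t]: the only step that leaves the side of [w] crosses [e],
    and it arrives at [u]. *)
Lemma farE e w u t : val e = [set w; u] ->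
  (t \in far e w) = connect (del_edge e) u t.
Proof.
move=> E; rewrite inE; have [wt|nwt] /= := boolP (connect _ w t).
  apply/esym/negbTE; apply: contra (bridge E) => ut.
  by rewrite (connect_trans wt) // del_edge_sym.
apply/esym; have [_ /(_ w t) /connectP[p]] := treeT; move=> + + _.
elim/last_ind: p t nwt => [|p y IH] t nwt; first by rewrite /= => _ tw; rewrite tw connect0 in nwt.
rewrite rcons_path last_rcons => /andP[pp ly] ty; subst t.
set z := last w p in ly; have [zy|] := boolP (del_edge e z y).
  have nwz : ~~ connect (del_edge e) w z.
    by apply: contra nwt => /connect_trans; apply; apply: connect1.
  by rewrite (connect_trans (IH z nwz pp erefl)) // connect1.
rewrite /del_edge /= ly /= negbK => /eqP zyE.
have [yw|->] := mem_edge2 E (mem_edger (esym zyE)); last exact: connect0.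
by rewrite yw connect0 in nwt.
Qed.

Lemma far_end e w u : val e = [set w; u] -> u \in far e w.
Proof. by move/farE->; apply: connect0. Qed.

Lemma far_self e w : w \notin far e w.
Proof. by rewrite inE connect0. Qed.

Lemma far_sub e w u d : val e = [set w; u] -> u \in val d -> d != e ->
  far d u \subset far e w.
Proof.
move=> E /edge_at[v _ D] nde; apply/subsetP=> t; rewrite (farE _ D) (farE _ E).
case/connectP=> p pp ->; suff H z q : connect (del_edge e) u z ->
    connect (del_edge d) v z -> path (del_edge d) z q ->
    connect (del_edge e) u (last z q).
  apply: H pp => //; apply: connect1; rewrite /del_edge /= (edge_adj D) -D.
  by rewrite (inj_eq val_inj).
elim: q z => //= y q IH z uz vz /andP[zy qq]; apply: IH => //; last first.
  exact: connect_trans vz (connect1 zy).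
apply: connect_trans uz (connect1 _); rewrite /del_edge /= (andP zy).1 /=.
apply/eqP=> zyE; have := bridge D; rewrite del_edge_sym.
have: u \in [set z; y] by rewrite zyE (mem_edger E).
rewrite !inE => /orP[/eqP->|/eqP->]; first by rewrite vz.
by rewrite (connect_trans vz (connect1 zy)).
Qed.

(** The decreasing measure when strands are built outwards. *)
Lemma far_proper e w u d : val e = [set w; u] -> u \in val d -> d != e ->
  #|far d u| < #|far e w|.
Proof.
move=> E ud nde; apply/proper_card/properP; split; first exact: far_sub ud nde.
by exists u; rewrite ?(far_end E) ?far_self.
Qed.

Lemma far_disj e d w t : e != d -> w \in val e -> w \in val d ->
  t \in far e w -> t \notin far d w.
Proof.
move=> ned we /edge_at[v _ D]; have [u _ E] := edge_at we.
move=> /(subsetP (far_sub (edge_sym D) we ned)).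
rewrite (farE _ (edge_sym D)) => wt; rewrite (farE _ D).
apply: contra (bridge D) => vt; rewrite (connect_trans wt) //.
by rewrite del_edge_sym.
Qed.

Lemma far_step e w h s t : w \in val e -> h != e -> s \in val h -> t \in val h ->
  s \in far e w -> t \in far e w.
Proof.
case/edge_at=> u _ E nhe sh th; rewrite !(farE _ E) => us.
have [v sv H] := edge_at sh; have [->//|->] := mem_edge2 H th.
by apply: connect_trans us (connect1 _); rewrite /del_edge /= sv -H (inj_eq val_inj).
Qed.

Lemma far_next e w u t : val e = [set w; u] -> t \in far e w -> t != u ->
  exists d, [/\ u \in val d, d != e & t \in far d u].
Proof.
move=> E; rewrite (farE _ E) => /connectP[p0 pp lp].
move: lp; case/shortenP: pp => -[|s p] /=; first by move=> _ _ _ ->; rewrite eqxx.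
move=> /andP[/andP[us sE] pp] /andP[nu _] _ lp _.
have [d D] := mk_edge us; exists d; split; first exact: mem_edgel D.
  by apply: contraNneq sE => <-; rewrite D.
rewrite (farE _ D); apply/connectP; exists p => //.
have ud := mem_edgel D; elim: p s nu pp {us sE D lp} => //= y p IH s.
rewrite !inE !negb_or => /and3P[us uy up] /andP[/andP[sy _] pp].
rewrite /del_edge /= sy (IH y) ?inE ?negb_or ?uy // andbT.
apply/negP=> /eqP sdE; have : u \in [set s; y] by rewrite sdE.
by rewrite !inE (negbTE us) (negbTE uy).
Qed.

(** One end in the far component suffices, so [e] lies beyond itself: a direction at [w] is its
    first edge [e] together with everything behind it. *)
Definition beyond e w h := [exists t in val h, t \in far e w].

Lemma beyond_self e w : w \in val e -> beyond e w e.
Proof.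
by case/edge_at=> u _ E; apply/existsP; exists u; rewrite (mem_edger E) (far_end E).
Qed.

Lemma beyond_far e w h t : w \in val e -> beyond e w h -> h != e ->
  t \in val h -> t \in far e w.
Proof.
by move=> we /existsP[s /andP[sh sf]] nhe th; apply: (far_step we nhe sh th sf).
Qed.

Lemma beyond_at e w h : w \in val e -> beyond e w h -> w \in val h -> h = e.
Proof.
move=> we bh wh; apply/eqP; apply: contraTT (far_self e w) => nhe.
by rewrite negbK (beyond_far we bh nhe wh).
Qed.

Lemma beyond_meet e d w h k t : e != d -> w \in val e -> w \in val d ->
  beyond e w h -> beyond d w k -> t \in val h -> t \in val k ->
  [/\ t = w, h = e & k = d].
Proof.
move=> ned we wd bh bk th tk; have [tw|ntw] := eqVneq t w.
  by rewrite tw in th tk *; split=> //; [apply: beyond_at bh th | apply: beyond_at bk tk].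
have in_far e' h' : w \in val e' -> beyond e' w h' -> t \in val h' -> t \in far e' w.
  move=> we' bh' th'; have [hE|nhe] := eqVneq h' e'; last exact: beyond_far th'.
  have [u _ E] := edge_at we'; rewrite hE in th'.
  by case: (mem_edge2 E th') ntw => ->; rewrite ?eqxx // (far_end E).
have := far_disj ned we wd (in_far _ _ we bh th).
by rewrite (in_far _ _ wd bk tk).
Qed.

Lemma beyond_neq e d w h k : e != d -> w \in val e -> w \in val d ->
  beyond e w h -> beyond d w k -> h != k.
Proof.
move=> ned we wd bh bk; apply/eqP=> hk.
have /existsP[s /andP[sh _]] := bh; have [t st H] := edge_at sh.
have meet x (xh : x \in val h) : x = w.
  by have [] := beyond_meet ned we wd bh bk xh _; rewrite -?hk.
by rewrite (meet _ sh) (meet _ (mem_edger H)) sedge_irrefl in st.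
Qed.

Lemma beyond_trans e w u d h : val e = [set w; u] -> u \in val d -> d != e ->
  beyond d u h -> beyond e w h.
Proof.
move=> E ud nde /existsP[t /andP[th tf]]; apply/existsP; exists t.
by rewrite th (subsetP (far_sub E ud nde)).
Qed.

Lemma beyond_next e w u h : val e = [set w; u] -> beyond e w h -> h != e ->
  exists d, [/\ u \in val d, d != e & beyond d u h].
Proof.
move=> E bh nhe; have we := mem_edgel E.
have [uh|nuh] := boolP (u \in val h).
  by exists h; split=> //; apply: beyond_self.
have /existsP[t /andP[th tf]] := bh.
have [|d [ud nde td]] := far_next E tf; first by apply: contraNneq nuh => <-.
by exists d; split=> //; apply/existsP; exists t; rewrite th.
Qed.

(** Some end of [h] is not an end of [e]. Seen from one end of [e] it lies across [e], and [d] is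
    the first edge on the way to it from the opposite end. *)
Lemma beyond_exists e h : h != e ->
  exists w d, [/\ w \in val e, w \in val d, d != e & beyond d w h].
Proof.
move=> nhe; have /imsetP[[w u]] := valP e; rewrite inE /= => wu E.
have E' := edge_sym E.
have /existsP[s0 /andP[s0h _]] : [exists s in val h, true].
  have /imsetP[[x y]] := valP h; rewrite inE /= => _ ->.
  by apply/existsP; exists x; rewrite !inE eqxx.
have [t th nte] : exists2 t, t \in val h & t \notin val e.
  apply/subsetPn; apply: contra nhe => /subsetP s.
  have [s1 s01 H] := edge_at s0h.
  by apply/eqP/esym/(edge_eq H); apply: s; rewrite // (mem_edger H).
have nt x : x \in val e -> t != x by apply: contraTneq => <-.
have [tf|] := boolP (t \in far e w).
  have [|d [ud nde td]] := far_next E tf; first exact/nt/mem_edger/E.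
  exists u, d; split=> //; first exact: mem_edger E.
  by apply/existsP; exists t; rewrite th.
rewrite inE negbK -(farE _ E') => tf.
have [|d [ud nde td]] := far_next E' tf; first exact/nt/mem_edgel/E.
exists w, d; split=> //; first exact: mem_edgel E.
by apply/existsP; exists t; rewrite th.
Qed.

End Trees.

(** * Rungs and strands *)

Section OrientedRungs.
Variables (G T : sgraph) (eta : strip_map G T).
Implicit Types (u v w l : T) (e d h k : edge T) (x y z r : G) (p q R : seq G).

(* A rung of [e] listed from its [w]-end to its [u]-end. *)
Definition orung e w u r R :=
  [/\ val e = [set w; u], ipath (r :: R), {subset r :: R <= se eta e},
      {in r :: R, forall z, (z \in sev eta e w) = (z == r)} &
      {in r :: R, forall z, (z \in sev eta e u) = (z == last r R)}].

Lemma orung_rev e w u r R : orung e w u r R ->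
  exists r' R', orung e u w r' R' /\ r' :: R' = rev (r :: R).
Proof.
case=> E ip sub hw hu; case Er: (rev (r :: R)) => [|r' R'].
  by move: (congr1 size Er); rewrite size_rev.
exists r', R'; split=> //.
have El : last r R = r'.
  by rewrite -[last r R]/(last r (r :: R)) -[r :: R]revK Er rev_cons last_rcons.
have Eh : last r' R' = r.
  by rewrite -[last r' R']/(last r (r' :: R')) -Er rev_cons last_rcons.
split; rewrite -?Er ?ipath_rev ?(edge_sym E) //.
- by move=> z; rewrite mem_rev; apply: sub.
- by move=> z; rewrite mem_rev -El; apply: hu.
by move=> z; rewrite mem_rev Eh; apply: hw.
Qed.

(** Both alternatives in [rung], one vertex or two distinct ends, become the same two equations
    about ends; a single vertex is the case of an empty [R]. *)
Lemma rung_orung e A w u : rung eta e A -> val e = [set w; u] ->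
  exists r R, orung e w u r R /\ A = [set x in r :: R].
Proof.
move=> [u0 [v0 [E0 [p ip [EA [subA cases]]]]]] E.
have [r [R [OR ER]]] : exists r R, orung e u0 v0 r R /\ r :: R = p.
  case: cases => [[cA sA]|[x [y [bp xu yv int]]]].
    case: p ip EA => [|r [|r2 R]] ip EA //.
      exists r, [::]; split=> //.
      have rA : r \in A by rewrite EA inE mem_head.
      have := subsetP sA _ rA; rewrite inE => /andP[ru rv].
      by split=> // z; rewrite inE => /eqP->; rewrite ?eqxx ?ru ?rv ?(subsetP subA).
    by move: cA; rewrite EA cardsE (card_uniqP (ipath_uniq ip)).
  case: p ip EA bp int => [|r R] // ip EA /and3P[_ /eqP /= Er /eqP Ey] int.
  exists r, R; split=> //.
  have inint z w0 : z \in r :: R -> z != r -> z != y -> w0 \in val e ->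
      z \notin sev eta e w0.
    move=> zp nr ny we; have : z \in eta_int eta e.
      by apply: (subsetP int); rewrite !inE in zp *; rewrite negb_or -Er nr ny.
    rewrite inE => /andP[+ _]; apply: contra => zw.
    by apply/bigcupP; exists w0.
  move: xu yv; rewrite !inE -Er => /andP[nrv ru] /andP[nyu yv].
  have neq : r != y by apply: contraNneq nyu => <-.
  split=> // [z zp|z zp|z zp].
  - by apply: (subsetP subA); rewrite EA inE.
  - have [->//|nr] := eqVneq z r.
    have [->|ny] := eqVneq z y; first exact: negbTE.
    exact/negbTE/inint/(mem_edgel E0).
  rewrite Ey; have [->//|ny] := eqVneq z y.
  have [->|nr] := eqVneq z r; first exact: negbTE.
  exact/negbTE/inint/(mem_edger E0).
have Ap : A = [set x in r :: R] by rewrite ER.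
have [wu|[wv uu]] : (w = u0 /\ u = v0) \/ (w = v0 /\ u = u0).
  have wv : w \in val e by rewrite E !inE eqxx.
  have uv : u \in val e by rewrite E !inE eqxx orbT.
  have nwu : w != u by apply/sedge_neq/(edge_adj E).
  case: (mem_edge2 E0 wv) nwu => ->; case: (mem_edge2 E0 uv) => ->;
    rewrite ?eqxx //; auto.
  by exists r, R; rewrite wu.1 wu.2.
have [r' [R' [OR' Er']]] := orung_rev OR.
by exists r', R'; rewrite wv uu; split=> //; rewrite Ap Er'; apply/setP=> z; rewrite !inE mem_rev inE.
Qed.

Lemma orung_rung e w u r R : orung e w u r R -> rung eta e [set x in r :: R].
Proof.
case=> E ip sub hw hu; exists w, u; split=> //.
exists (r :: R) => //; split=> //; split.
  by apply/subsetP=> z; rewrite inE; apply: sub.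
have rm := mem_head r R; have lm := mem_last r R.
have [R0|R0] := eqVneq R [::].
  left; split; first by rewrite R0 cardsE (card_uniqP _).
  apply/subsetP=> z.
  by rewrite R0 !inE => /eqP->; rewrite hw // hu // R0 !eqxx.
have nrl : r != last r R by apply: head_neq_last.
right; exists r, (last r R); split; first by rewrite /ipath_between ip !eqxx.
- by rewrite inE hw // hu // eqxx andbT.
- by rewrite inE hw // hu // eqxx andbT eq_sym.
apply/subsetP=> z; rewrite !inE negb_or => /andP[/andP[nr nl] zR].
have zR' : z \in r :: R by rewrite inE.
rewrite sub // andbT; apply/negP=> /bigcupP[t te].
by have [->|->] := mem_edge2 E te; rewrite ?hw ?hu // ?(negbTE nr) ?(negbTE nl).
Qed.

Lemma orung_head e w u r R : orung e w u r R -> r \in sev eta e w.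
Proof. by case=> _ _ _ -> //; rewrite ?eqxx ?mem_head. Qed.

Lemma orung_last e w u r R : orung e w u r R -> last r R \in sev eta e u.
Proof. by case=> _ _ _ _ ->; rewrite ?eqxx ?mem_last. Qed.

End OrientedRungs.

(** * Strands as arms of pyramids *)

Section Strands.
Variables (G T : sgraph) (a : G) (eta : strip_map G T).
Implicit Types (u v w l : T) (e d h k : edge T) (x y z r : G) (p q R : seq G).

(** The hypotheses on [eta] in terms of oriented rungs. This is the invariant that adding a rung
    preserves. *)
Record good : Prop := Good {
  good_strip : strip_structure a eta;
  good_vertex : forall v, sv eta v = set0;
  good_tame : forall e w u z, val e = [set w; u] -> z \in se eta e ->
    exists r R, orung eta e w u r R /\ z \in r :: R;
  good_long : forall e w u, val e = [set w; u] ->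
    exists r R, orung eta e w u r R /\ R != [::];
  good_rich : rich a eta }.

(* [r :: R] is the rung of [e] at [w] and [q] continues it, rung after rung,
   up to a leaf of [T]; these are the paths [Gamma_i] of an eta-pyramid. *)
Inductive strand : T -> edge T -> G -> seq G -> seq G -> Prop :=
| StrandLeaf w e l r R : leaf l -> orung eta e w l r R -> strand w e r R [::]
| StrandStep w e u d r R b R' q : orung eta e w u r R ->
    u \in val d -> d != e -> strand u d b R' q ->
    strand w e r R (b :: (R' ++ q)).

Hypotheses (smoothT : smooth_tree T) (gd : good).

Let treeT : is_tree T := let: And3 H _ _ := smoothT in H.
Let leaf_or_branch v : leaf v || branch v.
Proof. by case: smoothT. Qed.

Let sS1 : strip1 eta. Proof. by case: (good_strip gd) => [[]]. Qed.
Let sS3 : strip3 eta. Proof. by case: (good_strip gd) => [[]]. Qed.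
Let sS4 : strip4 eta. Proof. by case: (good_strip gd) => [[]]. Qed.
Let sS8 : strip8 a eta. Proof. by case: (good_strip gd) => _ []. Qed.
Let sav : avoids_apex a eta. Proof. by case: (good_strip gd) => [[]]. Qed.

Lemma se_eq e d z : z \in se eta e -> z \in se eta d -> e = d.
Proof.
move=> ze zd; apply/eqP; case: sS1 => _ H _; apply: contraTT ze => /H.
by rewrite disjoint_sym => /disjointFr->.
Qed.

Lemma sev_se e v z : z \in sev eta e v -> z \in se eta e /\ v \in val e.
Proof.
move=> zv; have [/subsetP s E] := sS3 e v; split; first exact: s.
by rewrite -E; apply/set0Pn; exists z.
Qed.

Lemma eta_allP z : reflect (exists e, z \in se eta e) (z \in eta_all eta).
Proof.
apply: (iffP idP) => [|[e ze]].
  rewrite inE => /orP[/bigcupP[v _]|/bigcupP[e _ ze]]; last by exists e.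
  by rewrite (good_vertex gd) inE.
by rewrite inE; apply/orP; right; apply/bigcupP; exists e; rewrite ?subsetT.
Qed.

(** By (S4) an edge between two strips lies at a common vertex of their edges in [T], and two
    directions at [w] meet only in [w], through their first edges. *)
Lemma adj_beyond w e d h k x y : e != d -> w \in val e -> w \in val d ->
  beyond e w h -> beyond d w k -> x \in se eta h -> y \in se eta k ->
  x != y /\ sedge x y = (x \in sev eta e w) && (y \in sev eta d w).
Proof.
move=> ned we wd bh bk xh yk; have nhk := beyond_neq treeT ned we wd bh bk.
split; first by apply: contraNneq nhk => xy; rewrite -xy in yk; rewrite (se_eq xh yk).
apply/idP/andP=> [xy|[xe yd]]; last exact: ((sS4 ned).1 w x y xe yd).
have [v [xv yv]] := (sS4 nhk).2 x y xh yk xy.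
have [_ vh] := sev_se xv; have [_ vk] := sev_se yv.
by have [<- <- <-] := beyond_meet treeT ned we wd bh bk vh vk.
Qed.

Lemma apex_se z e : z \in se eta e -> a != z.
Proof. by case: sav => _ H _; apply: contraTneq => <-. Qed.

Lemma apex_adj z e w u : val e = [set w; u] -> ~~ leaf w -> z \in se eta e ->
  sedge a z = leaf u && (z \in sev eta e u).
Proof.
move=> E nlw ze; apply/idP/andP=> [az|[lu zu]].
  have [|l [d [ll ld zd]]] := sS8.2 z _ az; first by apply/eta_allP; exists e.
  have Ed : e = d by apply: se_eq ze (sev_se zd).1.
  rewrite -Ed in ld zd; have [El|El] := mem_edge2 E ld; rewrite El in ll zd.
    by rewrite ll in nlw.
  by [].
by apply: (sS8.1 u e lu (mem_edger E)); rewrite ?inE ?eqxx.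
Qed.

(** By richness all rungs of [e] end in the same vertex at [l]. A long rung shows that this vertex
    is not in [eta(e,w)], while a one-vertex rung would put it there. *)
Lemma leaf_rung_long e w l r R : leaf l -> orung eta e w l r R -> R != [::].
Proof.
move=> ll OR; apply/eqP=> R0; rewrite R0 in OR.
have [E _ _ _ _] := OR; have le := mem_edger E.
have [r' [R' [OR' nR']]] := good_long gd E.
have /eqP/cards1P[c Ec] := (good_rich gd).2 l e ll le.
have := orung_last OR; have := orung_last OR'; rewrite Ec !inE /= => /eqP lc /eqP rc.
have := orung_head OR; rewrite rc -lc; case: OR' => _ ip _ hw _.
by rewrite hw ?mem_last // eq_sym (negbTE (head_neq_last ip nR')).
Qed.

Lemma strip_nonempty e v : v \in val e -> exists z, z \in se eta e.
Proof.
move=> ve; have [_] := sS3 e v; rewrite ve => /set0Pn[z /sev_se[]].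
by exists z.
Qed.

Lemma strand_first w e r R q : strand w e r R q ->
  exists u, orung eta e w u r R.
Proof. by case=> *; eexists; eassumption. Qed.

Lemma strand_props w e r R q : ~~ leaf w -> strand w e r R q ->
  [/\ arm a r (R ++ q), r \in sev eta e w,
      {in r :: R ++ q, forall z, exists2 h, beyond e w h & z \in se eta h} &
      {in r :: R ++ q, forall z, (z \in sev eta e w) = (z == r)}].
Proof.
move=> nlw st; elim: st nlw => {w e r R q} [w e l r R ll OR|w e u d r R b R' q OR ud nde st IH] nlw.
  have [E ip sub hw hl] := OR; have we := mem_edgel E; rewrite cats0; split=> //.
  (* Every strand has at least two vertices because its rung at the leaf is long. *)
  - split=> //; first exact: leaf_rung_long ll OR.
    + by apply/negP=> /sub /apex_se; rewrite eqxx.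
    + by move=> z zR; rewrite (apex_adj E nlw (sub _ zR)) ll hl.
  - exact: orung_head OR.
  by move=> z /sub ze; exists e => //; apply: beyond_self.
have [E ip sub hw hu] := OR; have [we ue] := (mem_edgel E, mem_edger E).
have nlu : ~~ leaf u by apply: contraNN nde => lu; rewrite (leaf_edge lu ud ue).
have [[ipq q0 naq aq] bd bq hd] := IH nlu.
have ned : e != d by rewrite eq_sym.
have X x y : x \in r :: R -> y \in b :: R' ++ q ->
    x != y /\ sedge x y = (x == last r R) && (y == b).
  move=> xR yq; have [h bh yh] := bq _ yq.
  have [n ->] := adj_beyond ned ue ud (beyond_self treeT ue) bh (sub _ xR) yh.
  by rewrite hu ?hd.
have catE : r :: R ++ b :: R' ++ q = (r :: R) ++ b :: R' ++ q by [].
have lastE : last r (R ++ b :: R' ++ q) = last b (R' ++ q) by rewrite last_cat.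
split.
- split.
  + by rewrite catE; apply: ipath_cat ip ipq X.
  + by case: (R).
  + rewrite catE mem_cat negb_or naq andbT.
    by apply/negP=> /sub /apex_se; rewrite eqxx.
  move=> z; rewrite catE mem_cat lastE => /orP[zR|]; last exact: aq.
  rewrite (apex_adj E nlw (sub _ zR)) (negbTE nlu) /=.
  by have [/negbTE->] := X z _ zR (mem_last _ _).
- exact: orung_head OR.
- move=> z; rewrite catE mem_cat => /orP[/sub ze|/bq[h bh zh]].
    by exists e => //; apply: beyond_self.
  by exists h => //; apply: beyond_trans bh.
move=> z; rewrite catE mem_cat => /orP[/hw->//|zq].
have [h bh zh] := bq _ zq.
have [/negbTE nrz _] := X r z (mem_head _ _) zq; rewrite [RHS]eq_sym nrz.
apply/negP=> /sev_se[ze _].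
have := beyond_neq treeT ned ue ud (beyond_self treeT ue) bh.
by rewrite (se_eq ze zh) eqxx.
Qed.

(** The strand is built outwards from [w]: towards [h] along arbitrary rungs, through [h] along a
    rung containing [z], which tameness provides, and from there to any leaf. *)
Lemma strand_exists w e h z : w \in val e -> beyond e w h -> z \in se eta h ->
  exists r R q, strand w e r R q /\ z \in r :: R ++ q.
Proof.
have [n] := ubnP #|far e w|; elim: n => // n IH in w e h z * => lt we bh zh.
have [u wu E] := edge_at we.
have rest r R z' d k : orung eta e w u r R -> u \in val d -> d != e ->
    beyond d u k -> z' \in se eta k -> exists q, strand w e r R q /\ z' \in q.
  move=> OR ud nde bk zk; have lt' : #|far d u| < n.
    by apply: leq_trans (far_proper treeT E ud nde) _; rewrite -ltnS.
  have [b [R' [q [st zq]]]] := IH u d k z' lt' ud bk zk.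
  by exists (b :: R' ++ q); split=> //; apply: StrandStep OR ud nde st.
have [he|nhe] := eqVneq h e; last first.
  have [d [ud nde bd]] := beyond_next treeT E bh nhe.
  have [r [R [OR _]]] := good_long gd E.
  have [q [st zq]] := rest r R z d h OR ud nde bd zh.
  by exists r, R, q; split=> //; rewrite inE mem_cat zq !orbT.
rewrite he in zh; have [r [R [OR zR]]] := good_tame gd E zh.
have [lu|nlu] := boolP (leaf u).
  by exists r, R, [::]; split; [apply: StrandLeaf OR | rewrite cats0].
have bu : branch u by have := leaf_or_branch u; rewrite (negbTE nlu).
(* Given the same edge twice, [third_edge] yields some continuation of [e] at [u]. *)
have [d [ud nde _]] := third_edge bu (mem_edger E) (mem_edger E).
have [z' z'd] := strip_nonempty ud.
have [q [st _]] := rest r R z' d d OR ud nde (beyond_self treeT ud) z'd.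
by exists r, R, q; split=> //; rewrite -cat_cons mem_cat zR.
Qed.

Lemma two_edges_nonleaf w e d : e != d -> w \in val e -> w \in val d -> ~~ leaf w.
Proof. by move=> ned we wd; apply: contra ned => lw; rewrite (leaf_edge lw we wd). Qed.

Lemma strand_cross w e d r R q r' R' q' : e != d -> w \in val e -> w \in val d ->
  strand w e r R q -> strand w d r' R' q' -> cross r (R ++ q) r' (R' ++ q').
Proof.
move=> ned we wd st st' x y xq yq; have nl := two_edges_nonleaf ned we wd.
have [_ _ bx hx] := strand_props nl st; have [_ _ byy hy] := strand_props nl st'.
have [h bh xh] := bx _ xq; have [k bk yk] := byy _ yq.
by have [n ->] := adj_beyond ned we wd bh bk xh yk; rewrite hx ?hy.
Qed.

Lemma strand_pyr w e1 e2 e3 r1 R1 q1 r2 R2 q2 r3 R3 q3 :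
  e1 != e2 -> e1 != e3 -> e2 != e3 ->
  w \in val e1 -> w \in val e2 -> w \in val e3 ->
  strand w e1 r1 R1 q1 -> strand w e2 r2 R2 q2 -> strand w e3 r3 R3 q3 ->
  pyr a r1 (R1 ++ q1) r2 (R2 ++ q2) r3 (R3 ++ q3).
Proof.
move=> n12 n13 n23 w1 w2 w3 s1 s2 s3; have nl := two_edges_nonleaf n12 w1 w2.
have [[A1 _ _ _] [A2 _ _ _] [A3 _ _ _]] :=
  And3 (strand_props nl s1) (strand_props nl s2) (strand_props nl s3).
split=> //; [exact: strand_cross s1 s2 | exact: strand_cross s1 s3 | exact: strand_cross s2 s3].
Qed.

End Strands.

(** * Attachments to a strip-structure *)

Section Feet.
Variables (G T : sgraph) (a : G) (eta : strip_map G T).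
Implicit Types (u v w l : T) (e d h k : edge T) (x y z r f : G) (p q R s : seq G).
Hypotheses (tf : theta_free G) (pf : prism_free G).
Hypotheses (smoothT : smooth_tree T) (gd : good a eta).

Let treeT : is_tree T := let: And3 H _ _ := smoothT in H.

(** Recovers from a strand the leaf and the path of [T] that [eta_pyramid] asks for. *)
Lemma strand_tree_path w e r R q : ~~ leaf w -> strand eta w e r R q ->
  exists L, [/\ leaf (last w L), last w L \in far e w, ipath (w :: L),
    {subset L <= far e w} & [/\ val e \subset [set t in w :: L],
    {in r :: R ++ q, forall z,
       exists2 h : edge T, val h \subset [set t in w :: L] & z \in se eta h},
    [set z in r :: R ++ q] :&: se eta e = [set z in r :: R] &
    forall h : edge T, val h \subset [set t in w :: L] -> h != e ->
      rung eta h ([set z in r :: R ++ q] :&: se eta h)]].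
Proof.
move=> nlw st; elim: st nlw => {w e r R q} [w e l r R ll OR|w e u d r R b R' q OR ud nde st IH] nlw.
  have [E ip sub hw hl] := OR; have lf := far_end treeT E.
  have sE : val e \subset [set t in [:: w; l]] by rewrite E; apply/subsetP=> t; rewrite !inE.
  exists [:: l]; split=> //.
  - by rewrite ipath_cons2 (edge_adj E) ipath1 inE (sedge_neq (edge_adj E)).
  - by move=> t; rewrite inE => /eqP->.
  split=> //.
  - by move=> z; rewrite cats0 => /sub ze; exists e.
  - by rewrite cats0; apply/setIidPl/subsetP=> z; rewrite inE; apply: sub.
  move=> h hs /eqP[]; apply: edge_sub; apply: subset_trans hs _.
  by rewrite E; apply/subsetP=> t; rewrite !inE.
have [E ip sub hw hu] := OR; have [we ue] := (mem_edgel E, mem_edger E).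
have nlu : ~~ leaf u by apply: contraNN nde => lu; rewrite (leaf_edge lu ud ue).
have ned : e != d by rewrite eq_sym.
have [L [ll lf iL sL [dL qL dR rL]]] := IH nlu.
have [_ _ bq _] := strand_props smoothT gd nlu st.
have sub_far := subsetP (far_sub treeT E ud nde).
have sL' : {subset u :: L <= far e w}.
  by move=> t; rewrite inE => /orP[/eqP->|/sL/sub_far//]; apply: far_end.
have nwL : w \notin u :: L by apply: contra (far_self e w); apply: sL'.
(* All vertices of the path after [w] lie across [e], so [e] is its only edge at [w]. *)
have nw h : val h \subset [set t in w :: u :: L] -> h != e -> w \notin val h.
  move=> /subsetP hs nhe; apply/negP=> wh; have [t wt H] := edge_at wh.
  have th := mem_edger H; have tf' : t \in far e w.
    by apply: sL'; have := hs _ th; rewrite !inE eq_sym (negbTE (sedge_neq wt)).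
  by have := far_step treeT we nhe th wh tf'; rewrite (negbTE (far_self e w)).
have hL h : val h \subset [set t in w :: u :: L] -> h != e ->
    val h \subset [set t in u :: L].
  move=> hs nhe; apply/subsetP=> t th; have := subsetP hs _ th.
  by rewrite !inE => /orP[/eqP tw|//]; have := nw _ hs nhe; rewrite -tw th.
have qe : {in b :: R' ++ q, forall z, z \notin se eta e}.
  move=> z /bq[h bh zh]; apply/negP=> ze.
  have := beyond_neq treeT ned ue ud (beyond_self treeT ue) bh.
  by rewrite (se_eq gd ze zh) eqxx.
have catE : r :: R ++ b :: R' ++ q = (r :: R) ++ b :: R' ++ q by [].
have sub_cons : [set t in u :: L] \subset [set t in w :: u :: L].
  by apply/subsetP=> t; rewrite !inE => ->; rewrite orbT.
exists (u :: L); split=> //; first exact/sub_far.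
  rewrite ipath_cons2 nwL (edge_adj E) iL andbT /=; apply/hasPn=> t tL.
  apply/negP=> wt; have [h H] := mk_edge wt.
  suff : w \notin val h by rewrite (mem_edgel H).
  apply: nw; first by rewrite H; apply/subsetP=> z; rewrite !inE => /orP[]/eqP->; rewrite ?eqxx // tL !orbT.
  apply: contraNneq (far_self d u) => he; have := mem_edger H.
  rewrite he => te; case: (mem_edge2 E te) => tE; last by apply: sL; rewrite -tE.
  by rewrite tE sedge_irrefl in wt.
split.
- by rewrite E; apply/subsetP=> t; rewrite !inE => /orP[]/eqP->; rewrite eqxx ?orbT.
- move=> z; rewrite catE mem_cat => /orP[/sub ze|/qL[h hs zh]].
    exists e => //.
    by rewrite E; apply/subsetP=> t; rewrite !inE => /orP[]/eqP->; rewrite eqxx ?orbT.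
  by exists h => //; apply: subset_trans sub_cons.
- apply/setP=> z; rewrite in_setI !in_set catE mem_cat.
  have [zR|_] /= := boolP (z \in r :: R); first by rewrite sub.
  by apply/negbTE; rewrite negb_and -implybE; apply/implyP=> /qe.
move=> h hs nhe; have -> : [set z in r :: R ++ b :: R' ++ q] :&: se eta h =
    [set z in b :: R' ++ q] :&: se eta h.
  apply/setP=> z; rewrite !in_setI !in_set catE mem_cat.
  have [zR|//] /= := boolP (z \in r :: R).
  have -> : (z \in se eta h) = false; last by rewrite andbF.
  by apply: contraNF nhe => zh; rewrite (se_eq gd zh (sub _ zR)).
have [->|nhd] := eqVneq h d; last exact: rL (hL _ hs nhe) nhd.
have [u' OR'] := strand_first st; have [D' _ _ _ _] := OR'.
by rewrite dR; apply: orung_rung OR'.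
Qed.

(* A set of attachments is local (inside one [eta(e)] or one [B_eta(v)]) as soon
   as its pairs are, because a tree has no triangles. *)
Definition local x y :=
  (exists e, x \in se eta e /\ y \in se eta e) \/
  (exists v, x \in eta_B eta v /\ y \in eta_B eta v).

Lemma local_sym x y : local x y -> local y x.
Proof. by case=> -[o [xo yo]]; [left|right]; exists o. Qed.

Lemma eta_BP v z : reflect (exists e, z \in sev eta e v) (z \in eta_B eta v).
Proof.
apply: (iffP bigcupP) => [[e _ ze]|[e ze]]; exists e => //.
by case: (sev_se gd ze).
Qed.

Lemma local_beyond w e d h k x y : e != d -> w \in val e -> w \in val d ->
  beyond e w h -> beyond d w k -> x \in se eta h -> y \in se eta k ->
  local x y -> x \in sev eta e w /\ y \in sev eta d w.
Proof.
move=> ned we wd bh bk xh yk [[c [xc yc]]|[v [/eta_BP[c xc] /eta_BP[c' yc']]]].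
  have := beyond_neq treeT ned we wd bh bk.
  by rewrite (se_eq gd xh xc) (se_eq gd yk yc) eqxx.
have [xc0 vc] := sev_se gd xc; have [yc0 vc'] := sev_se gd yc'.
have Eh := se_eq gd xh xc0; have Ek := se_eq gd yk yc0; subst h k.
by have [E1 E2 E3] := beyond_meet treeT ned we wd bh bk vc vc'; subst v c c'.
Qed.

Record connecting f s : Prop := Connecting {
  cn_ipath : ipath (f :: s);
  cn_out : {in f :: s, forall u : G, u \notin eta_plus a eta};
  cn_jewel : {in f :: s, forall u : G, ~ is_jewel a eta u};
  cn_min : forall (u v : G) x y, u \in f :: s -> v \in f :: s ->
    x \in eta_all eta -> y \in eta_all eta -> sedge u x -> sedge v y ->
    ~ local x y -> (u = f /\ v = last f s) \/ (u = last f s /\ v = f) }.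

Lemma out_apex (u : G) : u \notin eta_plus a eta -> u != a /\ ~~ sedge a u.
Proof.
move=> nu; split; first by apply: contraNneq nu => ->; rewrite !inE eqxx.
apply: contra nu => au; apply: ((good_rich gd).1).1.
by exists [:: u]; rewrite /= au.
Qed.

(** Here distance two in [trapped] is used; it supplies the second clause of [off]. *)
Lemma out_apex2 (u : G) z : u \notin eta_plus a eta -> sedge a z -> ~~ sedge z u.
Proof.
move=> nu az; apply: contra nu => zu; apply: ((good_rich gd).1).1.
by exists [:: z; u]; rewrite /= az zu.
Qed.

Lemma out_se (u : G) z e : u \notin eta_plus a eta -> z \in se eta e -> u != z.
Proof.
move=> nu ze; apply: contraNneq nu => ->; rewrite inE; apply/orP; right.
by apply/(eta_allP gd); exists e.
Qed.

Lemma strand_att_pyr f s w e1 e2 e3 r1 R1 q1 r2 R2 q2 r3 R3 q3 :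
  connecting f s -> e1 != e2 -> e1 != e3 -> e2 != e3 ->
  w \in val e1 -> w \in val e2 -> w \in val e3 ->
  strand eta w e1 r1 R1 q1 -> strand eta w e2 r2 R2 q2 ->
  strand eta w e3 r3 R3 q3 ->
  att_pyr a f s r1 (R1 ++ q1) r2 (R2 ++ q2) r3 (R3 ++ q3).
Proof.
move=> C n12 n13 n23 w1 w2 w3 s1 s2 s3; have nl := two_edges_nonleaf n12 w1 w2.
have off_strand e r R q : strand eta w e r R q -> off f s r (R ++ q).
  move=> st; have [[_ _ _ aq] _ bq _] := strand_props smoothT gd nl st.
  split; apply/hasPn=> u uF; have nu := cn_out C uF.
    by apply/negP=> /bq[h _ uh]; have := out_se nu uh; rewrite eqxx.
  by apply: out_apex2 => //; rewrite aq ?mem_last.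
have min_strand e d r R q r' R' q' : e != d -> w \in val e -> w \in val d ->
    strand eta w e r R q -> strand eta w d r' R' q' ->
    min_conn f s r (R ++ q) r' (R' ++ q').
  move=> ned we wd st st' u v x y uF vF xq yq ux vy nxy.
  have [_ _ bx hx] := strand_props smoothT gd nl st.
  have [_ _ byy hy] := strand_props smoothT gd nl st'.
  have [h bh xh] := bx _ xq; have [k bk yk] := byy _ yq.
  apply: (cn_min C uF vF _ _ ux vy); [by apply/(eta_allP gd); exists h| by apply/(eta_allP gd); exists k|].
  move=> /(local_beyond ned we wd bh bk xh yk)[]; rewrite hx ?hy // => xr yr.
  by rewrite xr yr in nxy.
split.
- by split; [exact: cn_ipath C | move=> u /(cn_out C)/out_apex].
- exact: off_strand s1.
- exact: off_strand s2.
- exact: off_strand s3.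
- exact: min_strand s1 s2.
- exact: min_strand s1 s3.
- exact: min_strand s2 s3.
Qed.

Lemma strand_feet f s w e1 e2 e3 r1 R1 q1 r2 R2 q2 r3 R3 q3 :
  connecting f s -> e1 != e2 -> e1 != e3 -> e2 != e3 ->
  w \in val e1 -> w \in val e2 -> w \in val e3 ->
  strand eta w e1 r1 R1 q1 -> strand eta w e2 r2 R2 q2 ->
  strand eta w e3 r3 R3 q3 ->
  has (att f s) (R1 ++ q1) -> has (att f s) (r2 :: R2 ++ q2) ->
  jewel_pattern f s r1 (R1 ++ q1) r2 (R2 ++ q2) r3 (R3 ++ q3) \/
  ({in r2 :: R2 ++ q2, forall z, att f s z = (z == r2)} /\
   {in r3 :: R3 ++ q3, forall z, att f s z = (z == r3)}).
Proof.
move=> C n12 n13 n23 w1 w2 w3 s1 s2 s3; apply: foot_or_jewel => //.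
  exact: (strand_pyr smoothT gd n12 n13 n23 w1 w2 w3 s1 s2 s3).
exact: (strand_att_pyr C n12 n13 n23 w1 w2 w3 s1 s2 s3).
Qed.

Lemma jewel_pattern_swap f s b1 q1 b2 q2 b3 q3 :
  jewel_pattern f s b1 q1 b2 q2 b3 q3 -> jewel_pattern f s b2 q2 b1 q1 b3 q3.
Proof. by case. Qed.

(** The first rung can be exchanged while the rest stays, since (S4) joins any end of a rung of [e]
    to the next rung. *)
Lemma strand_long w e r R q : strand eta w e r R q ->
  exists r' R', R' != [::] /\ strand eta w e r' R' q.
Proof.
case=> {w e r R q} [w e l r R ll [E _ _ _ _]|w e v d r R b R' q [E _ _ _ _] vd nde st].
  have [r' [R' [OR' nR']]] := good_long gd E.
  by exists r', R'; split=> //; apply: StrandLeaf OR'.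
have [r' [R'' [OR' nR']]] := good_long gd E.
by exists r', R''; split=> //; apply: StrandStep OR' vd nde st.
Qed.

(* Rerouting a strand through a long first rung keeps the attachments of a
   jewel, which forces the first rung to have been long. *)
Lemma jewel_first_rung_long f s w e1 e2 e3 r1 R1 q1 r2 R2 q2 r3 R3 q3 :
  connecting f s -> e1 != e2 -> e1 != e3 -> e2 != e3 ->
  w \in val e1 -> w \in val e2 -> w \in val e3 ->
  strand eta w e1 r1 R1 q1 -> strand eta w e2 r2 R2 q2 ->
  strand eta w e3 r3 R3 q3 ->
  jewel_pattern f s r1 (R1 ++ q1) r2 (R2 ++ q2) r3 (R3 ++ q3) -> R1 != [::].
Proof.
move=> C n12 n13 n23 w1 w2 w3 s1 s2 s3 [s0 [x1 [Z1 [E1 p1]]] [x2 [Z2 [E2 p2]]] _].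
apply/eqP=> R0; have nl := two_edges_nonleaf n12 w1 w2.
have x1a : att f s x1 by rewrite p1 ?E1 !inE eqxx ?orbT.
have r2a : att f s r2 by rewrite p2 !inE eqxx.
have x2a : att f s x2 by rewrite p2 ?E2 !inE eqxx ?orbT.
have [[/ipath_uniq U2 _ _ _] _ _ _] := strand_props smoothT gd nl s2.
have [r [R [nR s1']]] := strand_long s1.
have [[/ipath_uniq U1 _ _ _] _ _ _] := strand_props smoothT gd nl s1'.
rewrite R0 /= in E1; have xq : x1 \in q1 by rewrite E1 mem_head.
(* [x1] lies in the unchanged part [q1]. Behind a long rung it is no longer among the first two
   vertices, which excludes a jewel pattern; the attachment [x2] excludes the other outcome. *)
have [||[_ [y [Z [EZ pZ]]] _ _]|[p2' _]] := strand_feet C n12 n13 n23 w1 w2 w3 s1' s2 s3.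
- by apply/hasP; exists x1; rewrite // mem_cat xq orbT.
- by apply/hasP; exists r2; rewrite ?mem_head.
- case: (R) nR EZ U1 pZ => //= c R' _ [-> _] /and3P[nr nc _] pZ.
  have := pZ x1; rewrite !inE mem_cat xq !orbT => /(_ isT); rewrite x1a.
  by case/esym/orP=> /eqP E; [move: nr|move: nc]; rewrite -E ?inE mem_cat xq !orbT.
have := p2' x2; rewrite x2a E2 !inE eqxx orbT => /(_ isT)/esym/eqP E.
by move: U2; rewrite E2 E /= mem_head.
Qed.

Lemma strand_leg w e r R q : ~~ leaf w -> strand eta w e r R q -> R != [::] ->
  r \in sev eta e w /\
  exists (l : T) (L : seq T) (Gam : {set G}),
    [/\ leaf l /\ ~~ connect (del_edge e) w l, ipath_between w l L,
       [set x in a :: rev (r :: R ++ q)] = a |: Gam /\ is_path_set Gam,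
       Gam \subset \bigcup_(h : edge T | val h \subset [set t in L]) se eta h &
       long_rung eta e (Gam :&: se eta e) /\
       forall h : edge T, val h \subset [set t in L] -> h != e ->
         rung eta h (Gam :&: se eta h)].
Proof.
move=> nlw st nR; have [[ip _ _ _] rw _ _] := strand_props smoothT gd nlw st.
have [v OR] := strand_first st; split=> //.
have [L [ll lf iL sL [eL qL Re rL]]] := strand_tree_path nlw st.
exists (last w L), (w :: L), [set z in r :: R ++ q]; split.
- by split=> //; rewrite inE in lf.
- by rewrite /ipath_between iL !eqxx.
- split; first by apply/setP=> z; rewrite !inE mem_rev inE.
  by exists (r :: R ++ q).
- apply/subsetP=> z; rewrite in_set => /qL[h hL zh].
  by apply/bigcupP; exists h.
split=> //; rewrite Re; split; first exact: orung_rung OR.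
have [_ ipR _ _ _] := OR; rewrite cardsE (card_uniqP (ipath_uniq ipR)) /=.
by case: (R) nR.
Qed.

(** An eta-pyramid needs long first rungs on all three legs. The third is made long by rerouting;
    the first two are long by [jewel_first_rung_long]. Then [f] is a jewel for [eta], against
    [cn_jewel]. *)
Lemma no_jewel_pattern f s w e1 e2 e3 r1 R1 q1 r2 R2 q2 r3 R3 q3 :
  connecting f s -> e1 != e2 -> e1 != e3 -> e2 != e3 ->
  w \in val e1 -> w \in val e2 -> w \in val e3 ->
  strand eta w e1 r1 R1 q1 -> strand eta w e2 r2 R2 q2 ->
  strand eta w e3 r3 R3 q3 ->
  jewel_pattern f s r1 (R1 ++ q1) r2 (R2 ++ q2) r3 (R3 ++ q3) -> False.
Proof.
move=> C n12 n13 n23 w1 w2 w3 s1 s2 s3' JP0.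
have nl := two_edges_nonleaf n12 w1 w2.
have [r3' [R3' [nR3 s3]]] := strand_long s3'.
(* The pattern survives rerouting of the third arm: the alternative would confine the attachments on
   the second arm to its base, but [x2] is one. *)
have JP : jewel_pattern f s r1 (R1 ++ q1) r2 (R2 ++ q2) r3' (R3' ++ q3).
  have [_ [x1 [Z1 [E1 p1]]] [x2 [Z2 [E2 p2]]] _] := JP0.
  have [||//|[p2' _]] := strand_feet C n12 n13 n23 w1 w2 w3 s1 s2 s3.
  - by apply/hasP; exists x1; rewrite ?p1 ?E1 !inE eqxx ?orbT.
  - by apply/hasP; exists r2; rewrite ?p2 ?inE eqxx.
  have [[/ipath_uniq U2 _ _ _] _ _ _] := strand_props smoothT gd nl s2.
  have := p2' x2; rewrite p2 E2 !inE eqxx !orbT // => /(_ isT)/esym/eqP E.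
  by move: U2; rewrite E2 E /= mem_head.
have nR1 := jewel_first_rung_long C n12 n13 n23 w1 w2 w3 s1 s2 s3 JP.
have n21 : e2 != e1 by rewrite eq_sym.
have nR2 := jewel_first_rung_long C n21 n23 n13 w2 w1 w3 s2 s1 s3 (jewel_pattern_swap JP).
have PY := strand_pyr smoothT gd n12 n13 n23 w1 w2 w3 s1 s2 s3.
have AP := strand_att_pyr C n12 n13 n23 w1 w2 w3 s1 s2 s3.
have fF : f \in f :: s by apply: mem_head.
apply: (cn_jewel C fF); exists w, e1, e2; split.
  by apply: branch_edges w1 w2 n12; case: smoothT.
split; [exact: cn_out C _ fF | by split | exists e3].
exists (pyr_base r1 r2 r3').
exists (pyr_path a (r1 :: R1 ++ q1) (r2 :: R2 ++ q2) (r3' :: R3' ++ q3)).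
have s0 : s = [::] by case: JP.
split=> //; last by rewrite s0 in AP JP; apply: pyr_jewel.
  by rewrite !inE negb_or; apply/andP; split; rewrite eq_sym.
have L1 := strand_leg nl s1 nR1; have L2 := strand_leg nl s2 nR2.
have L3 := strand_leg nl s3 nR3.
split; first split.
- by move=> [[|[|[|//]]] ?] [[|[|[|//]]] ?]; rewrite !(tnth_nth e1) /= => E;
    apply: val_inj => //; move: n12 n13 n23; rewrite E eqxx.
- by move=> [[|[|[|//]]] ?]; rewrite (tnth_nth e1).
- exact: pyr_pyramid PY.
case=> -[|[|[|i]]] i3; last by exfalso; move: i3.
- have -> : tnth [tuple e1; e2; e3] (Ordinal i3) = e1 by rewrite (tnth_nth e1).
  exact: L1.
- have -> : tnth [tuple e1; e2; e3] (Ordinal i3) = e2 by rewrite (tnth_nth e1).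
  exact: L2.
have -> : tnth [tuple e1; e2; e3] (Ordinal i3) = e3 by rewrite (tnth_nth e1).
exact: L3.
Qed.

(** The three strands are chosen through [x], [y] and [z]. As [z] is arbitrary, what [strand_feet]
    says about one strand holds for the whole direction [d2]. *)
Lemma feet_across f s w e d1 d2 h h1 h2 x y z : connecting f s ->
  w \in val e -> w \in val d1 -> w \in val d2 -> e != d1 -> e != d2 -> d1 != d2 ->
  beyond e w h -> x \in se eta h -> att f s x -> x \notin sev eta e w ->
  beyond d1 w h1 -> y \in se eta h1 -> att f s y ->
  beyond d2 w h2 -> z \in se eta h2 -> att f s z = (z \in sev eta d2 w).
Proof.
move=> C we w1 w2 n1 n2 n12 bh xh ax nx b1 yh ay b2 zh.
have nl := two_edges_nonleaf n1 we w1.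
have [r [R [q [st xq]]]] := strand_exists smoothT gd we bh xh.
have [r1 [R1 [q1 [st1 yq]]]] := strand_exists smoothT gd w1 b1 yh.
have [r2 [R2 [q2 [st2 zq]]]] := strand_exists smoothT gd w2 b2 zh.
have [_ _ _ hr] := strand_props smoothT gd nl st.
have [_ _ _ hr2] := strand_props smoothT gd nl st2.
have [||JP|[_ h2P]] := strand_feet C n1 n2 n12 we w1 w2 st st1 st2.
- apply/hasP; exists x => //; move: xq; rewrite in_cons => /orP[/eqP xr|//].
  by rewrite hr ?xr ?mem_head ?eqxx in nx.
- by apply/hasP; exists y.
- by case: (no_jewel_pattern C n1 n2 n12 we w1 w2 st st1 st2 JP).
by rewrite h2P // hr2.
Qed.

(** Directions other than [d] are covered by [feet_across] directly. For [d] itself, the smooth tree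
    has a third direction [d3] at [w]; an attachment found there takes the place of [y]. *)
Lemma attach_beyond f s w e d h1 h2 x y : connecting f s ->
  w \in val e -> w \in val d -> e != d ->
  beyond e w h1 -> x \in se eta h1 -> att f s x -> x \notin sev eta e w ->
  beyond d w h2 -> y \in se eta h2 -> att f s y ->
  forall d' h z, w \in val d' -> d' != e -> beyond d' w h -> z \in se eta h ->
    att f s z = (z \in sev eta d' w).
Proof.
move=> C we wd ned b1 xh ax nx b2 yh ay d' h z wd' nd'e bh zh.
have ned' : e != d' by rewrite eq_sym.
have [d'd|nd'd] := eqVneq d' d; last first.
  have ndd' : d != d' by rewrite eq_sym.
  exact: (feet_across C we wd wd' ned ned' ndd' b1 xh ax nx b2 yh ay bh zh).
subst d'; have bw : branch w by apply: branch_edges we wd ned; case: smoothT.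
have [d3 [w3 n3e n3d]] := third_edge bw we wd.
have en3 : e != d3 by rewrite eq_sym.
have dn3 : d != d3 by rewrite eq_sym.
have b3 := beyond_self treeT w3.
have [t td] : exists t, t \in sev eta d3 w.
  by have [_] := (let: conj (And5 _ _ _ H _) _ := good_strip gd in H) d3 w; rewrite w3 => /set0Pn.
have t3 := (sev_se gd td).1.
have := feet_across C we wd w3 ned en3 dn3 b1 xh ax nx b2 yh ay b3 t3.
rewrite td => at3.
exact: (feet_across C we w3 wd en3 ned n3d b1 xh ax nx b3 t3 at3 bh zh).
Qed.

Lemma connecting_rev f s f' s' : f' :: s' = rev (f :: s) -> connecting f s ->
  connecting f' s' /\ last f' s' = f /\ last f s = f' /\ (f' :: s' =i f :: s).
Proof.
move=> E [ip out jw mn].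
have K : connector a f s by split=> // u /out/out_apex.
have [[ip' _] [lf' [lf mF]]] := connector_rev E K; split=> //; split=> //.
- by move=> u; rewrite mF; apply: out.
- by move=> u; rewrite mF; apply: jw.
move=> u v x y; rewrite !mF lf' -lf => uF vF xa ya ux vy nl.
by case: (mn u v x y uF vF xa ya ux vy nl) => -[-> ->]; auto.
Qed.

End Feet.

(** * Adding a rung *)

Section Grow.
Variables (G T : sgraph) (a : G) (eta : strip_map G T).
Implicit Types (u v w l : T) (e d h k : edge T) (x y z r f : G).
Hypothesis (gd : good a eta).
Variables (e0 : edge T) (w0 u0 : T) (F Fw Fu : {set G}).

Definition grow_ends e v : {set G} :=
  if e == e0 then if v == w0 then Fw else if v == u0 then Fu else set0 else set0.

(** [F] joins the strip of [e0], with [Fw] and [Fu] at its two ends. Adjacencies between [F] and the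
    old strip of [e0] are not prescribed below: inside a strip only rungs through every vertex are
    required. *)
Definition grow : strip_map G T := {|
  sv := sv eta;
  se := fun e => if e == e0 then se eta e :|: F else se eta e;
  sev := fun e v => sev eta e v :|: grow_ends e v |}.

Hypotheses (E0 : val e0 = [set w0; u0]) (sFw : Fw \subset F) (sFu : Fu \subset F).
Hypothesis (outF : {in F, forall x, x \notin eta_plus a eta}).
Hypothesis (adjF : forall y z h, y \in F -> h != e0 -> z \in se eta h ->
  sedge y z = (y \in Fw) && (z \in sev eta h w0) || (y \in Fu) && (z \in sev eta h u0)).
Hypotheses (nlw : ~~ leaf w0) (leafu : leaf u0 -> Fu = set0).
Hypothesis (rungF : {in F, forall y, exists r R, orung grow e0 w0 u0 r R /\ y \in r :: R}).

Let sav : avoids_apex a eta. Proof. by case: (good_strip gd) => [[]]. Qed.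
Let sS1 : strip1 eta. Proof. by case: (good_strip gd) => [[]]. Qed.
Let sS3 : strip3 eta. Proof. by case: (good_strip gd) => [[]]. Qed.
Let sS4 : strip4 eta. Proof. by case: (good_strip gd) => [[]]. Qed.
Let sS8 : strip8 a eta. Proof. by case: (good_strip gd) => _ []. Qed.

Let outse x e : x \in F -> x \in se eta e = false.
Proof. by move=> xF; apply/negP=> /(out_se gd (outF xF)); rewrite eqxx. Qed.

Let aF : a \notin F.
Proof. by apply/negP=> /outF; rewrite !inE eqxx. Qed.

Lemma grow_endsP e v x : x \in grow_ends e v ->
  [/\ e = e0, x \in F & (v = w0 /\ x \in Fw) \/ (v = u0 /\ x \in Fu)].
Proof.
rewrite /grow_ends; case: eqP => [->|_]; last by rewrite inE.
case: eqP => [->|_] xw; first by split; auto; apply: (subsetP sFw).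
move: xw; case: eqP => [->|_] xu; last by rewrite inE in xu.
by split; auto; apply: (subsetP sFu).
Qed.

Lemma grow_seP e x : x \in se grow e -> x \in se eta e \/ (e = e0 /\ x \in F).
Proof. by rewrite /=; case: eqP => [->|_]; rewrite ?inE; [case/orP|]; auto. Qed.

Lemma grow_se e : {subset se eta e <= se grow e}.
Proof. by move=> x xe /=; case: ifP => _ //; rewrite inE xe. Qed.

Lemma grow_sev_old e v x : x \notin F -> (x \in sev grow e v) = (x \in sev eta e v).
Proof.
move=> nx; rewrite inE; apply/orP/idP=> [[//|/grow_endsP[_ xF _]]|]; last by left.
by rewrite xF in nx.
Qed.

Lemma grow_allP x : x \in eta_all grow -> x \in eta_all eta \/ x \in F.
Proof.
rewrite inE => /orP[/bigcupP[v _]|/bigcupP[e _ /grow_seP[xe|[_ xF]]]]; auto.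
  by rewrite /= (good_vertex gd) inE.
by left; apply/(eta_allP gd); exists e.
Qed.

Lemma grow_all : {subset eta_all eta <= eta_all grow}.
Proof.
move=> x /(eta_allP gd)[e xe]; rewrite inE; apply/orP; right.
by apply/bigcupP; exists e; rewrite ?subsetT // grow_se.
Qed.

Lemma grow_allF : {subset F <= eta_all grow}.
Proof.
move=> x xF; rewrite inE; apply/orP; right.
by apply/bigcupP; exists e0; rewrite ?subsetT //= eqxx inE xF orbT.
Qed.

Lemma grow_orung e w u r R : orung eta e w u r R -> orung grow e w u r R.
Proof.
case=> E ip sub hw hu; have nF z : z \in r :: R -> z \notin F.
  by move=> /sub ze; apply/negP=> /outse zF; rewrite zF in ze.
split=> // z zR; first exact/grow_se/sub.
  by rewrite grow_sev_old ?nF // hw.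
by rewrite grow_sev_old ?nF // hu.
Qed.

Lemma grow_tame e w u z : val e = [set w; u] -> z \in se grow e ->
  exists r R, orung grow e w u r R /\ z \in r :: R.
Proof.
move=> E /grow_seP[ze|[ee zF]].
  have [r [R [OR zR]]] := good_tame gd E ze.
  by exists r, R; split=> //; apply: grow_orung.
subst e; have [r [R [OR zR]]] := rungF zF.
have [ww0|nww0] := eqVneq w w0.
  have [uw|->] := mem_edge2 E0 (mem_edger E); last by exists r, R; rewrite ww0.
  by have := sedge_neq (edge_adj E); rewrite ww0 uw eqxx.
have [ww|wu] := mem_edge2 E0 (mem_edgel E); first by rewrite ww eqxx in nww0.
have [uw|uu] := mem_edge2 E0 (mem_edger E); last first.
  by have := sedge_neq (edge_adj E); rewrite wu uu eqxx.
have [r' [R' [OR' Er]]] := orung_rev OR; exists r', R'; rewrite wu uw.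
by split=> //; rewrite Er mem_rev.
Qed.

Lemma grow_sev_sub e v : sev grow e v \subset se grow e.
Proof.
apply/subsetP=> x; rewrite inE => /orP[/(sev_se gd)[xe _]|]; first exact: grow_se.
by move=> /grow_endsP[-> xF _]; rewrite /= eqxx inE xF orbT.
Qed.

(** (S5) follows from tameness by cutting a rung through [x] at [x]. *)
Lemma orung_strip5 (zeta : strip_map G T) :
  (forall e w u z, val e = [set w; u] -> z \in se zeta e ->
     exists r R, orung zeta e w u r R /\ z \in r :: R) -> strip5 zeta.
Proof.
move=> tm e v ve x xe; have [w wv E] := edge_at ve.
have E' := edge_sym E; have [r [R [OR xR]]] := tm e w v x E' xe.
have [_ ip sub hw hv] := OR.
have [p1 [p2 EP]] : exists p1 p2, r :: R = p1 ++ x :: p2.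
  by case/splitPr: xR => p1 p2; exists p1, p2.
have lE : last r R = last x p2 by apply: last_suffix EP.
have sp : {subset x :: p2 <= r :: R} by move=> z h; rewrite EP mem_cat h orbT.
exists (last x p2), (x :: p2); split.
- by rewrite -lE hv ?mem_last ?eqxx.
- rewrite /ipath_between /= !eqxx !andbT.
  by apply: (@ipath_catr _ p1); rewrite -?EP.
- by apply/subsetP=> z; rewrite inE => /sp/sub.
apply/subsetP=> z; rewrite !inE negb_or => /andP[/andP[nx nl] zp].
have zR : z \in r :: R by apply: sp; rewrite inE.
rewrite sub // andbT; apply/negP=> /bigcupP[t te].
have [->|->] := mem_edge2 E te; rewrite ?hv ?hw // ?lE ?(negbTE nl) //.
move=> /eqP zr; move: (ipath_uniq ip); rewrite EP.
have zp2 : z \in p2 by move: zp; rewrite (negbTE nx).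
case: p1 EP => [[rx _]|c p1 [rc _]]; first by rewrite -rx zr eqxx in nx.
by rewrite -rc -zr /= mem_cat inE zp2 !orbT.
Qed.

(** (S4) for the new vertices is the hypothesis [adjF], and (S6), (S7) are void because all [eta(v)]
    are empty. For (S8), no leaf gains a vertex at its end, and vertices outside do not see [a]. *)
Lemma grow_strip : strip_structure a grow.
Proof.
have [ax1 ax2 ax3] := sav; have [s11 s12 s13] := sS1.
have sv0 v : sv grow v = set0 by apply: (good_vertex gd).
split; split.
- split=> [//|e|e v]; first by apply/negP=> /grow_seP[|[_]]; rewrite ?(negbTE (ax2 e)) ?(negbTE aF).
  by rewrite inE negb_or ax3; apply/negP=> /grow_endsP[_]; rewrite (negbTE aF).
- split=> [//|e h neh|v e]; last by rewrite sv0 disjoints_subset sub0set.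
  rewrite disjoint_subset; apply/subsetP=> x xe; rewrite inE; apply/negP=> xh.
  case/grow_seP: xe => [xe|[Ee xF]]; case/grow_seP: xh => [xh|[Eh xF']].
  + by rewrite (se_eq gd xe xh) eqxx in neh.
  + by rewrite outse in xe.
  + by rewrite outse in xh.
  by rewrite Ee Eh eqxx in neh.
- by move=> l _; apply: sv0.
- move=> e v; split; first exact: grow_sev_sub.
  have [_ nE] := sS3 e v; apply/idP/idP=> [/set0Pn[x]|ve].
    rewrite inE => /orP[/(sev_se gd)[]//|/grow_endsP[-> _]].
    by case=> -[-> _]; [apply: mem_edgel E0 | apply: mem_edger E0].
  move: nE; rewrite ve => /set0Pn[x xe]; apply/set0Pn; exists x.
  by rewrite inE xe.
- move=> e h neh; split.
    have half e' h' v x y : e' != h' -> x \in grow_ends e' v ->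
        y \in sev grow h' v -> sedge x y.
      move=> ne /grow_endsP[Ee xF xv]; rewrite inE => /orP[yv|/grow_endsP[Eh _ _]].
        subst e'; rewrite (@adjF x y h') // 1?eq_sym ?(sev_se gd yv).1 //.
        by case: xv yv => -[-> ->] ->; rewrite ?orbT.
      by rewrite Ee Eh eqxx in ne.
    move=> v x y; rewrite inE => /orP[xe|xe yh]; last exact: half neh xe yh.
    rewrite inE => /orP[yh|yh]; first exact: ((sS4 neh).1 v).
    rewrite sedgeC; apply: (half h e v y x) => //; first by rewrite eq_sym.
    by rewrite inE xe.
  have half e' h' x y : e' = e0 -> x \in F -> h' != e' -> y \in se eta h' -> sedge x y ->
      exists v, x \in sev grow e' v /\ y \in sev grow h' v.
    move=> -> xF nh yh; rewrite (adjF xF nh yh).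
    have nwu := sedge_neq (edge_adj E0).
    case/orP=> /andP[xw yw]; [exists w0|exists u0]; rewrite !inE yw /grow_ends !eqxx.
      by rewrite xw orbT.
    by rewrite [u0 == _]eq_sym (negbTE nwu) xw orbT.
  move=> x y /grow_seP[xe|[Ee xF]] /grow_seP[yh|[Eh yF]] xy.
  + by have [v [xv yv]] := (sS4 neh).2 x y xe yh xy; exists v; rewrite !inE xv yv.
  + rewrite sedgeC in xy.
    by have [v [yv xv]] := half h e y x Eh yF neh xe xy; exists v.
  + by apply: half => //; rewrite eq_sym.
  by rewrite Ee Eh eqxx in neh.
- exact/orung_strip5/grow_tame.
- by move=> v e x y; rewrite sv0 inE.
- move=> v D; rewrite sv0 /components /equivalence_partition => /imsetP[x].
  by rewrite inE.
split.
  move=> l e ll le; have -> : sev grow e l = sev eta e l; last exact: sS8.1.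
  apply/setP=> x; rewrite inE; apply/orP/idP=> [[//|/grow_endsP[_ _]]|]; last by left.
  by case=> -[El xl]; rewrite El in ll; [move: nlw; rewrite ll | rewrite leafu ?inE in xl].
move=> x /grow_allP[xa ax|xF ax].
  have [l [e [ll le xl]]] := sS8.2 x xa ax; exists l, e; split=> //.
  by rewrite inE xl.
by have [_ /negP] := out_apex gd (outF xF).
Qed.

Lemma grow_good : good a grow.
Proof.
split=> //; [exact: grow_strip | exact: good_vertex gd | exact: grow_tame | |].
  move=> e w u E; have [r [R [OR nR]]] := good_long gd E.
  by exists r, R; split=> //; apply: grow_orung.
have [[tr1 tr2] r2] := good_rich gd.
have sub_plus : {subset eta_plus a eta <= eta_plus a grow}.
  by move=> x; rewrite !in_setU1 => /orP[->//|/grow_all->]; rewrite orbT.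
split; first split.
- by move=> x /tr1/sub_plus.
(* The degree of a neighbour of [a] is unchanged: all its neighbours have distance at most two from
   [a] and belong to the old structure. *)
- move=> x ax; rewrite -(tr2 x ax); congr #|pred_of_set _|; apply/setP=> y.
  rewrite !in_setI; have [xy|//] /= := boolP (y \in nbhd x).
  rewrite inE in xy; have ya : y \in eta_plus a eta.
    by apply: tr1; exists [:: x; y]; rewrite /= ax xy.
  by rewrite ya sub_plus.
move=> l e ll le; rewrite -(r2 l e ll le); congr #|pred_of_set _|.
apply/setP=> x; rewrite inE; apply/orP/idP=> [[//|/grow_endsP[_ _]]|]; last by left.
by case=> -[El xl]; rewrite El in ll; [move: nlw; rewrite ll | rewrite leafu ?inE in xl].
Qed.

Lemma grow_card : F != set0 -> #|eta_all eta| < #|eta_all grow|.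
Proof.
case/set0Pn=> x xF; apply/proper_card/properP; split; first exact/subsetP/grow_all.
exists x; first exact: grow_allF.
by have := outF xF; rewrite in_setU1 negb_or => /andP[].
Qed.

End Grow.

(** * New rungs from connecting paths *)

Section Augment.
Variables (G T : sgraph) (a : G) (eta : strip_map G T).
Implicit Types (w l : T) (e d h k : edge T) (x y z r f : G) (p q R s : seq G).
Hypotheses (tf : theta_free G) (pf : prism_free G).
Hypotheses (smoothT : smooth_tree T) (gd : good a eta).

Let treeT : is_tree T := let: And3 H _ _ := smoothT in H.

Lemma sev_beyond d w h z : w \in val d -> beyond d w h -> z \in se eta h ->
  (z \in sev eta d w) = (z \in sev eta h w).
Proof.
move=> wd bh zh; apply/idP/idP=> zw.
  by rewrite (se_eq gd zh (sev_se gd zw).1).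
by rewrite -(beyond_at treeT wd bh (sev_se gd zw).2).
Qed.

Lemma edge_side e w u h : val e = [set w; u] -> h != e ->
  exists d, d != e /\
   ([/\ w \in val d, beyond d w h & u \notin val h] \/
    [/\ u \in val d, beyond d u h & w \notin val h]).
Proof.
move=> E nhe; have [v [d [ve vd nde bh]]] := beyond_exists treeT nhe.
have ned : e != d by rewrite eq_sym.
have far_no t : t \in val e -> t != v -> t \notin val h.
  move=> te ntv; apply/negP=> th.
  by have [tv] := beyond_meet treeT ned ve vd (beyond_self treeT ve) bh te th; rewrite tv eqxx in ntv.
have nwu := sedge_neq (edge_adj E).
exists d; split=> //; case: (mem_edge2 E ve) => Ev; subst v; [left|right]; split=> //.
  by apply: far_no; rewrite ?(mem_edger E) // eq_sym.
by apply: far_no; rewrite ?(mem_edgel E).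
Qed.

(** What (S4) requires, outside [e], of a rung of [e] reaching its end [w], stated for the path as a
    whole; minimality then concentrates it on one end of the path. *)
Definition side_attached f s e w :=
  forall d h z, w \in val d -> d != e -> beyond d w h -> z \in se eta h ->
    att f s z = (z \in sev eta d w).

Definition augmented := exists zeta : strip_map G T,
  good a zeta /\ #|eta_all eta| < #|eta_all zeta|.

Lemma att_ex f s z : att f s z -> exists2 v, v \in f :: s & sedge v z.
Proof. by case/hasP=> v vF zv; exists v; rewrite // sedgeC. Qed.

Lemma att_intro f s v z : v \in f :: s -> sedge v z -> att f s z.
Proof. by move=> vF vz; apply/hasP; exists v; rewrite // sedgeC. Qed.

Lemma connecting_out f s : connecting a eta f s ->
  {in [set x in f :: s], forall x, x \notin eta_plus a eta}.
Proof. by move=> C x; rewrite inE; apply: cn_out C x. Qed.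

Lemma connecting_nonempty f s : [set x in f :: s] != set0.
Proof. by apply/set0Pn; exists f; rewrite inE mem_head. Qed.

Lemma se_all z e : z \in se eta e -> z \in eta_all eta.
Proof. by move=> ze; apply/(eta_allP gd); exists e. Qed.

Lemma other_end f s u v x y : connecting a eta f s -> u \in f :: s ->
  v \in f :: s -> x \in eta_all eta -> y \in eta_all eta ->
  sedge u x -> sedge v y -> ~ local eta x y ->
  (u = f -> v = last f s) /\ (u = last f s -> v = f).
Proof.
move=> C uF vF xa ya ux vy nl.
by case: (cn_min C uF vF xa ya ux vy nl) => -[-> ->]; split=> // /esym.
Qed.

(* Both ends of [e] see the connecting path: the path is a new rung. *)
Lemma augment_two_sides f s e w u z1 z2 h1 h2 d1 d2 : connecting a eta f s ->
  val e = [set w; u] -> side_attached f s e w -> side_attached f s e u ->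
  w \in val d1 -> d1 != e -> beyond d1 w h1 -> z1 \in se eta h1 ->
  sedge (last f s) z1 ->
  u \in val d2 -> d2 != e -> beyond d2 u h2 -> z2 \in se eta h2 ->
  sedge f z2 -> augmented.
Proof.
move=> C E Sw Su wd1 n1 b1 zh1 gz1 ud2 n2 b2 zh2 fz2.
have E' := edge_sym E; have [we ue] := (mem_edgel E, mem_edger E).
have fF : f \in f :: s := mem_head _ _.
have gF : last f s \in f :: s := mem_last _ _.
(* Attachments on different sides of [e] form nonlocal pairs, so by [cn_min] only the last vertex
   sees the side of [w] and only [f] sees the side of [u]. *)
have nonlocal d d' h h' z z' : w \in val d -> d != e -> beyond d w h ->
    z \in se eta h -> u \in val d' -> d' != e -> beyond d' u h' ->
    z' \in se eta h' -> ~ local eta z z'.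
  move=> wd nd bh zh ud nd' bh' zh'; have bew := beyond_trans treeT E ud nd' bh'.
  move=> /(local_beyond smoothT gd nd wd we bh bew zh zh')[_ /(sev_se gd)[ze _]].
  have ned' : e != d' by rewrite eq_sym.
  have := beyond_neq treeT ned' ue ud (beyond_self treeT ue) bh'.
  by rewrite (se_eq gd ze zh') eqxx.
have only_g v d h z : v \in f :: s -> w \in val d -> d != e -> beyond d w h ->
    z \in se eta h -> sedge v z -> v = last f s.
  move=> vF wd nd bh zh vz.
  have nl := nonlocal _ _ _ _ _ _ wd nd bh zh ud2 n2 b2 zh2.
  apply: (other_end C fF vF (se_all zh2) (se_all zh) fz2 vz _).1 => //.
  by move/local_sym.
have only_f v d h z : v \in f :: s -> u \in val d -> d != e -> beyond d u h ->
    z \in se eta h -> sedge v z -> v = f.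
  move=> vF ud nd bh zh vz.
  have nl := nonlocal _ _ _ _ _ _ wd1 n1 b1 zh1 ud nd bh zh.
  exact: (other_end C gF vF (se_all zh1) (se_all zh) gz1 vz nl).2.
have nlw : ~~ leaf w by apply: two_edges_nonleaf n1 wd1 we.
have nlu : ~~ leaf u by apply: two_edges_nonleaf n2 ud2 ue.
pose F := [set x in f :: s].
have mF y : (y \in F) = (y \in f :: s) by rewrite in_set.
have adj y z h : y \in F -> h != e -> z \in se eta h ->
  sedge y z = (y \in [set last f s]) && (z \in sev eta h w)
           || (y \in [set f]) && (z \in sev eta h u).
  rewrite mF => yF nhe zh; rewrite !in_set1.
  have [d [nde [[wd bh uh]|[ud bh wh]]]] := edge_side E nhe.
    have -> : (z \in sev eta h u) = false by apply/negP=> /(sev_se gd)[_]; apply/negP.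
    rewrite andbF orbF -(sev_beyond wd bh zh) -(Sw d h z wd nde bh zh).
    apply/idP/andP=> [yz|[/eqP-> /att_ex[v vF vz]]].
      by rewrite (only_g _ _ _ _ yF wd nde bh zh yz) (att_intro yF yz) eqxx.
    by rewrite -(only_g _ _ _ _ vF wd nde bh zh vz).
  have -> : (z \in sev eta h w) = false by apply/negP=> /(sev_se gd)[_]; apply/negP.
  rewrite andbF /= -(sev_beyond ud bh zh) -(Su d h z ud nde bh zh).
  apply/idP/andP=> [yz|[/eqP-> /att_ex[v vF vz]]].
    by rewrite (only_f _ _ _ _ yF ud nde bh zh yz) (att_intro yF yz) eqxx.
  by rewrite -(only_f _ _ _ _ vF ud nde bh zh vz).
have sg : [set last f s] \subset F by apply/subsetP=> x; rewrite mF in_set1 => /eqP->.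
have sf : [set f] \subset F by apply/subsetP=> x; rewrite mF in_set1 => /eqP->.
have out := connecting_out C.
have nev z v : z \in f :: s -> (z \in sev eta e v) = false.
  move=> zF; apply/negP=> /(sev_se gd)[ze _].
  by have := out_se gd (cn_out C zF) ze; rewrite eqxx.
have nwu := sedge_neq (edge_adj E).
have OR : orung (grow eta e w u F [set last f s] [set f]) e u w f s.
  split=> //; first exact: cn_ipath C.
  - by move=> z zF; rewrite /= eqxx in_setU mF zF orbT.
  - by move=> z zF; rewrite in_setU nev // /grow_ends eqxx eq_sym (negbTE nwu) eqxx in_set1.
  by move=> z zF; rewrite in_setU nev // /grow_ends !eqxx in_set1.
have [r [R [OR' Er]]] := orung_rev OR.
exists (grow eta e w u F [set last f s] [set f]); split.
  apply: grow_good => //; first by move/negP: nlu.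
  by move=> y; rewrite mF => yF; exists r, R; split=> //; rewrite Er mem_rev.
exact: (grow_card gd e w u _ _ out (connecting_nonempty f s)).
Qed.

(* Only the [w]-end of [e] sees the connecting path from outside: followed by
   part of an old rung, the path is a new rung. *)
Lemma augment_one_side f s e w u d h x y : connecting a eta f s ->
  val e = [set w; u] -> side_attached f s e w ->
  (forall d' h' z, u \in val d' -> d' != e -> beyond d' u h' ->
     z \in se eta h' -> ~~ att f s z) ->
  x \in se eta e -> x \notin sev eta e w -> sedge f x ->
  w \in val d -> d != e -> beyond d w h -> y \in se eta h ->
  sedge (last f s) y -> augmented.
Proof.
move=> C E Sw Su xe nxw fx wd nde bh yh gy.
have E' := edge_sym E; have [we ue] := (mem_edgel E, mem_edger E).
have fF : f \in f :: s := mem_head _ _.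
have gF : last f s \in f :: s := mem_last _ _.
have nonlocal d' h' x' z : x' \in se eta e -> x' \notin sev eta e w ->
    w \in val d' -> d' != e -> beyond d' w h' -> z \in se eta h' ->
    ~ local eta x' z.
  move=> xe' nx' wd' nd' bh' zh'; have ned' : e != d' by rewrite eq_sym.
  move=> /(local_beyond smoothT gd ned' we wd' (beyond_self treeT we) bh' xe' zh')[].
  by rewrite (negbTE nx').
have only_g (v : G) d' h' z : v \in f :: s -> w \in val d' -> d' != e ->
    beyond d' w h' -> z \in se eta h' -> sedge v z -> v = last f s.
  move=> vF wd' nd' bh' zh' vz.
  have nl := nonlocal _ _ _ _ xe nxw wd' nd' bh' zh'.
  exact: (other_end C fF vF (se_all xe) (se_all zh') fx vz nl).1.
have only_f (v : G) z : v \in f :: s -> z \in se eta e -> z \notin sev eta e w ->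
    sedge v z -> v = f.
  move=> vF ze nz vz; have nl := nonlocal _ _ _ _ ze nz wd nde bh yh.
  apply: (other_end C gF vF (se_all yh) (se_all ze) gy vz _).2 => //.
  by move/local_sym.
have nlw : ~~ leaf w by apply: two_edges_nonleaf nde wd we.
pose F := [set x in f :: s].
have mF z : (z \in F) = (z \in f :: s) by rewrite in_set.
have adj (y' z : G) h' : y' \in F -> h' != e -> z \in se eta h' ->
  sedge y' z = (y' \in [set last f s]) && (z \in sev eta h' w)
           || (y' \in (set0 : {set G})) && (z \in sev eta h' u).
  rewrite mF => yF nhe zh; rewrite !(in_set1, in_set0) orbF.
  have [d' [nd' [[wd' bh' uh]|[ud bh' wh]]]] := edge_side E nhe.
    rewrite -(sev_beyond wd' bh' zh) -(Sw d' h' z wd' nd' bh' zh).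
    apply/idP/andP=> [yz|[/eqP-> /att_ex[v vF vz]]].
      by rewrite (only_g _ _ _ _ yF wd' nd' bh' zh yz) (att_intro yF yz) eqxx.
    by rewrite -(only_g _ _ _ _ vF wd' nd' bh' zh vz).
  have -> : (z \in sev eta h' w) = false by apply/negP=> /(sev_se gd)[_]; apply/negP.
  rewrite andbF; apply/negP=> yz.
  by have := Su _ _ _ ud nd' bh' zh; rewrite (att_intro yF yz).
have sg : [set last f s] \subset F by apply/subsetP=> z; rewrite mF in_set1 => /eqP->.
have out := connecting_out C.
have nse z e' : z \in f :: s -> (z \in se eta e') = false.
  move=> zF; apply/negP=> ze.
  by have := out_se gd (cn_out C zF) ze; rewrite eqxx.
have nev z e' v : z \in f :: s -> (z \in sev eta e' v) = false.
  by move=> zF; apply/negP=> /(sev_se gd)[]; rewrite nse.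
have nwu := sedge_neq (edge_adj E).
(* An old rung through [x], listed from [u], is cut at the first neighbour [z] of [f]. Since it
   contains [x], which is outside [eta(e,w)], the cut comes before its [w]-end; the kept piece meets
   [eta(e,u)] and avoids [eta(e,w)]. *)
have [r0 [R0 [OR0 xR]]] := good_tame gd E' xe.
have [_ ip0 sub0 hu0 hw0] := OR0.
have [B [z [Z [EB fz /hasPn nB]]]] : exists B z Z,
    [/\ r0 :: R0 = B ++ z :: Z, sedge f z & ~~ has (sedge f) B].
  by apply: split_first; apply/hasP; exists x.
have El : last r0 R0 = last z Z by apply: last_suffix EB.
have nlast c : c \in rcons B z -> c != last r0 R0.
  move=> cB; case: Z EB El => [|z' Z] EB El; last first.
    have U := ipath_uniq ip0; rewrite El; move: U; rewrite EB -cat_rcons => U.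
    exact: uniq_cat_disj U cB (mem_last _ _).
  have xz : x = z.
    move: xR; rewrite EB mem_cat inE => /orP[/nB|/eqP//]; by rewrite fx.
  have : x \in sev eta e w by rewrite hw0 // xz El eqxx.
  by rewrite (negbTE nxw).
have sB : {subset rcons B z <= r0 :: R0}.
  by move=> c cB; rewrite EB -cat_rcons mem_cat cB.
have nw c : c \in rcons B z -> c \notin sev eta e w.
  by move=> cB; rewrite hw0 ?sB // nlast.
have [B' EB'] : exists B', rcons B z = r0 :: B'.
  by case: B EB {nB nlast sB nw} => [|c B] [-> _]; [exists [::] | exists (rcons B z)].
have lB' : last r0 B' = z.
  by rewrite -[last r0 B']/(last r0 (r0 :: B')) -EB' last_rcons.
have ipB : ipath (r0 :: B').
  by rewrite -EB'; apply: (@ipath_catl _ _ Z); rewrite ?cat_rcons -?EB //; case: (B).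
have cross : {in r0 :: B' & f :: s, forall c v,
    c != v /\ sedge c v = (c == last r0 B') && (v == f)}.
  move=> c v; rewrite -EB' lB' => cB vF; split.
    by rewrite eq_sym; apply: (out_se gd (cn_out C vF) (sub0 _ (sB _ cB))).
  apply/idP/andP=> [|[/eqP-> /eqP->]]; last by rewrite sedgeC.
  rewrite sedgeC => vc; have vf := only_f _ _ vF (sub0 _ (sB _ cB)) (nw _ cB) vc.
  rewrite vf eqxx; split=> //; move: cB; rewrite mem_rcons inE => /orP[//|/nB].
  by rewrite -vf vc.
have OR : orung (grow eta e w u F [set last f s] set0) e u w r0 (B' ++ f :: s).
  have ru : r0 \in sev eta e u by apply: orung_head OR0.
  have nr0 c : c \in f :: s -> c != r0.
    by move=> cF; apply: (out_se gd (cn_out C cF) (sub0 _ (mem_head _ _))).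
  have memB c : c \in r0 :: B' ++ f :: s -> c \in rcons B z \/ c \in f :: s.
    by rewrite -cat_cons mem_cat -EB' => /orP.
  split=> //.
  - by rewrite -cat_cons; apply: ipath_cat ipB (cn_ipath C) cross.
  - move=> c /memB[cB|cF]; first exact/grow_se/sub0/sB.
    by rewrite /= eqxx in_setU mF cF orbT.
  - move=> c /memB[cB|cF]; rewrite in_setU /grow_ends eqxx.
      by rewrite eq_sym (negbTE nwu) eqxx in_set0 orbF hu0 ?sB.
    by rewrite nev // eq_sym (negbTE nwu) eqxx in_set0 (negbTE (nr0 _ cF)).
  move=> c /memB[cB|cF]; rewrite in_setU /grow_ends !eqxx in_set1 last_cat /=.
    by rewrite (negbTE (nw _ cB)).
  by rewrite nev.
have [r [R [OR' Er]]] := orung_rev OR.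
exists (grow eta e w u F [set last f s] set0); split.
  apply: grow_good => //; first exact: sub0set.
  move=> c; rewrite mF => cF; exists r, R; split=> //.
  by rewrite Er mem_rev -cat_cons mem_cat cF orbT.
exact: (grow_card gd e w u _ _ out (connecting_nonempty f s)).
Qed.

(** [attach_beyond] at a suitable [w] settles all directions but one, [e]. Whether the path also
    sees something beyond the other end [u] of [e] decides whether it is a rung by itself or has to
    be continued by an old one. *)
Lemma connecting_augment f s x0 y0 : connecting a eta f s ->
  x0 \in eta_all eta -> y0 \in eta_all eta -> att f s x0 -> att f s y0 ->
  ~ local eta x0 y0 -> augmented.
Proof.
move=> C /(eta_allP gd)[h xh] /(eta_allP gd)[k yk] ax ay nl.
have nkh : k != h.
  by apply/eqP=> kh; apply: nl; left; exists h; rewrite -{2}kh.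
(* [w] is the end of [h] towards [k]. As [x0], [y0] is not a local pair, at least one of the two is
   not in the part of its direction at [w]; it becomes [x]. *)
have [w [e [d [h1 [h2 [x [y [[we wd ned] [b1 xh1 ax1 nx] [b2 yh2 ay2]]]]]]]]] :
  exists w e d h1 h2 x y, [/\ [/\ w \in val e, w \in val d & e != d],
    [/\ beyond e w h1, x \in se eta h1, att f s x & x \notin sev eta e w] &
    [/\ beyond d w h2, y \in se eta h2 & att f s y]].
  have [w [d [wh wd ndh bk]]] := beyond_exists treeT nkh.
  have bh := beyond_self treeT wh.
  have [yd|nyd] := boolP (y0 \in sev eta d w); last first.
    by exists w, d, h, k, h, y0, x0.
  exists w, h, d, h, k, x0, y0; split; split=> //; first by rewrite eq_sym.
  apply/negP=> xw; apply: nl; right; exists w.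
  by split; apply/(eta_BP gd); [exists h | exists d].
have Sw : side_attached f s e w.
  by move=> d' h' z; apply: (attach_beyond tf pf smoothT gd C we wd ned b1 xh1 ax1 nx b2 yh2 ay2).
have [u wu E] := edge_at we; have E' := edge_sym E; have ue := mem_edger E.
have nde : d != e by rewrite eq_sym.
have b2u := beyond_trans treeT E' wd nde b2.
have reverse : exists f' s', f' :: s' = rev (f :: s).
  case Er: (rev (f :: s)) => [|f' s']; last by exists f', s'.
  by move: (congr1 size Er); rewrite size_rev.
have [f' [s' Er]] := reverse; have [C' [lf' [lf mF]]] := connecting_rev gd Er C.
have aE := att_eq mF.
have Sw' : side_attached f' s' e w.
  by move=> d' h' z wd' nd' bh' zh'; rewrite aE (Sw d' h' z).
have [/existsP[d3 /existsP[h3 /existsP[z /and5P[ud3 n3 b3 zh3 az]]]]|/existsPn nu] :=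
  boolP [exists d' : edge T, exists h' : edge T, exists z : G,
    [&& u \in val d', d' != e, beyond d' u h', z \in se eta h' & att f s z]].
  have ne3 : e != d3 by rewrite eq_sym.
  have nyu : y \notin sev eta e u.
    apply/negP=> /(sev_se gd)[ye _].
    have := beyond_neq treeT ned we wd (beyond_self treeT we) b2.
    by rewrite (se_eq gd ye yh2) eqxx.
  have Su : side_attached f s e u.
    by move=> d' h' z'; apply: (attach_beyond tf pf smoothT gd C ue ud3 ne3 b2u yh2 ay2 nyu b3 zh3 az).
  have Su' : side_attached f' s' e u.
    by move=> d' h' z' ud' nd' bh' zh'; rewrite aE (Su d' h' z').
  have nlzy : ~ local eta z y.
    have bz := beyond_trans treeT E ud3 n3 b3.
    move=> /(local_beyond smoothT gd ned we wd bz b2 zh3 yh2)[/(sev_se gd)[ze _] _].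
    have := beyond_neq treeT ne3 ue ud3 (beyond_self treeT ue) b3.
    by rewrite (se_eq gd ze zh3) eqxx.
  have [v1 v1F v1z] := att_ex az; have [v2 v2F v2y] := att_ex ay2.
  case: (cn_min C v1F v2F (se_all zh3) (se_all yh2) v1z v2y nlzy) => -[E1 E2]; subst v1 v2.
    exact: (augment_two_sides C E Sw Su wd nde b2 yh2 v2y ud3 n3 b3 zh3 v1z).
  rewrite -lf' in v2y; rewrite lf in v1z.
  exact: (augment_two_sides C' E Sw' Su' wd nde b2 yh2 v2y ud3 n3 b3 zh3 v1z).
have {}nu d' h' z : u \in val d' -> d' != e -> beyond d' u h' ->
    z \in se eta h' -> ~~ att f s z.
  move=> ud' nd' bh' zh'; have /existsPn/(_ h')/existsPn/(_ z) := nu d'.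
  by rewrite ud' nd' bh' zh'.
have nu' d' h' z : u \in val d' -> d' != e -> beyond d' u h' ->
    z \in se eta h' -> ~~ att f' s' z.
  by rewrite aE; apply: nu.
(* Nothing beyond [u] is attached, so [x] lies in the strip of [e] itself. *)
have h1e : h1 = e.
  apply/eqP; apply: contraTT ax1 => nh1.
  have [d' [ud' nd' bh']] := beyond_next treeT E b1 nh1.
  exact: nu ud' nd' bh' xh1.
subst h1; have nlxy : ~ local eta x y.
  move=> /(local_beyond smoothT gd ned we wd (beyond_self treeT we) b2 xh1 yh2)[].
  by rewrite (negbTE nx).
have [v1 v1F v1x] := att_ex ax1; have [v2 v2F v2y] := att_ex ay2.
case: (cn_min C v1F v2F (se_all xh1) (se_all yh2) v1x v2y nlxy) => -[E1 E2]; subst v1 v2.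
  exact: (augment_one_side C E Sw nu xh1 nx v1x wd nde b2 yh2 v2y).
rewrite -lf' in v2y; rewrite lf in v1x.
exact: (augment_one_side C' E Sw' nu' xh1 nx v1x wd nde b2 yh2 v2y).
Qed.

End Augment.

(** * Absorbing local components *)

Section Absorb.
Variables (G T : sgraph) (a : G) (eta : strip_map G T).
Implicit Types (w l : T) (e d h k : edge T) (x y z r f : G) (p q R s : seq G).
Hypotheses (tf : theta_free G) (pf : prism_free G).
Hypotheses (smoothT : smooth_tree T) (gd : good a eta).
Hypothesis (max_eta : ~ augmented a eta).

Let treeT : is_tree T := let: And3 H _ _ := smoothT in H.
Let sav : avoids_apex a eta. Proof. by case: (good_strip gd) => [[]]. Qed.
Let sS3 : strip3 eta. Proof. by case: (good_strip gd) => [[]]. Qed.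
Let sS4 : strip4 eta. Proof. by case: (good_strip gd) => [[]]. Qed.
Let sS5 : strip5 eta. Proof. by case: (good_strip gd) => _ []. Qed.
Let sS8 : strip8 a eta. Proof. by case: (good_strip gd) => _ []. Qed.

Definition rest : {set G} :=
  [set x | (x \notin eta_plus a eta) && `[< ~ is_jewel a eta x >]].

Definition joined := connect [rel x y | [&& x \in rest, y \in rest & sedge x y]].

(* The attachments of the component of [x] in the graph induced by [rest]. *)
Definition feet x : {set G} :=
  [set y in eta_all eta | [exists z in rest, joined x z && sedge z y]].

Definition nonlocal_walk n := exists f s x y,
  [/\ path (@sedge G) f s, {subset f :: s <= rest}, size s = n &
   [/\ x \in eta_all eta, y \in eta_all eta, sedge f x, sedge (last f s) y &
       ~ local eta x y]].

(** A smallest such walk, made induced, satisfies [cn_min], so [connecting_augment] contradicts the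
    maximality of [eta]. *)
Lemma no_nonlocal_walk n : ~ nonlocal_walk n.
Proof.
move=> W0; have exW : exists n, `[< nonlocal_walk n >] by exists n; apply/asboolP.
have [m /asboolP[f [s0 [x [y [p0 sub0 sz0 [xa ya fx gy nl]]]]]] minm] := ex_minnP exW.
have [s [ip ls ss]] := walk_ipath p0.
have subs : {subset f :: s <= rest}.
  by move=> z; rewrite inE => /orP[/eqP->|/ss zs]; apply: sub0; rewrite inE ?eqxx ?zs ?orbT.
have ps := ipath_path ip; rewrite -ls in gy.
have sm : size s <= m.
  by rewrite -sz0; apply: uniq_leq_size ss; case/andP: (ipath_uniq ip).
(* The part between two vertices that see a nonlocal pair is again such a walk, so by minimality it
   is the whole path. *)
have ends p1 u p2 p3 v p4 x' y' : f :: s = p1 ++ u :: p2 -> u :: p2 = p3 ++ v :: p4 ->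
    x' \in eta_all eta -> y' \in eta_all eta -> sedge u x' -> sedge v y' ->
    ~ local eta x' y' -> u = f /\ v = last f s.
  move=> E1 E2 xa' ya' ux vy nl'.
  have ip2 : ipath (u :: p2) by apply: (@ipath_catr _ p1); rewrite -?E1.
  have [t [pt lt st subt]] := sub_walk (ipath_path ip2) E2.
  have /minm : `[< nonlocal_walk (size t) >].
    apply/asboolP; exists u, t, x', y'; split=> //; last by rewrite lt.
    move=> z; rewrite inE => zt; apply: subs; rewrite E1 mem_cat inE.
    by case/orP: zt => [->|/subt->]; rewrite ?orbT.
  rewrite st => mp3; have := leq_trans sm mp3.
  have := congr1 size E1; have := congr1 size E2; rewrite !size_cat /= => s2 s1.
  move: s1; rewrite s2 !addnS => -[s1]; rewrite s1 addnCA => le.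
  move: le; rewrite -[X in _ <= X]addn0 leq_add2l leqn0 addn_eq0 !size_eq0.
  move=> /andP[/eqP p10 /eqP p40]; subst p1 p4; case: E1 => Ef Es.
  by split=> //; rewrite Es Ef -[last u p2]/(last u (u :: p2)) E2 last_cat.
apply: max_eta; apply: (@connecting_augment _ _ _ _ tf pf smoothT gd f s _ _ _ xa ya _ _ nl).
- split=> // [u /subs|u /subs|u v x' y' uF vF xa' ya' ux vy nl'].
  + by rewrite inE => /andP[].
  + by rewrite inE => /andP[_ /asboolP].
  have [p1 [p2 E1]] : exists p1 p2, f :: s = p1 ++ u :: p2.
    by case/splitPr: uF => p1 p2; exists p1, p2.
  have [v2|v1] : v \in u :: p2 \/ v \in p1.
  + by move: vF; rewrite E1 mem_cat orbC => /orP.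
  + have [p3 [p4 E2]] : exists p3 p4, u :: p2 = p3 ++ v :: p4.
      by case/splitPr: v2 => p3 p4; exists p3, p4.
    by left; apply: ends E1 E2 xa' ya' ux vy nl'.
  have [p3 [p4 E2]] : exists p3 p4, p1 = p3 ++ v :: p4.
    by case/splitPr: v1 => p3 p4; exists p3, p4.
  rewrite E2 -catA /= in E1.
  by have [|-> ->] := ends p3 v _ (v :: p4) u p2 y' x' E1 erefl ya' xa' vy ux _; 
    [move/local_sym | right].
- by apply: (att_intro (v := f)) fx; rewrite mem_head.
by apply: (att_intro (v := last f s)) gy; rewrite mem_last.
Qed.

Lemma restP x : reflect (x \notin eta_plus a eta /\ ~ is_jewel a eta x) (x \in rest).
Proof.
rewrite [x \in rest]in_set; apply: (iffP andP) => [[nx /asboolP]|[nx nj]]; split=> //.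
exact/asboolP.
Qed.

Lemma joined_sym : connect_sym [rel x y | [&& x \in rest, y \in rest & sedge x y]].
Proof.
apply: sym_connect_sym => x y /=; rewrite sedgeC.
by case: (x \in rest); case: (y \in rest).
Qed.

Lemma feetP x y : reflect (y \in eta_all eta /\ exists2 z, z \in rest &
  joined x z /\ sedge z y) (y \in feet x).
Proof.
rewrite [y \in feet x]in_set; apply: (iffP andP) => -[-> h]; split=> //.
  by case/existsP: h => z /and3P[zW xz zy]; exists z.
by case: h => z zW [xz zy]; apply/existsP; exists z; rewrite zW xz.
Qed.

Lemma feet_local x y z : y \in feet x -> z \in feet x -> local eta y z.
Proof.
move=> /feetP[ya [u uW [xu uy]]] /feetP[za [v vW [xv vz]]].
apply/asboolP/negPn/negP => /asboolP nl.
have /connectP[p pp lp] : joined u v by rewrite /joined (connect_trans _ xv) // joined_sym.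
apply: (@no_nonlocal_walk (size p)); exists u, p, y, z; split=> //.
- by apply: sub_path pp => c d /and3P[].
- move=> c; rewrite inE => /orP[/eqP->//|cp].
  elim: p u {uW xu uy lp} pp cp => //= d p IH u /andP[/and3P[_ dW _] pp].
  by rewrite inE => /orP[/eqP->//|]; apply: IH pp.
by rewrite -lp.
Qed.

Lemma feet_adj x y : x \in rest -> y \in rest -> sedge x y -> feet x = feet y.
Proof.
move=> xW yW xy; have jxy : joined x y by apply: connect1; rewrite /= xW yW.
by apply/setP=> z; apply/feetP/feetP=> -[za [c cW [xc cz]]]; split=> //;
  exists c => //; move: xc; rewrite /joined (same_connect joined_sym jxy).
Qed.

Lemma feet_mem x y : x \in rest -> y \in eta_all eta -> sedge x y -> y \in feet x.
Proof.
by move=> xW ya xy; apply/feetP; split=> //; exists x => //; rewrite /joined connect0.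
Qed.

Lemma sev_local x y e d : x \in se eta e -> y \in se eta d -> e != d ->
  local eta x y -> exists w : T, x \in sev eta e w /\ y \in sev eta d w.
Proof.
move=> xe yd ned [[h [xh yh]]|[w [/(eta_BP gd)[h xh] /(eta_BP gd)[k yk]]]].
  by move: ned; rewrite (se_eq gd xe xh) (se_eq gd yd yh) eqxx.
exists w; rewrite (se_eq gd xe (sev_se gd xh).1).
by rewrite (se_eq gd yd (sev_se gd yk).1).
Qed.

Lemma two_common_ends e d (u v : T) : u \in val e -> v \in val e ->
  u \in val d -> v \in val d -> u != v -> e = d.
Proof.
move=> ue ve ud vd nuv; have [w _ E] := edge_at ue.
have vw : v = w by case: (mem_edge2 E ve) nuv => ->; rewrite ?eqxx.
by apply/esym/(edge_eq E); rewrite -?vw.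
Qed.

(** Two feet in different strips [e], [d] determine [w]. A further foot, in a strip [h] and not at
    [w], would make [h] meet [e] and [d] away from [w], closing a triangle in [T]; if [h] is [e] or
    [d], these two would share both ends. *)
Lemma feet_dichotomy x : (exists w : T, feet x \subset eta_B eta w) \/
  (exists e, feet x \subset se eta e) \/ feet x = set0.
Proof.
have [->|/set0Pn[y yx]] := eqVneq (feet x) set0; first by right; right.
have [e ye] : exists e, y \in se eta e by apply/(eta_allP gd); case/feetP: yx.
have [sub|/subsetPn[z zx nze]] := boolP (feet x \subset se eta e).
  by right; left; exists e.
have [d zd] : exists e, z \in se eta e by apply/(eta_allP gd); case/feetP: zx.
have ned : e != d by apply: contraNneq nze => ->.
have [w [yw zw]] := sev_local ye zd ned (feet_local yx zx).
have [we wd] := ((sev_se gd yw).2, (sev_se gd zw).2).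
left; exists w; apply/subsetP=> t tx; apply/(eta_BP gd).
have [h th] : exists e, t \in se eta e by apply/(eta_allP gd); case/feetP: tx.
have key k c : c \in se eta k -> c \in feet x -> k != h -> w \in val k ->
    (exists2 v : T, v \in val h & v \in val k /\ t \in sev eta h v).
  move=> ck cx nkh wk; rewrite eq_sym in nkh.
  have [v [tv cv]] := sev_local th ck nkh (feet_local tx cx).
  by exists v; [case: (sev_se gd tv) | split=> //; case: (sev_se gd cv)].
exists h; have [he|nhe] := eqVneq e h.
  have ndh : d != h by rewrite -he eq_sym.
  have [v vh [vd tv]] := key d z zd zx ndh wd.
  have [<-//|nvw] := eqVneq v w.
  by move: ned; rewrite (two_common_ends (u := v) (v := w) (e := e) (d := d)) ?eqxx // he.
have [v vh [ve tv]] := key e y ye yx nhe we.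
have [<-//|nvw] := eqVneq v w.
have [hd|nhd] := eqVneq d h.
  by move: ned; rewrite (two_common_ends (u := v) (v := w) (e := e) (d := d)) ?eqxx // hd.
have [v' v'h [v'd _]] := key d z zd zx nhd wd.
(* Seen from [w], the edge [h] would lie beyond both [e] and [d]. *)
have bh : beyond e w h.
  apply/existsP; exists v; rewrite vh; have [u _ E] := edge_at we.
  by case: (mem_edge2 E ve) nvw => ->; rewrite ?eqxx // (far_end treeT E).
have [v'w|nv'w] := eqVneq v' w.
  by have := beyond_at treeT we bh; rewrite -v'w => /(_ v'h) hE; rewrite hE eqxx in nhe.
have bh' : beyond d w h.
  apply/existsP; exists v'; rewrite v'h; have [u _ E] := edge_at wd.
  by case: (mem_edge2 E v'd) nv'w => ->; rewrite ?eqxx // (far_end treeT E).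
by have := beyond_neq treeT ned we wd bh bh'; rewrite eqxx.
Qed.

(* Components with feet in some [B_eta(w)] are absorbed by [eta(w)]; the others
   have all their feet in one [eta(e)] and join it, away from its ends. *)
Definition hub x := [pick w : T | feet x \subset eta_B eta w].

Definition in_hub (w : T) : {set G} :=
  [set x in rest | (feet x != set0) && (hub x == Some w)].

Definition in_strip e : {set G} :=
  [set x in rest | [&& feet x != set0, hub x == None & feet x \subset se eta e]].

Definition absorb : strip_map G T := {|
  sv := in_hub;
  se := fun e => se eta e :|: in_strip e;
  sev := sev eta |}.

Lemma in_hubP w x : reflect [/\ x \in rest, feet x != set0 & hub x = Some w]
  (x \in in_hub w).
Proof.
rewrite [x \in in_hub w]in_set; apply: (iffP and3P) => -[xW x0 h]; split=> //; exact/eqP.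
Qed.

Lemma in_stripP e x : reflect
  [/\ x \in rest, feet x != set0, hub x = None & feet x \subset se eta e]
  (x \in in_strip e).
Proof.
rewrite [x \in in_strip e]in_set; apply: (iffP and4P) => -[xW x0 h s]; split=> //; exact/eqP.
Qed.

Lemma hub_some x w : hub x = Some w -> feet x \subset eta_B eta w.
Proof. by rewrite /hub; case: pickP => // v h [<-]. Qed.

Lemma hub_none x w : hub x = None -> ~~ (feet x \subset eta_B eta w).
Proof. by rewrite /hub; case: pickP => // h _; rewrite h. Qed.

Lemma hub_adj x y : x \in rest -> y \in rest -> sedge x y -> hub x = hub y.
Proof. by move=> xW yW xy; rewrite /hub (feet_adj xW yW xy). Qed.

Lemma rest_out x : x \in rest -> x \notin eta_plus a eta.
Proof. by case/restP. Qed.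

Lemma rest_se x e : x \in rest -> x \in se eta e = false.
Proof. by move=> /rest_out nx; apply/negP=> /(out_se gd nx); rewrite eqxx. Qed.

Lemma rest_sev x e w : x \in rest -> x \in sev eta e w = false.
Proof. by move=> xW; apply/negP=> /(sev_se gd)[]; rewrite rest_se. Qed.

Lemma absorb_seP e x : reflect (x \in se eta e \/ x \in in_strip e) (x \in se absorb e).
Proof. by rewrite in_setU; apply: orP. Qed.

Lemma absorb_se e : {subset se eta e <= se absorb e}.
Proof. by move=> x xe; apply/absorb_seP; left. Qed.

Lemma absorb_allP x : x \in eta_all absorb ->
  x \in eta_all eta \/ [/\ x \in rest & feet x != set0].
Proof.
rewrite in_setU => /orP[/bigcupP[v _ /in_hubP[xW x0 _]]|]; first by right.
move=> /bigcupP[e _ /absorb_seP[xe|/in_stripP[xW x0 _ _]]]; last by right.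
by left; apply/(eta_allP gd); exists e.
Qed.

Lemma absorb_all x : x \in eta_all eta -> x \in eta_all absorb.
Proof.
move=> /(eta_allP gd)[e xe]; rewrite in_setU; apply/orP; right.
by apply/bigcupP; exists e; rewrite ?subsetT // absorb_se.
Qed.

Lemma absorb_rest x : x \in rest -> feet x != set0 -> x \in eta_all absorb.
Proof.
move=> xW x0; rewrite in_setU; apply/orP; case hx: (hub x) => [w|].
  by left; apply/bigcupP; exists w => //; apply/in_hubP.
right; have [[w sw]|[[e se]|f0]] := feet_dichotomy x.
- by have := hub_none w hx; rewrite sw.
- apply/bigcupP; exists e; rewrite ?subsetT //; apply/absorb_seP; right.
  exact/in_stripP.
by rewrite f0 eqxx in x0.
Qed.

Lemma absorb_eta_int e : {subset eta_int eta e <= eta_int absorb e}.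
Proof.
by move=> x; rewrite !in_setD => /andP[nx xe]; rewrite absorb_se // andbT.
Qed.

Lemma absorb_orung e w u r R : orung eta e w u r R -> orung absorb e w u r R.
Proof. by case=> E ip sub hw hu; split=> // z /sub/absorb_se. Qed.

Lemma absorb_rung e (A : {set G}) : rung eta e A -> rung absorb e A.
Proof.
have [w [u E]] : exists w u : T, val e = [set w; u].
  by have /imsetP[[x y] _ E] := valP e; exists x, y.
move=> /rung_orung/(_ E)[r [R [OR ->]]].
exact: orung_rung (absorb_orung OR).
Qed.

Lemma joined_path x z : joined x z -> x \in rest ->
  exists p, [/\ path (@sedge G) x p, last x p = z &
    {in x :: p, forall y, [/\ y \in rest, feet y = feet x & hub y = hub x]}].
Proof.
case/connectP=> p pp -> xW; exists p; split=> //.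
  by apply: sub_path pp => c d /and3P[].
elim: p x xW pp => [|y p IH] x xW /=; first by move=> _ c; rewrite inE => /eqP->.
case/andP=> /and3P[_ yW xy] pp c; rewrite inE => /orP[/eqP->//|cp].
have [cW fc hc] := IH y yW pp c cp.
by rewrite fc hc (feet_adj xW yW xy) (hub_adj xW yW xy).
Qed.

(** For an absorbed [x] and an end [v] of [e], let [w] be the other end. As [x] has no hub, some
    foot [y] is not in [eta(e,w)]; the path runs through the component to [y] and then along a rung
    to [v], which cannot meet [eta(e,w)] after [y]. *)
Lemma absorb_strip5 : strip5 absorb.
Proof.
move=> e v ve x /absorb_seP[xe|xs].
  have [y [p [yv bp sp ip]]] := sS5 ve xe; exists y, p; split=> //.
    by apply: subset_trans sp _; apply/subsetP/absorb_se.
  by apply: subset_trans ip _; apply/subsetP/absorb_eta_int.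
have /in_stripP[xW x0 hx sx] := xs; have [w vw E'] := edge_at ve.
have E := edge_sym E'.
have /subsetPn[y yx nyw] := hub_none w hx.
have ye := subsetP sx _ yx; have /feetP[ya [z zW [xz zy]]] := yx.
have [r [R [OR yR]]] := good_tame gd E ye; have [_ ip sub hw hv] := OR.
have nys : y \notin sev eta e w.
  by apply: contra nyw => yw; apply/(eta_BP gd); exists e.
have [p1 [p2 EP]] : exists p1 p2, r :: R = p1 ++ y :: p2.
  by case/splitPr: yR => p1 p2; exists p1, p2.
have lE : last r R = last y p2 by apply: last_suffix EP.
have sp : {subset y :: p2 <= r :: R} by move=> c h; rewrite EP mem_cat h orbT.
have nws c : c \in y :: p2 -> c \notin sev eta e w.
  move=> cp; rewrite hw ?sp //; case: p1 EP => [|b p1] EP.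
    by case: EP nys => <- _; rewrite (orung_head OR).
  case: EP => rb ER; have /andP[nr _] := ipath_uniq ip.
  by apply: contraNneq nr => <-; rewrite ER mem_cat cp orbT.
have [p [pp lp hp]] := joined_path xz xW.
have pyp : path (@sedge G) y p2.
  by apply: ipath_path; apply: (@ipath_catr _ p1); rewrite -?EP.
have ppath : path (@sedge G) x (p ++ y :: p2) by rewrite cat_path pp lp /= zy.
have [q [iq lq sq]] := walk_ipath ppath.
have lq' : last x q = last r R by rewrite lq last_cat /= lE.
have instrip c : c \in x :: p -> c \in in_strip e.
  by move=> /hp[cW fc hc]; apply/in_stripP; rewrite fc hc.
have qP c : c \in x :: q -> c \in in_strip e \/ c \in y :: p2.
  rewrite inE => /orP[/eqP->|/sq]; first by left.
  rewrite mem_cat => /orP[cp|]; last by right.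
  by left; apply: instrip; rewrite inE cp orbT.
have qe c : c \in x :: q -> c \in se absorb e.
  by move=> /qP[cs|/sp/sub/absorb_se//]; apply/absorb_seP; right.
exists (last r R), (x :: q); split.
- exact: orung_last OR.
- by rewrite /ipath_between iq /= lq' !eqxx.
- by apply/subsetP=> c; rewrite in_set; apply: qe.
apply/subsetP=> c; rewrite in_setD in_set2 negb_or in_set => /andP[/andP[nx nl] cq].
rewrite in_setD (qe _ cq) andbT; apply/negP=> /bigcupP[t te ct].
case: (qP _ cq) => [/in_stripP[cW _ _ _]|cy]; first by rewrite /= rest_sev in ct.
have [tv|tw] := mem_edge2 E' te; rewrite /= ?tv ?tw in ct.
  by move: ct; rewrite hv ?sp // (negbTE nl).
by move: ct; apply/negP/nws.
Qed.

Lemma feet_out x y : y \in feet x -> ~~ sedge a y.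
Proof.
move=> /feetP[ya [z /rest_out nz [_ zy]]].
by apply/negP=> ay; have := out_apex2 gd nz ay; rewrite sedgeC zy.
Qed.

Lemma absorb_strip : strip_structure a absorb.
Proof.
have [ax1 ax2 ax3] := sav.
have aW : a \notin rest by apply/negP=> /rest_out; rewrite in_setU1 eqxx.
split; split.
- split=> [v|e|e v]; last exact: ax3.
    by apply/in_hubP=> -[aW']; rewrite aW' in aW.
  by apply/absorb_seP=> -[|/in_stripP[aW']]; [apply/negP/ax2 | rewrite aW' in aW].
- split=> [u v nuv|e h neh|v e]; rewrite disjoint_subset; apply/subsetP=> x.
  + move=> /in_hubP[_ _ hu]; apply/in_hubP=> -[_ _ hv].
    by rewrite hu in hv; case: hv nuv => ->; rewrite eqxx.
  + move=> /absorb_seP xe; apply/absorb_seP=> xh.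
    case: xe xh => [xe|/in_stripP[xW x0 _ se]] [xh|/in_stripP[xW' _ _ sh]].
    * by rewrite (se_eq gd xe xh) eqxx in neh.
    * by rewrite rest_se in xe.
    * by rewrite rest_se in xh.
    have /set0Pn[y yx] := x0.
    by rewrite (se_eq gd (subsetP se _ yx) (subsetP sh _ yx)) eqxx in neh.
  move=> /in_hubP[xW _ hx]; apply/absorb_seP=> -[|/in_stripP[_ _]].
    by rewrite rest_se.
  by rewrite hx.
(* The feet of a component absorbed at a leaf would be neighbours of [a], which vertices outside do
   not see. *)
- move=> l ll; apply/setP=> x; rewrite in_set0; apply/in_hubP=> -[xW /set0Pn[y yx] /hub_some sx].
  have /(eta_BP gd)[e ye] := subsetP sx _ yx; have := feet_out yx.
  by rewrite (sS8.1 l e ll (sev_se gd ye).2) ?inE.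
- move=> e v; have [sub E] := sS3 e v; split=> //.
  by apply: subset_trans sub _; apply/subsetP/absorb_se.
- move=> e h neh; split; first exact: (sS4 neh).1.
  have half e' h' x y : e' != h' -> x \in in_strip e' -> y \in se absorb h' -> sedge x y -> False.
    move=> ne /in_stripP[xW /set0Pn[t tx] _ sx] /absorb_seP[yh|/in_stripP[yW _ _ sy]] xy.
      have yx : y \in feet x by apply: feet_mem xy => //; apply/(eta_allP gd); exists h'.
      by rewrite (se_eq gd (subsetP sx _ yx) yh) eqxx in ne.
    rewrite -(feet_adj xW yW xy) in sy.
    by rewrite (se_eq gd (subsetP sx _ tx) (subsetP sy _ tx)) eqxx in ne.
  move=> x y xe yh xy.
  have [xe'|xs] := absorb_seP _ _ xe; last by case: (half _ _ _ _ neh xs yh xy).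
  have [yh'|ys] := absorb_seP _ _ yh; first exact: (sS4 neh).2 xe' yh' xy.
  by case: (half h e y x) => //; rewrite 1?sedgeC // eq_sym.
- exact: absorb_strip5.
- move=> v e x y /in_hubP[xW x0 hx]; rewrite in_setD => /andP[nye /absorb_seP ye].
  apply/negP=> xy; case: ye => [ye|/in_stripP[yW _ hy _]]; last first.
    by rewrite (hub_adj xW yW xy) hy in hx.
  have yx : y \in feet x by apply: feet_mem xy => //; apply/(eta_allP gd); exists e.
  have /(eta_BP gd)[h yh] := subsetP (hub_some hx) _ yx.
  by rewrite (se_eq gd ye (sev_se gd yh).1) /= yh in nye.
- move=> v D /imsetP[x xv ->]; have /in_hubP[xW /set0Pn[y yx] hx] := xv.
  have /feetP[ya [z zW [xz zy]]] := yx; exists z, y; split=> //; last first.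
    have /(eta_BP gd)[h yh] := subsetP (hub_some hx) _ yx.
    by apply/bigcupP; exists h; rewrite // (sev_se gd yh).2.
  have [p [pp lp hp]] := joined_path xz xW.
  have inh c : c \in x :: p -> c \in in_hub v.
    by move=> /hp[cW fc hc]; apply/in_hubP; rewrite fc hc; split=> //; apply/set0Pn; exists y.
  rewrite in_set; apply/andP; split; first by rewrite -lp inh ?mem_last.
  apply/connectP; exists p => //.
  elim: p x {xv xW y yx hx ya zy xz lp hp} pp inh => //= c p IH x /andP[xc pp] inh.
  have cp : {in c :: p, forall t, t \in in_hub v}.
    by move=> t tp; apply: inh; rewrite inE tp orbT.
  rewrite (IH c pp cp) andbT xc !andbT; apply/andP; split; first exact/inh/mem_head.
  exact/cp/mem_head.
split; first exact: sS8.1.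
move=> x /absorb_allP[xa ax|[xW _] ax]; first exact: sS8.2.
by have [_] := out_apex gd (rest_out xW); rewrite ax.
Qed.

Lemma absorb_substantial : substantial absorb.
Proof.
move=> e; have [w [u E]] : exists w u : T, val e = [set w; u].
  by have /imsetP[[x y] _ E] := valP e; exists x, y.
have [r [R [OR nR]]] := good_long gd E; exists [set x in r :: R].
split; first exact: orung_rung (absorb_orung OR).
have [_ ip _ _ _] := OR; rewrite cardsE (card_uniqP (ipath_uniq ip)) /=.
by case: (R) nR.
Qed.

Lemma absorb_plus x : x \in eta_plus a eta -> x \in eta_plus a absorb.
Proof. by rewrite !in_setU1 => /orP[->//|/absorb_all->]; rewrite orbT. Qed.

Lemma absorb_rich : rich a absorb.
Proof.
have [[tr1 tr2] r2] := good_rich gd; split; last exact: r2.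
split; first by move=> x /tr1/absorb_plus.
move=> x ax; rewrite -(tr2 x ax); congr #|pred_of_set _|; apply/setP=> y.
rewrite !in_setI; have [xy|//] /= := boolP (y \in nbhd x).
have ya : y \in eta_plus a eta.
  by apply: tr1; exists [:: x; y]; rewrite /= ax; split=> //; rewrite inE in xy; rewrite xy.
by rewrite ya absorb_plus.
Qed.

(** The legs consist of old vertices, so their intersections with the enlarged strips are the old
    rungs. *)
Lemma absorb_eta_pyramid v c b P :
  eta_pyramid a eta v c b P -> eta_pyramid a absorb v c b P.
Proof.
move=> [cl py legs]; split=> // i; have [bi [l [L [Gam [lL bL [EP pG] sG [lr rr]]]]]] := legs i.
split=> //; exists l, L, Gam.
have GamE e : Gam :&: se absorb e = Gam :&: se eta e.
  apply/setP=> x; rewrite !in_setI; have [xG|//] /= := boolP (x \in Gam).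
  apply/absorb_seP/idP=> [[//|/in_stripP[xW _ _ _]]|]; last by left.
  by have /bigcupP[h _] := subsetP sG _ xG; rewrite rest_se.
split=> //.
  apply/subsetP=> x /(subsetP sG)/bigcupP[h hL xh].
  by apply/bigcupP; exists h => //; apply: absorb_se.
split=> [|e eL nec]; rewrite GamE; last exact/absorb_rung/rr.
by case: lr => r1 r2; split=> //; apply: absorb_rung.
Qed.

Lemma absorb_jewel x : x \notin eta_plus a absorb ->
  is_jewel a eta x -> is_jewel a absorb x.
Proof.
move=> nx [v [e1 [e2 [bv [_ sg [e3 [b [P [ve3 ne3 py jw]]]]]]]]].
exists v, e1, e2; split=> //; split=> //; exists e3, b, P; split=> //.
exact: absorb_eta_pyramid.
Qed.

(** Such a vertex belongs to [rest], since old jewels outside the new structure are still jewels,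
    and it has no feet, since otherwise it would have been absorbed. An absorbed neighbour would lie
    in the same component and have the same empty set of feet. *)
Lemma absorb_anticomplete x : x \notin eta_plus a absorb ->
  ~ is_jewel a absorb x -> anticomplete [set x] (eta_plus a absorb).
Proof.
move=> nx nj y z; rewrite in_set1 => /eqP->{y} zp.
have xW : x \in rest.
  apply/restP; split; first by apply: contra nx; apply: absorb_plus.
  by move=> /(absorb_jewel nx).
have x0 : feet x = set0.
  apply/eqP/negPn/negP => x0; move: nx.
  by rewrite in_setU1 (absorb_rest xW x0) orbT.
apply/negP=> xz; move: zp; rewrite in_setU1 => /orP[/eqP za|/absorb_allP[za|[zW z0]]].
- by have [_] := out_apex gd (rest_out xW); rewrite -za sedgeC xz.
- by have := feet_mem xW za xz; rewrite x0 in_set0.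
by rewrite -(feet_adj xW zW xz) x0 eqxx in z0.
Qed.

End Absorb.

(** * Maximal structures and the conclusion *)

Lemma tame_good (G T : sgraph) (a : G) (eta : strip_map G T) :
  [/\ strip_structure a eta, tame eta, substantial eta & rich a eta] ->
  good a eta.
Proof.
move=> [st [sv0 tm] sb rc]; split=> //.
  move=> e w u z E ze; have [A rA zA] := tm e z ze.
  have [r [R [OR EA]]] := rung_orung rA E.
  by exists r, R; split=> //; rewrite EA inE in zA.
move=> e w u E; have [A [rA cA]] := sb e.
have [r [R [OR EA]]] := rung_orung rA E; exists r, R; split=> //.
have [_ ip _ _ _] := OR; move: cA.
by rewrite EA cardsE (card_uniqP (ipath_uniq ip)); case: (R).
Qed.

Lemma maximal_good (G T : sgraph) (a : G) (eta : strip_map G T) : good a eta ->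
  exists zeta : strip_map G T, good a zeta /\ ~ augmented a zeta.
Proof.
have [n] := ubnP (#|G| - #|eta_all eta|); elim: n => // n IH in eta *.
move=> lt gd; have [[zeta [gz cz]]|] := EM (augmented a eta); last by exists eta.
apply: (IH zeta) => //; rewrite -ltnS; apply: leq_trans lt; rewrite ltnS.
by apply: ltn_sub2l => //; apply: leq_trans cz (max_card _).
Qed.

Theorem theorem4p2 (G T : sgraph) (a : G) :
  theta_free G -> prism_free G -> smooth_tree T ->
  (exists eta : strip_map G T,
     [/\ strip_structure a eta, tame eta, substantial eta & rich a eta]) ->
  exists zeta : strip_map G T,
    [/\ strip_structure a zeta, substantial zeta, rich a zeta &
        forall x : G, x \notin eta_plus a zeta -> ~ is_jewel a zeta x ->
          anticomplete [set x] (eta_plus a zeta)].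
Proof.
move=> tf pf sT [eta0 /tame_good/maximal_good[eta [gd mx]]].
exists (absorb a eta); split.
- exact: absorb_strip.
- exact: absorb_substantial.
- exact: absorb_rich.
exact: absorb_anticomplete.
Qed.
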